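(* Let $\kappa_1,\kappa_2\in\mathbb{C}^2\setminus\{0\}$ be two spinors, and let $(\mathcal{h}_1,W_1)=\widetilde{\mathbf K}(\kappa_1)$ and $(\mathcal{h}_2,W_2)=\widetilde{\mathbf K}(\kappa_2)$ be the corresponding spin-decorated horospheres. Then $$\{\kappa_1,\kappa_2\}=\exp\left(\frac d2\right),$$ where $\{\cdot,\cdot\}$ is the inner product of spinors and $d$ is the complex distance from $(\mathcal{h}_1,W_1)$ to $(\mathcal{h}_2,W_2)$ (when the two horospheres have the same centre, the right-hand side is by convention $0$).
   Context: **Spinors, Hermitian matrices, Minkowski space.** A spinor is a vector $\kappa=(\xi,\eta)\in\mathbb{C}^2$, regarded as a column vector; $\mathbb{C}^2_\times=\mathbb{C}^2\setminus\{0\}$. The spinor inner product is $\{(\xi_1,\eta_1),(\xi_2,\eta_2)\}=\xi_1\eta_2-\xi_2\eta_1$. $\mathcal{H}$ is the real vector space of $2\times2$ Hermitian matrices and $\mathcal{H}_0^+=\{S\in\mathcal{H}:\det S=0,\ \mathrm{Trace}\,S>0\}$. $\mathbb{R}^{1,3}$ has coordinates $(T,X,Y,Z)$ and inner product $\langle p,p'\rangle=TT'-XX'-YY'-ZZ'$; $L^+=\{p:\langle p,p\rangle=0,\ T>0\}$. The linear isomorphism $\mathbf g\colon\mathcal{H}\to\mathbb{R}^{1,3}$ is $\mathbf g\begin{pmatrix}a&b+ci\\ b-ci&d\end{pmatrix}=(a+d,2b,2c,a-d)$; it restricts to a bijection $\mathcal{H}_0^+\to L^+$. Let $\mathbf f(\kappa)=\kappa\kappa^*$,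 which maps $\mathbb{C}^2_\times$ to $\mathcal{H}_0^+$, with real derivative $D_\kappa\mathbf f(\nu)=\kappa\nu^*+\nu\kappa^*$, and let $\mathcal{Z}(\xi,\eta)=(i\overline\eta,-i\overline\xi)$. **Flags.** A (pointed oriented null) flag in $\mathbb{R}^{1,3}$ (resp. $\mathcal{H}$) is a triple $(p,V,o)$ with $p\in L^+$ (resp. $p\in\mathcal{H}_0^+$), $V$ a 2-dimensional real subspace spanned by $p$ and some $v$ in the tangent space at $p$ to $L^+$ (resp. $\mathcal{H}_0^+$), and $o$ an orientation of the line $V/\mathbb{R}p$. For such linearly independent $p,v$, $[[p,v]]$ is the flag with $V=\mathrm{span}(p,v)$ and $o$ represented by $v+\mathbb{R}p$. The sets of flags are $\mathcal{F}_P^O(\mathbb{R}^{1,3})$, $\mathcal{F}_P^O(\mathcal{H})$. Define $\mathbf F(\kappa)=[[\mathbf f(\kappa),D_\kappa\mathbf f(\mathcal{Z}(\kappa))]]$ for $\kappa\in\mathbb{C}^2_\times$ and $\mathbf G(S,V,o)=(\mathbf g(S),\mathbf g(V),\mathbf g(o))$. **Horospheres and decorations.** The hyperboloid model is $\mathbb{H}=\{x\in\mathbb{R}^{1,3}:\langle x,x\rangle=1,\ T>0\}$ with metric $dX^2+dY^2+dZ^2-dT^2$. For $p\in L^+$, $\mathbf h(p)=\{x\in\mathbb{H}:\langle x,p\rangle=1\}$ is a horosphere (all horospheres arise uniquely this way), with centre the point of $\partial\mathbb{H}$ given by the ray through $p$. A decorated horosphere is a horosphere together with an oriented tangent line field on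 it which is parallel, i.e. invariant under all parabolic isometries preserving the horosphere; the set of these is $\mathfrak{H}_D$. $\mathbf H\colon\mathcal{F}_P^O(\mathbb{R}^{1,3})\to\mathfrak{H}_D(\mathbb{H})$ sends $(p,V,o)$ to $\mathbf h(p)$ with the line field $V\cap T_q\mathbf h(p)$, $q\in\mathbf h(p)$, each line oriented via its isomorphic projection to $(V/\mathbb{R}p,o)$. $\mathbb{D}$ is the conformal unit ball model and $\mathbb{U}=\{(x,y,z):z>0\}$ the upper half space model with metric $(dx^2+dy^2+dz^2)/z^2$ and $\partial\mathbb{U}=\mathbb{C}\cup\{\infty\}$. $\mathbf i\colon\mathbb{H}\to\mathbb{D}$, $\mathbf i(T,X,Y,Z)=\frac1{1+T}(X,Y,Z)$, and $\mathbf j\colon\mathbb{D}\to\mathbb{U}$ is the isometry extending $\partial\mathbb{D}\to\partial\mathbb{U}$, $(x,y,z)\mapsto\frac{x+iy}{1-z}$. $\mathbf I,\mathbf J$ are the maps on decorated horospheres induced by $\mathbf i,\mathbf j$ and their derivatives, and $\mathbf K=\mathbf J\circ\mathbf I\circ\mathbf H\circ\mathbf G\circ\mathbf F\colon\mathbb{C}^2_\times\to\mathfrak{H}_D(\mathbb{U})$. **Spin decorations.** A frame is a right-handed orthonormal frame $(f_1,f_2,f_3)$ at a point of $\mathbb{H}^3$. $\mathrm{Fr}\to\mathbb{H}^3$ is the principal $SO(3)$ bundle of frames and $\mathrm{Spin}$ its double (universal) cover, whose points are spin frames. On a horosphere, $N^{out}$ is the unit normal field pointing towards its centre and $N^{in}=-N^{out}$.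 For a unit parallel tangent vector field $\mathcal V$ on a horosphere, $f^{out}(\mathcal V)=(N^{out},\mathcal V,N^{out}\times\mathcal V)$ and $f^{in}(\mathcal V)=(N^{in},\mathcal V,N^{in}\times\mathcal V)$. An outward (inward) spin decoration is a continuous lift to $\mathrm{Spin}$ of some $f^{out}(\mathcal V)$ ($f^{in}(\mathcal V)$). The inward spin decoration associated to an outward one $W^{out}$ is obtained by rotating $W^{out}$ by angle $\pi$ about $\mathcal V$ at each point; the outward one associated to $W^{in}$ is obtained by rotating $W^{in}$ by $-\pi$ about $\mathcal V$ (right-handed rotations). A spin decoration is a pair $W=(W^{in},W^{out})$, each associated to the other. $\mathfrak{H}_D^S$ is the set of spin-decorated horospheres; the map sending $(W^{in},W^{out})$ to the decoration directed by $\mathcal V$ is a double (universal) covering $\mathfrak{H}_D^S\to\mathfrak{H}_D$. **The map $\widetilde{\mathbf K}$.** Since $\mathbb{C}^2_\times$ is simply connected, $\mathbf K$ lifts to a map $\widetilde{\mathbf K}\colon\mathbb{C}^2_\times\to\mathfrak{H}_D^S(\mathbb{U})$; fix such a lift. **Complex distance.** A frame (or spin frame) at a point of an oriented geodesic $\gamma$ is adapted to $\gamma$ if the first vector of (the underlying frame of) it is positively tangent to $\gamma$. If two spin frames at points of $\gamma$ are adapted to $\gamma$, the complex distance from the first to the second is $d=\rho+i\theta$, where translation along $\gamma$ by signed distance $\rho$ followed by (right-handed) rotation about $\gamma$ by angle $\theta$ takes the first to the second; it is well defined modulo $4\pi i$. For spin-decorated horospheres $(\mathcal{h}_1,W_1),(\mathcal{h}_2,W_2)$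 with distinct centres $p_1,p_2$, let $\gamma_{12}$ be the oriented geodesic from $p_1$ to $p_2$ and $q_i=\gamma_{12}\cap\mathcal{h}_i$; the complex distance from $(\mathcal{h}_1,W_1)$ to $(\mathcal{h}_2,W_2)$ is the complex distance $d$ from $W_1^{in}(q_1)$ to $W_2^{out}(q_2)$ along $\gamma_{12}$. The quantity $\lambda_{12}=\exp(d/2)$ is the complex lambda length, set equal to $0$ when the centres coincide. Here $\mathcal{h}$ denotes a horosphere. *)

(* Defs.v *)
From HB Require Import structures.
From mathcomp Require Import all_boot all_order all_algebra.
From mathcomp Require Import all_classical all_reals all_analysis.
From mathcomp Require Import complex.
From mathcomp Require Import ring lra.
Set Implicit Arguments.
Unset Strict Implicit.
Unset Printing Implicit Defensive.
Import Order.TTheory GRing.Theory Num.Theory.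
Import numFieldNormedType.Exports.
Local Open Scope classical_set_scope.
Local Open Scope ring_scope.
Local Open Scope complex_scope.
Local Open Scope sesquilinear_scope.

(* The topology of C is the norm topology that the library puts on the
   regular algebra of any numFieldType. *)
HB.instance Definition _ (R : realType) := NormedModule.copy R[i] R[i]^o.

Section Spinors.
Context {R : realType}.

Definition spinor := 'cV[R[i]]_2.

Definition spinor_ip (k1 k2 : spinor) : R[i] :=
  k1 0 0 * k2 1 0 - k2 0 0 * k1 1 0.

Definition cexp (z : R[i]) : R[i] :=
  (expR (complex.Re z))%:C * (cos (complex.Im z) +i* sin (complex.Im z)).

Definition spinor_f (k : spinor) : 'M[R[i]]_2 := k *m k ^t*.

Definition spinor_Df (k nu : spinor) : 'M[R[i]]_2 := k *m nu ^t* + nu *m k ^t*.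

Definition spinor_Z (k : spinor) : spinor :=
  \col_(a < 2) [:: 'i * (k 1 0)^*; - ('i * (k 0 0)^*)]`_a.

(* A flag (p, V, o).  The orientation o of the line V / Rp is encoded by the
   open half-plane of those vectors of V that project to the positive side. *)
Record flag (T : Type) := Flag {
  flag_pt : T;
  flag_plane : set T;
  flag_or : set T }.

(* [[S, v]] *)
Definition spanned_flag (S v : 'M[R[i]]_2) : flag 'M[R[i]]_2 :=
  Flag S [set w | exists a b : R, w = a%:C *: S + b%:C *: v]
         [set w | exists a b : R, 0 < b /\ w = a%:C *: S + b%:C *: v].

Definition map_F (k : spinor) : flag 'M[R[i]]_2 :=
  spanned_flag (spinor_f k) (spinor_Df k (spinor_Z k)).

(* Meaningful on Hermitian matrices [[a, b + ci], [b - ci, d]]. *)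
Definition map_g (S : 'M[R[i]]_2) : 'rV[R]_4 :=
  let a := complex.Re (S 0 0) in let d := complex.Re (S 1 1) in
  let b := complex.Re (S 0 1) in let c := complex.Im (S 0 1) in
  \row_(k < 4) [:: a + d; 2 * b; 2 * c; a - d]`_k.

Definition map_G (fl : flag 'M[R[i]]_2) : flag 'rV[R]_4 :=
  Flag (map_g (flag_pt fl)) (map_g @` flag_plane fl) (map_g @` flag_or fl).

End Spinors.
Arguments spinor : clear implicits.

Section Hyperboloid.
Context {R : realType}.
Implicit Types (p q x v u : 'rV[R]_4).

Definition mink p q : R :=
  p 0 0 * q 0 0 - p 0 1 * q 0 1 - p 0 2 * q 0 2 - p 0 3 * q 0 3.

Definition light_cone : set 'rV[R]_4 := [set p | mink p p = 0 /\ 0 < p 0 0].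

Definition hyperboloid : set 'rV[R]_4 := [set x | mink x x = 1 /\ 0 < x 0 0].

(* The ray through p; points of the boundary at infinity are such rays, for p
   in the light cone. *)
Definition ray p : set 'rV[R]_4 := [set x | exists2 a : R, 0 < a & x = a *: p].

Definition horosphere p : set 'rV[R]_4 :=
  [set x | hyperboloid x /\ mink x p = 1].

Definition tangent_horosphere p q : set 'rV[R]_4 :=
  [set u | mink u q = 0 /\ mink u p = 0].

Definition ch (t : R) : R := (expR t + expR (- t)) / 2.
Definition sh (t : R) : R := (expR t - expR (- t)) / 2.

(* The geodesic with unit initial velocity v at x; it runs from the ideal
   point ray (x - v) to the ideal point ray (x + v). *)
Definition geodesicH x v (t : R) : 'rV[R]_4 := ch t *: x + sh t *: v.

(* Right-handed orthonormal frames, the vectors being the rows of the matrix.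
   The metric of the hyperboloid is - mink; its orientation is the one for
   which the projection to (X, Y, Z) preserves orientation. *)
Definition frameH : set ('rV[R]_4 * 'M[R]_(3, 4)) :=
  [set xF | hyperboloid xF.1
    /\ (forall a, mink (row a xF.2) xF.1 = 0)
    /\ (forall a b, - mink (row a xF.2) (row b xF.2) = (a == b)%:R)
    /\ 0 < \det (col_mx xF.1 xF.2 : 'M[R]_4)].

(* Translation by t along the geodesic directed by the first vector of the
   frame: it is the Lorentz boost in the plane of this geodesic, which fixes
   the orthogonal complement of this plane. *)
Definition translateH (t : R) (xF : 'rV[R]_4 * 'M[R]_(3, 4)) :
    'rV[R]_4 * 'M[R]_(3, 4) :=
  let x := xF.1 in let v := row 0 xF.2 in
  (ch t *: x + sh t *: v,
   \matrix_a (if a == 0 then sh t *: x + ch t *: v else row a xF.2)).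

(* Orientation-preserving isometries of the hyperboloid, acting on rows. *)
Definition isometryH (L : 'M[R]_4) : Prop :=
  (forall x y, mink (x *m L) (y *m L) = mink x y)
  /\ (forall x, hyperboloid x -> hyperboloid (x *m L))
  /\ \det L = 1.

(* No fixed point in the hyperboloid and exactly one at infinity. *)
Definition parabolic (L : 'M[R]_4) : Prop :=
  isometryH L
  /\ (forall x, hyperboloid x -> x *m L <> x)
  /\ exists2 p, light_cone p &
       forall q, light_cone q -> (ray q (q *m L) <-> ray p q).

End Hyperboloid.

(* A set of points with an oriented line field on it: (q, u) belongs to dh_dir
   when u is a nonzero vector at q, along the line at q, in the positive
   direction. *)
Record dec_horosphere (R : realType) (n : nat) := DecHorosphere {
  dh_set : set 'rV[R]_n;
  dh_dir : set ('rV[R]_n * 'rV[R]_n) }.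

Section Models.
Context {R : realType}.

Definition map_H (fl : flag 'rV[R]_4) : dec_horosphere R 4 :=
  let p := flag_pt fl in
  DecHorosphere (horosphere p)
    [set qu | horosphere p qu.1
      /\ (flag_plane fl `&` tangent_horosphere p qu.1) qu.2
      /\ flag_or fl qu.2].

Definition is_dec_horosphereH (h : dec_horosphere R 4) : Prop :=
  exists p, light_cone p /\ dh_set h = horosphere p
  /\ (forall q u, dh_dir h (q, u) -> dh_set h q)
  /\ (forall q, dh_set h q -> exists u, u != 0 /\ tangent_horosphere p q u
        /\ forall v, dh_dir h (q, v) <-> ray u v)
  /\ (forall L, parabolic L -> [set q *m L | q in dh_set h] = dh_set h ->
        forall q u, dh_dir h (q, u) -> dh_dir h (q *m L, u *m L)).

Definition push_dec (m n : nat) (f : 'rV[R]_m.+1 -> 'rV[R]_n.+1)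
    (h : dec_horosphere R m.+1) : dec_horosphere R n.+1 :=
  DecHorosphere (f @` dh_set h)
    [set (f qu.1, 'd f (qu.1) qu.2) | qu in dh_dir h].

(* i, by the same formula on all of R^{1,3} *)
Definition map_i (p : 'rV[R]_4) : 'rV[R]_3 :=
  (1 + p 0 0)^-1 *: \row_(k < 3) [:: p 0 1; p 0 2; p 0 3]`_k.

Definition sqn (v : 'rV[R]_3) : R := v 0 0 ^+ 2 + v 0 1 ^+ 2 + v 0 2 ^+ 2.

(* j: the inversion that extends stereographic projection from the north pole;
   see map_j_boundary and map_j_isometry below. *)
Definition map_j (v : 'rV[R]_3) : 'rV[R]_3 :=
  (v 0 0 ^+ 2 + v 0 1 ^+ 2 + (1 - v 0 2) ^+ 2)^-1 *:
    \row_(k < 3) [:: 2 * v 0 0; 2 * v 0 1; 1 - sqn v]`_k.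

Lemma map_j_boundary (v : 'rV[R]_3) : sqn v = 1 -> v 0 2 != 1 ->
  map_j v = \row_(k < 3) [:: v 0 0 / (1 - v 0 2); v 0 1 / (1 - v 0 2); 0]`_k.
Proof.
rewrite /sqn => v1 z1.
have z1' : 1 - v 0 2 != 0 by rewrite subr_eq0 eq_sym.
have E : v 0 0 ^+ 2 + v 0 1 ^+ 2 + (1 - v 0 2) ^+ 2 = 2 * (1 - v 0 2).
  by rewrite -[X in _ = 2 * (X - _)]v1; move: v1; lra.
rewrite /map_j E /sqn v1 subrr; apply/rowP => k; rewrite !mxE.
case: k => [[|[|[|//]]] ?] /=; last by rewrite mulr0.
all: by field.
Qed.

Lemma map_j_origin : map_j 0 = \row_(k < 3) [:: 0; 0; 1]`_k.
Proof.
apply/rowP => k; rewrite /map_j /sqn !mxE.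
by case: k => [[|[|[|//]]] ?] /=; field.
Qed.

(* Both sides are cosh d - 1, for the hyperbolic distances of the upper half
   space and of the ball. *)
Lemma map_j_isometry (v w : 'rV[R]_3) : sqn v < 1 -> sqn w < 1 ->
  sqn (map_j v - map_j w) / (2 * map_j v 0 2 * map_j w 0 2) =
  2 * sqn (v - w) / ((1 - sqn v) * (1 - sqn w)).
Proof.
have pos (a b c : R) : a ^+ 2 + b ^+ 2 + c ^+ 2 < 1 ->
    a ^+ 2 + b ^+ 2 + (1 - c) ^+ 2 != 0 /\
    1 - (a ^+ 2 + b ^+ 2 + c ^+ 2) != 0.
  by move=> lt1; split; apply: lt0r_neq0; nra.
rewrite /map_j /sqn !mxE /=.
move: (v 0 0) (v 0 1) (v 0 2) (w 0 0) (w 0 1) (w 0 2) => a b c a' b' c'.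
move=> /pos[d1 e1] /pos[d2 e2]; field.
by rewrite ?d1 ?d2 ?e1 ?e2.
Qed.

Definition map_K (k : spinor R) : dec_horosphere R 3 :=
  push_dec map_j (push_dec map_i (map_H (map_G (map_F k)))).

Definition is_dec_horosphere (h : dec_horosphere R 3) : Prop :=
  exists2 h', is_dec_horosphereH h' & h = push_dec map_j (push_dec map_i h').

(* The isometry from the hyperboloid to the upper half space, and its
   derivative. *)
Definition map_ji (x : 'rV[R]_4) : 'rV[R]_3 := map_j (map_i x).

Definition dmap_ji (x u : 'rV[R]_4) : 'rV[R]_3 :=
  'd map_j (map_i x) ('d map_i x u).

(* The centre of a horosphere of the upper half space, as an ideal point of
   the hyperboloid. *)
Definition centre (h : set 'rV[R]_3) : set 'rV[R]_4 :=
  [set x | exists p, light_cone p /\ h = map_ji @` horosphere p /\ ray p x].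

Definition metricU (q u v : 'rV[R]_3) : R :=
  (u 0 0 * v 0 0 + u 0 1 * v 0 1 + u 0 2 * v 0 2) / q 0 2 ^+ 2.

Definition frame : Type := ('rV[R]_3 * 'M[R]_3)%type.

(* Fr; the vectors of a frame are the rows of the matrix. *)
Definition frameU : set frame :=
  [set f : frame | 0 < f.1 0 2
    /\ (forall a b, metricU f.1 (row a f.2) (row b f.2) = (a == b)%:R)
    /\ 0 < \det f.2].

Definition push_frame (xF : 'rV[R]_4 * 'M[R]_(3, 4)) : frame :=
  (map_ji xF.1, \matrix_a dmap_ji xF.1 (row a xF.2)).

(* Right-handed rotation by the angle t about the k-th vector of the frame;
   indices are taken modulo 3. *)
Definition rotate_frame (k : 'I_3) (t : R) (f : frame) : frame :=
  (f.1, \matrix_a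
     (if a == k then row k f.2
      else if a == k + 1 then cos t *: row (k + 1) f.2 + sin t *: row (k + 2) f.2
      else cos t *: row (k + 2) f.2 - sin t *: row (k + 1) f.2)).

(* The outward unit normal of a horosphere at q: the geodesic from q with
   initial velocity n ends at the centre. *)
Definition outward_normal (h : set 'rV[R]_3) (q n : 'rV[R]_3) : Prop :=
  exists p x N : 'rV[R]_4,
    light_cone p /\ h = map_ji @` horosphere p /\
    horosphere p x /\ q = map_ji x /\ n = dmap_ji x N /\
    mink N x = 0 /\ - mink N N = 1 /\
    (forall u, tangent_horosphere p x u -> mink N u = 0) /\
    ray p (x + N).

(* f is the frame f^out(V) (resp. f^in(V)) at q, where V is the unit vector
   field directing h.  The third vector is the cross product of the first two
   because frames are right-handed. *)
Definition is_fout (h : dec_horosphere R 3) (q : 'rV[R]_3) (f : frame) : Prop :=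
  frameU f /\ f.1 = q /\ outward_normal (dh_set h) q (row 0 f.2)
  /\ dh_dir h (q, row 1 f.2).

Definition is_fin (h : dec_horosphere R 3) (q : 'rV[R]_3) (f : frame) : Prop :=
  frameU f /\ f.1 = q /\ outward_normal (dh_set h) q (- row 0 f.2)
  /\ dh_dir h (q, row 1 f.2).

(* An oriented geodesic of the upper half space, parametrised by arc length,
   between two ideal points given as rays of the light cone. *)
Definition oriented_geodesic (g : R -> 'rV[R]_3) (from to : set 'rV[R]_4) : Prop :=
  exists x v : 'rV[R]_4, hyperboloid x /\ mink v x = 0 /\ - mink v v = 1
    /\ g = map_ji \o geodesicH x v /\ from (x - v) /\ to (x + v).

Definition adapted (g : R -> 'rV[R]_3) (f : frame) : Prop :=
  exists t a : R, 0 < a /\ f.1 = g t /\ row 0 f.2 = a *: derive1 g t.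

End Models.
Arguments frame : clear implicits.
Arguments frameU : clear implicits.

Section Coverings.
Context {E B : topologicalType}.

(* p is a two-sheeted covering of the subspace A of B. *)
Definition double_covering (A : set B) (p : E -> B) : Prop :=
  continuous p /\ p @` setT = A /\
  forall b, A b -> exists2 U, open_nbhs b U &
    exists V : bool -> set E,
      (forall i, open (V i)) /\ V true `&` V false = set0 /\
      p @^-1` U = V true `|` V false /\
      forall i, set_bij (V i) (U `&` A) p /\
        forall O, open O -> O `<=` V i ->
          exists2 O', open O' & p @` O = O' `&` A.

End Coverings.

Definition simply_connected (R : realType) (E : topologicalType) : Prop :=
  let I := `[0, 1]%classic : set R in
  (exists x : E, True) /\
  (forall x y : E, exists c : R -> E,
     {within I, continuous c} /\ c 0 = x /\ c 1 = y) /\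
  (forall c : R -> E, {within I, continuous c} -> c 0 = c 1 ->
     exists H : R * R -> E, {within I `*` I, continuous H} /\
       (forall t, I t -> H (t, 0) = c t /\ H (t, 1) = c 0) /\
       (forall s, I s -> H (0, s) = c 0 /\ H (1, s) = c 0)).

(* pr : Spin -> Fr is the double cover of the frame bundle and it is a
   universal cover; this determines it up to isomorphism. *)
Definition is_spin_bundle (R : realType) (Spin : topologicalType)
    (pr : Spin -> frame R) : Prop :=
  double_covering (frameU R) pr /\ simply_connected R Spin.

Section Spin.
Context {R : realType} {Spin : topologicalType}.
Variable pr : Spin -> frame R.

(* The path c of frames lifts to a path of spin frames that is at s at time 0
   and at s' at time t (t may be negative). *)
Definition lifts_to (c : R -> frame R) (t : R) (s s' : Spin) : Prop :=
  exists sigma : R -> Spin, continuous sigma /\ (forall u, pr (sigma u) = c u)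
    /\ sigma 0 = s /\ sigma t = s'.

Definition spin_rotate (k : 'I_3) (t : R) (s s' : Spin) : Prop :=
  lifts_to (fun u => rotate_frame k u (pr s)) t s s'.

(* Translation along the geodesic to which s is adapted. *)
Definition spin_translate (t : R) (s s' : Spin) : Prop :=
  exists xF, frameH xF /\ push_frame xF = pr s /\
    lifts_to (fun u => push_frame (translateH u xF)) t s s'.

Definition complex_distance_along (g : R -> 'rV[R]_3) (s1 s2 : Spin)
    (d : R[i]) : Prop :=
  adapted g (pr s1) /\ adapted g (pr s2) /\
  exists s, spin_translate (complex.Re d) s1 s
    /\ spin_rotate 0 (complex.Im d) s s2.

(* A spin-decorated horosphere, over the decorated horosphere sd_dec.  Only the
   values of sd_in and sd_out on the horosphere are meaningful. *)
Record spin_dec_horosphere := SpinDecHorosphere {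
  sd_dec : dec_horosphere R 3;
  sd_in : 'rV[R]_3 -> Spin;
  sd_out : 'rV[R]_3 -> Spin;
  sd_decP : is_dec_horosphere sd_dec;
  sd_in_continuous : {within dh_set sd_dec, continuous sd_in};
  sd_out_continuous : {within dh_set sd_dec, continuous sd_out};
  sd_in_lift : forall q, dh_set sd_dec q -> is_fin sd_dec q (pr (sd_in q));
  sd_out_lift : forall q, dh_set sd_dec q -> is_fout sd_dec q (pr (sd_out q));
  sd_in_of_out : forall q, dh_set sd_dec q -> spin_rotate 1 pi (sd_out q) (sd_in q);
  sd_out_of_in : forall q, dh_set sd_dec q ->
    spin_rotate 1 (- pi) (sd_in q) (sd_out q) }.

Definition complex_distance (W1 W2 : spin_dec_horosphere) (d : R[i]) : Prop :=
  let h1 := dh_set (sd_dec W1) in let h2 := dh_set (sd_dec W2) in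
  exists g q1 q2, oriented_geodesic g (centre h1) (centre h2)
    /\ (range g `&` h1) q1 /\ (range g `&` h2) q2
    /\ complex_distance_along g (sd_in W1 q1) (sd_out W2 q2) d.

HB.instance Definition _ := gen_eqMixin spin_dec_horosphere.
HB.instance Definition _ := gen_choiceMixin spin_dec_horosphere.

Definition sd_meets (O : set Spin) : set spin_dec_horosphere :=
  [set W | exists2 q, dh_set (sd_dec W) q & O (sd_out W q)].

(* Every spin frame lies on exactly one outward spin decoration, so the set of
   spin-decorated horospheres is a quotient of Spin; the quotient map is open,
   and the images of open sets generate the topology. *)
HB.instance Definition _ :=
  isSubBaseTopological.Build spin_dec_horosphere [set O | open O] sd_meets.

Definition is_spin_lift (Kt : spinor R -> spin_dec_horosphere) : Prop :=
  {within [set k | k != 0], continuous Kt} /\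
  forall k, k != 0 -> sd_dec (Kt k) = map_K k.

End Spin.

(* Main.v *)
Require Import Defs.
From HB Require Import structures.
From mathcomp Require Import all_boot all_order all_algebra.
From mathcomp Require Import all_classical all_reals all_analysis.
From mathcomp Require Import complex ring lra.
Import Order.TTheory GRing.Theory Num.Theory numFieldNormedType.Exports.

(** A pair of spinors (k, b) with {k, b} = 1 is a matrix A of SL(2, C) with
    columns k and b.  Hermitian matrices turn it into a right-handed
    orthonormal frame [frH k b] of the hyperboloid, the image under A of the
    frame attached to the identity matrix; [frU k b] is the corresponding
    frame of the upper half space.  This realises SL(2, C) as a double cover
    of the frame bundle, and three facts make it useful here.

    - Right multiplication moves frames by screw motions: the matrices
      diag(e^{t/2}, e^{-t/2}) and diag(e^{it/2}, e^{-it/2}) translate along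
      the first vector and rotate about it, and a real rotation matrix of angle
      t/2 rotates about the second vector ([translate_frH], [rotate0_frH],
      [rotate1_frH]).

    - The frames f^out of the decorated horosphere K(k) are exactly the
      [frU k b] for the spinors b with {k, b} = 1 ([is_fout_frU],
      [horosphereP]): replacing b by b + z k moves the frame along the
      horosphere.

    - A frame determines its matrix up to sign ([frU_inj]).

    Given the lift Kt, let [spin_frame k b] be the value of the outward spin
    decoration of Kt k at the point of [frU k b].  It is a lift of [frU] to
    spin frames, and the continuity of Kt makes it continuous in (k, b)
    ([spin_frame_continuous]).  Since lifts of paths are unique, every rotation
    or translation of a spin frame [spin_frame A] is [spin_frame] of the
    corresponding product of matrices.  In particular the inward decoration of
    Kt k1 at the point of [frU k1 b1] is [spin_frame b1 (- k1)]
    ([sd_in_spin_frame]), and going the complex distance d from it leads to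
    [spin_frame] of (e^{d/2} b1, - e^{-d/2} k1) ([spin_screwE]).  If this is
    the outward spin frame [spin_frame k2 b2], then k2 = e^{d/2} b1, so that
    {k1, k2} = e^{d/2} {k1, b1} = e^{d/2}.

    This last step requires [spin_frame] to be injective, that is, to separate
    A from - A.  It does, because these matrices differ by a full turn, and the
    lift of a full turn to spin frames is not closed: a homotopy from such a
    loop to a constant, in the simply connected space of spin frames, would
    give a contraction of the loop of rotations by the angles of [0, 2 pi] in
    SO(3).  Lifting the contraction to unit quaternions shows that there is
    none ([rotation_loop_not_contractible]). *)

Set Implicit Arguments.
Unset Strict Implicit.
Unset Printing Implicit Defensive.
Local Open Scope classical_set_scope.
Local Open Scope ring_scope.
Local Open Scope complex_scope.
Local Open Scope sesquilinear_scope.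

(** * Spinors and Minkowski vectors in coordinates *)

Notation Re := complex.Re.
Notation Im := complex.Im.

(** The polarisation of [nullv].  Both are locked, because conversion would
    otherwise expand matrices into coordinates. *)
HB.lock Definition herm (R : realType) (k b : spinor R) : 'rV[R]_4 :=
  map_g (spinor_Df k b).
HB.lock Definition nullv (R : realType) (k : spinor R) : 'rV[R]_4 :=
  map_g (spinor_f k).

Section Rows.
Context {R : realType}.

Lemma row4P (p q : 'rV[R]_4) :
  p 0 0 = q 0 0 -> p 0 1 = q 0 1 -> p 0 2 = q 0 2 -> p 0 3 = q 0 3 -> p = q.
Proof.
move=> e0 e1 e2 e3; apply/rowP => j; case: j => [[|[|[|[|//]]]] h].
- by rewrite (_ : Ordinal h = 0) //; apply/val_inj.
- by rewrite (_ : Ordinal h = 1) //; apply/val_inj.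
- by rewrite (_ : Ordinal h = 2) //; apply/val_inj.
- by rewrite (_ : Ordinal h = 3) //; apply/val_inj.
Qed.

Lemma row3P (p q : 'rV[R]_3) :
  p 0 0 = q 0 0 -> p 0 1 = q 0 1 -> p 0 2 = q 0 2 -> p = q.
Proof.
move=> e0 e1 e2; apply/rowP => j; case: j => [[|[|[|//]]] h].
- by rewrite (_ : Ordinal h = 0) //; apply/val_inj.
- by rewrite (_ : Ordinal h = 1) //; apply/val_inj.
- by rewrite (_ : Ordinal h = 2) //; apply/val_inj.
Qed.

Definition row4 (a b c d : R) : 'rV[R]_4 := \row_(j < 4) [:: a; b; c; d]`_j.
Definition row3 (a b c : R) : 'rV[R]_3 := \row_(j < 3) [:: a; b; c]`_j.

Lemma row4E (p : 'rV[R]_4) : p = row4 (p 0 0) (p 0 1) (p 0 2) (p 0 3).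
Proof. by apply: row4P; rewrite mxE. Qed.
Lemma row3_inj a b c a' b' c' :
  row3 a b c = row3 a' b' c' -> [/\ a = a', b = b' & c = c'].
Proof.
move/rowP => h; split.
- by have := h 0; rewrite !mxE.
- by have := h 1; rewrite !mxE.
- by have := h 2; rewrite !mxE.
Qed.

Lemma row4D a b c d a' b' c' d' :
  row4 a b c d + row4 a' b' c' d' = row4 (a + a') (b + b') (c + c') (d + d').
Proof. by apply: row4P; rewrite !mxE. Qed.
Lemma row4N a b c d : - row4 a b c d = row4 (- a) (- b) (- c) (- d).
Proof. by apply: row4P; rewrite !mxE. Qed.
Lemma row4Z e a b c d : e *: row4 a b c d = row4 (e * a) (e * b) (e * c) (e * d).
Proof. by apply: row4P; rewrite !mxE. Qed.
Definition row4_lin := (row4D, row4N, row4Z).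
Lemma row3D a b c a' b' c' :
  row3 a b c + row3 a' b' c' = row3 (a + a') (b + b') (c + c').
Proof. by apply: row3P; rewrite !mxE. Qed.
Lemma row3Z e a b c : e *: row3 a b c = row3 (e * a) (e * b) (e * c).
Proof. by apply: row3P; rewrite !mxE. Qed.

Lemma mink4 a b c d a' b' c' d' : mink (row4 a b c d) (row4 a' b' c' d') =
  a * a' - b * b' - c * c' - d * d'.
Proof. by rewrite /mink !mxE. Qed.

End Rows.

Section SpinorCoordinates.
Context {R : realType}.
Implicit Types (k b : spinor R) (z : R[i]).

Lemma imaginaryE : 'i%R = Complex 0 1 :> R[i]. Proof. by rewrite -complexiE. Qed.

Lemma colP2 k b : k 0 0 = b 0 0 -> k 1 0 = b 1 0 -> k = b.
Proof.
move=> e0 e1; apply/colP => j; case: j => [[|[|//]] h].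
- by rewrite (_ : Ordinal h = 0) //; apply/val_inj.
- by rewrite (_ : Ordinal h = 1) //; apply/val_inj.
Qed.

Lemma complexP z z' : Re z = Re z' -> Im z = Im z' -> z = z'.
Proof. by case: z z' => [? ?] [? ?] /= -> ->. Qed.

Lemma ReM z z' : Re (z * z') = Re z * Re z' - Im z * Im z'.
Proof. by case: z z' => [? ?] [? ?]. Qed.
Lemma ImM z z' : Im (z * z') = Re z * Im z' + Im z * Re z'.
Proof. by case: z z' => [? ?] [? ?]. Qed.
Lemma ReD z z' : Re (z + z') = Re z + Re z'.
Proof. by case: z z' => [? ?] [? ?]. Qed.
Lemma ImD z z' : Im (z + z') = Im z + Im z'.
Proof. by case: z z' => [? ?] [? ?]. Qed.
Lemma ReN z : Re (- z) = - Re z. Proof. by case: z. Qed.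
Lemma ImN z : Im (- z) = - Im z. Proof. by case: z. Qed.
Lemma ReJ z : Re (z^*%R) = Re z. Proof. by case: z. Qed.
Lemma ImJ z : Im (z^*%R) = - Im z. Proof. by case: z. Qed.
Definition cE := (ReM, ImM, ReD, ImD, ReN, ImN, ReJ, ImJ).

Lemma spinor_DfE k b i j :
  spinor_Df k b i j = k i 0 * (b j 0)^*%R + b i 0 * (k j 0)^*%R.
Proof. by rewrite !mxE !big_ord1 !mxE. Qed.

Lemma spinor_fE k i j : spinor_f k i j = k i 0 * (k j 0)^*%R.
Proof. by rewrite !mxE !big_ord1 !mxE. Qed.

Lemma hermE k b : herm k b = row4
  (2 * (Re (k 0 0) * Re (b 0 0) + Im (k 0 0) * Im (b 0 0)
       + (Re (k 1 0) * Re (b 1 0) + Im (k 1 0) * Im (b 1 0))))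
  (2 * (Re (k 0 0) * Re (b 1 0) + Im (k 0 0) * Im (b 1 0)
       + Re (b 0 0) * Re (k 1 0) + Im (b 0 0) * Im (k 1 0)))
  (2 * (Im (k 0 0) * Re (b 1 0) - Re (k 0 0) * Im (b 1 0)
       + Im (b 0 0) * Re (k 1 0) - Re (b 0 0) * Im (k 1 0)))
  (2 * (Re (k 0 0) * Re (b 0 0) + Im (k 0 0) * Im (b 0 0)
       - (Re (k 1 0) * Re (b 1 0) + Im (k 1 0) * Im (b 1 0)))).
Proof.
by apply: row4P; rewrite herm.unlock /map_g [in LHS]mxE [in RHS]mxE /= !spinor_DfE !cE; ring.
Qed.

Lemma nullvE k : nullv k = row4
  (Re (k 0 0) ^+ 2 + Im (k 0 0) ^+ 2 + (Re (k 1 0) ^+ 2 + Im (k 1 0) ^+ 2))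
  (2 * (Re (k 0 0) * Re (k 1 0) + Im (k 0 0) * Im (k 1 0)))
  (2 * (Im (k 0 0) * Re (k 1 0) - Re (k 0 0) * Im (k 1 0)))
  (Re (k 0 0) ^+ 2 + Im (k 0 0) ^+ 2 - (Re (k 1 0) ^+ 2 + Im (k 1 0) ^+ 2)).
Proof.
by apply: row4P; rewrite nullv.unlock /map_g [in LHS]mxE [in RHS]mxE /= !spinor_fE !cE; ring.
Qed.

Lemma scale_spinorE z k i : (z *: k) i 0 = z * k i 0.
Proof. by rewrite mxE. Qed.
Lemma add_spinorE k b i : (k + b) i 0 = k i 0 + b i 0.
Proof. by rewrite mxE. Qed.
Lemma opp_spinorE k i : (- k) i 0 = - k i 0.
Proof. by rewrite mxE. Qed.
Definition linE := (scale_spinorE, add_spinorE, opp_spinorE).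

Lemma ip_re k b : Re (spinor_ip k b) =
  Re (k 0 0) * Re (b 1 0) - Im (k 0 0) * Im (b 1 0)
  - (Re (b 0 0) * Re (k 1 0) - Im (b 0 0) * Im (k 1 0)).
Proof. by rewrite /spinor_ip !cE. Qed.
Lemma ip_im k b : Im (spinor_ip k b) =
  Re (k 0 0) * Im (b 1 0) + Im (k 0 0) * Re (b 1 0)
  - (Re (b 0 0) * Im (k 1 0) + Im (b 0 0) * Re (k 1 0)).
Proof. by rewrite /spinor_ip !cE. Qed.

Local Ltac atoms k :=
  move: (Re (k 0 0)) (Im (k 0 0)) (Re (k 1 0)) (Im (k 1 0)) => ? ? ? ?.

Definition nsq z : R := Re z ^+ 2 + Im z ^+ 2.

(** The spinor inner product refines the Minkowski product: its squared modulus
    is half of the product of the null vectors. *)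
Lemma mink_nullv k b : mink (nullv k) (nullv b) = 2 * nsq (spinor_ip k b).
Proof. rewrite /nsq !nullvE mink4 ip_re ip_im; atoms k; atoms b; ring. Qed.

Lemma mink_nullv_herm k b b' :
  mink (nullv k) (herm b b') =
  4 * (Re (spinor_ip k b) * Re (spinor_ip k b') + Im (spinor_ip k b) * Im (spinor_ip k b')).
Proof. rewrite !nullvE !hermE mink4 !ip_re !ip_im; atoms k; atoms b; atoms b'; ring. Qed.

Lemma mink_herm k b k' b' :
  mink (herm k b) (herm k' b') =
  4 * (Re (spinor_ip k k') * Re (spinor_ip b b') + Im (spinor_ip k k') * Im (spinor_ip b b')
  + Re (spinor_ip k b') * Re (spinor_ip b k') + Im (spinor_ip k b') * Im (spinor_ip b k')).
Proof. rewrite !hermE mink4 !ip_re !ip_im; atoms k; atoms b; atoms k'; atoms b'; ring. Qed.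
End SpinorCoordinates.

(** * The isometry from the hyperboloid to the upper half space *)

Section Differentials.
Context {R : realType}.

Lemma is_diff_coord n (x : 'rV[R]_n.+1) j :
  is_diff x (fun p : 'rV[R]_n.+1 => p 0 j) (fun p => p 0 j).
Proof.
have lc : linear (fun p : 'rV[R]_n.+1 => p 0 j : R) by move=> a p q; rewrite !mxE.
pose c := HB.pack (fun p : 'rV[R]_n.+1 => p 0 j : R)
  (GRing.isLinear.Build _ _ _ _ _ lc) : {linear 'rV[R]_n.+1 -> R}.
have cc : continuous c by move=> p; apply: coord_continuous.
apply: DiffDef; first exact: (linear_differentiable (f := c)).
exact: (diff_lin (f := c)).
Qed.

Lemma is_diff_row3 (V : normedModType R) (x : V) (f g h df dg dh : V -> R) :
  is_diff x f df -> is_diff x g dg -> is_diff x h dh ->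
  is_diff x (fun v => row3 (f v) (g v) (h v)) (fun v => row3 (df v) (dg v) (dh v)).
Proof.
move=> Hf Hg Hh.
have E (a b c : R) : row3 a b c = a *: row3 1 0 0 + b *: row3 0 1 0 + c *: row3 0 0 1.
  by rewrite !row3Z !row3D !mulr1 !mulr0 !addr0 !add0r.
pose sc (e : 'rV[R]_3) (a : R) := a *: e.
have Hsc e a : is_diff a (sc e) (sc e) by exact: is_diff_scalel.
have -> : (fun v => row3 (f v) (g v) (h v)) =
   (sc (row3 1 0 0) \o f) + (sc (row3 0 1 0) \o g) + (sc (row3 0 0 1) \o h).
  by apply/funext => v; rewrite E.
have H1 := is_diff_comp Hf (Hsc (row3 1 0 0) (f x)).
have H2 := is_diff_comp Hg (Hsc (row3 0 1 0) (g x)).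
have H3 := is_diff_comp Hh (Hsc (row3 0 0 1) (h x)).
have -> : (fun v => row3 (df v) (dg v) (dh v)) =
   (sc (row3 1 0 0) \o df) + (sc (row3 0 1 0) \o dg) + (sc (row3 0 0 1) \o dh).
  by apply/funext => v; rewrite [LHS]E.
exact: is_diffD (is_diffD H1 H2) H3.
Qed.

Lemma is_diff_div (V : normedModType R) (x : V) (f g df dg : V -> R) :
  g x != 0 -> is_diff x f df -> is_diff x g dg ->
  is_diff x (fun v => f v / g v)
    (fun v => df v / g x - f x * dg v / g x ^+ 2).
Proof.
move=> gx Hf Hg.
have Hi : is_diff x (fun v => (g v)^-1) (- (g x) ^- 2 \*: dg).
  apply: DiffDef; first by apply: differentiableV.
  by rewrite diffV// (diff_val (f := g)).
have -> : (fun v => f v / g v) = f * (fun v => (g v)^-1) by [].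
have := is_diffM Hf Hi.
have -> // : f x *: (- g x ^- 2 \*: dg) + (g x)^-1 *: df =
  (fun v => df v / g x - f x * dg v / g x ^+ 2).
apply/funext => v.
transitivity (f x * (- g x ^- 2 * dg v) + (g x)^-1 * df v); first by [].
by field.
Qed.

End Differentials.

Section Models.
Context {R : realType}.
Implicit Types (x u v : 'rV[R]_4).

Lemma is_diff_ext (V W : normedModType R) (x : V) (f g df dg : V -> W) :
  is_diff x f df -> f =1 g -> df =1 dg -> is_diff x g dg.
Proof. by move=> h /funext <- /funext <-. Qed.

Lemma map_iE x : map_i x =
  row3 (x 0 1 / (1 + x 0 0)) (x 0 2 / (1 + x 0 0)) (x 0 3 / (1 + x 0 0)).
Proof. by rewrite /map_i (_ : \row_(k < 3) _ = row3 (x 0 1) (x 0 2) (x 0 3)) // row3Z; congr row3; rewrite mulrC. Qed.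

Definition jden (v : 'rV[R]_3) := v 0 0 * v 0 0 + v 0 1 * v 0 1 + (1 - v 0 2) * (1 - v 0 2).
Definition jnum (v : 'rV[R]_3) := 1 - (v 0 0 * v 0 0 + v 0 1 * v 0 1 + v 0 2 * v 0 2).

Lemma map_jE (v : 'rV[R]_3) : map_j v =
  row3 (2 * v 0 0 / jden v) (2 * v 0 1 / jden v) (jnum v / jden v).
Proof.
rewrite /map_j (_ : \row_(k < 3) _ = row3 (2 * v 0 0) (2 * v 0 1) (1 - sqn v)) //.
by rewrite row3Z /jden /jnum /sqn !expr2; congr row3; rewrite mulrC.
Qed.

Lemma is_diff_map_i x : 1 + x 0 0 != 0 -> is_diff x map_i
  (fun u => row3 (u 0 1 / (1 + x 0 0) - x 0 1 * u 0 0 / (1 + x 0 0) ^+ 2)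
                 (u 0 2 / (1 + x 0 0) - x 0 2 * u 0 0 / (1 + x 0 0) ^+ 2)
                 (u 0 3 / (1 + x 0 0) - x 0 3 * u 0 0 / (1 + x 0 0) ^+ 2)).
Proof.
move=> x0; have H (j : 'I_4) := is_diff_coord x j.
have Hs : is_diff x (fun p : 'rV[R]_4 => 1 + p 0 0) (fun p => p 0 0).
  by apply: (is_diff_ext (is_diffD (is_diff_cst (1 : R) x) (H 0))) => // p; exact: add0r.
have -> : map_i = fun p : 'rV[R]_4 => row3 (p 0 1 / (1 + p 0 0))
    (p 0 2 / (1 + p 0 0)) (p 0 3 / (1 + p 0 0)) by apply/funext => p; rewrite map_iE.
by apply: is_diff_row3; exact: (is_diff_div (g := fun p : 'rV[R]_4 => 1 + p 0 0) x0 (H _) Hs).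
Qed.

Definition djden (v w : 'rV[R]_3) : R :=
  2 * (v 0 0 * w 0 0 + v 0 1 * w 0 1 - (1 - v 0 2) * w 0 2).
Definition djnum (v w : 'rV[R]_3) : R :=
  - 2 * (v 0 0 * w 0 0 + v 0 1 * w 0 1 + v 0 2 * w 0 2).

Lemma is_diff_map_j (v : 'rV[R]_3) : jden v != 0 -> is_diff v map_j
  (fun w => row3 (2 * w 0 0 / jden v - 2 * v 0 0 * djden v w / jden v ^+ 2)
                 (2 * w 0 1 / jden v - 2 * v 0 1 * djden v w / jden v ^+ 2)
                 (djnum v w / jden v - jnum v * djden v w / jden v ^+ 2)).
Proof.
move=> v0; have H (j : 'I_3) := is_diff_coord v j.
have Hsq (f df : 'rV[R]_3 -> R) : is_diff v f df ->
    is_diff v (fun p => f p * f p) (fun w => 2 * (f v * df w)).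
  move=> Hf; apply: (is_diff_ext (is_diffM Hf Hf)) => // w.
  by rewrite mulr_natl mulr2n.
have Hc : is_diff v (fun _ => 1 : R) (fun _ => 0) by exact: (is_diff_cst (1 : R) v).
have H1 : is_diff v (fun p : 'rV[R]_3 => 1 - p 0 2) (fun p => 0 - p 0 2).
  exact: is_diffB Hc (H 2).
have Hd : is_diff v jden (djden v).
  apply: (is_diff_ext (is_diffD (is_diffD (Hsq _ _ (H 0)) (Hsq _ _ (H 1))) (Hsq _ _ H1))) => // w.
  rewrite /djden -[LHS]/(2 * (v 0 0 * w 0 0) + 2 * (v 0 1 * w 0 1) + 2 * ((1 - v 0 2) * (0 - w 0 2))).
  ring.
have Hn : is_diff v jnum (djnum v).
  apply: (is_diff_ext (is_diffB Hc (is_diffD (is_diffD (Hsq _ _ (H 0)) (Hsq _ _ (H 1))) (Hsq _ _ (H 2))))) => // w.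
  rewrite /djnum -[LHS]/(0 - (2 * (v 0 0 * w 0 0) + 2 * (v 0 1 * w 0 1) + 2 * (v 0 2 * w 0 2))).
  ring.
have H2 j : is_diff v (fun p : 'rV[R]_3 => 2 * p 0 j) (fun p => 2 * p 0 j).
  exact: (is_diffZ 2 (H j)).
have -> : map_j = fun p : 'rV[R]_3 => row3 (2 * p 0 0 / jden p)
    (2 * p 0 1 / jden p) (jnum p / jden p) by apply/funext => p; rewrite map_jE.
apply: is_diff_row3.
- exact: is_diff_div v0 (H2 0) Hd.
- exact: is_diff_div v0 (H2 1) Hd.
- exact: is_diff_div v0 Hn Hd.
Qed.

(** The inverse of the height of [map_ji x], see [map_jiE]. *)
Definition ht x := x 0 0 - x 0 3.

Lemma hyp_ht x : hyperboloid x -> 0 < ht x.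
Proof.
rewrite /ht /hyperboloid /= /mink; move: (x 0 0) (x 0 1) (x 0 2) (x 0 3) => a b c d [h a0].
nra.
Qed.

(** On the hyperboloid the denominator and the numerator of the third coordinate
    of [map_j] reduce to linear functions of x; this is why [map_ji] and its
    derivative have the short forms [map_jiE] and [dmap_jiE]. *)
Lemma ball_coordinates x : hyperboloid x ->
  let v := map_i x in
  [/\ 1 + x 0 0 != 0, jden v = 2 * ht x / (1 + x 0 0) & jnum v = 2 / (1 + x 0 0)].
Proof.
move=> [+ x0]; rewrite map_iE /jden /jnum !mxE /= /mink /ht.
move: (x 0 0) (x 0 1) (x 0 2) (x 0 3) x0 => a b c d a0 h.
have a1 : 1 + a != 0 by rewrite gt_eqF// ltr_wpDl.
have e : c * c = a * a - b * b - d * d - 1 by move: h; lra.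
have e' : c / (1 + a) * (c / (1 + a)) = (a * a - b * b - d * d - 1) / (1 + a) ^+ 2.
  by rewrite -e; field.
split => //; rewrite e'; field => //.
Qed.

Lemma map_jiE x : hyperboloid x ->
  map_ji x = row3 (x 0 1 / ht x) (x 0 2 / ht x) (ht x)^-1.
Proof.
move=> hx; have [x1 e1 e2] := ball_coordinates hx; have h0 := hyp_ht hx.
rewrite /map_ji map_jE e1 e2 map_iE !mxE /=.
by congr row3; field; rewrite x1 gt_eqF.
Qed.

Lemma dmap_jiE x u : hyperboloid x -> mink u x = 0 -> dmap_ji x u =
  row3 (u 0 1 / ht x - x 0 1 * ht u / ht x ^+ 2)
       (u 0 2 / ht x - x 0 2 * ht u / ht x ^+ 2)
       (- ht u / ht x ^+ 2).
Proof.
move=> hx ux; have [x1 e1 e2] := ball_coordinates hx; have h0 := hyp_ht hx.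
have jv0 : jden (map_i x) != 0 by rewrite e1 gt_eqF// divr_gt0 ?mulr_gt0// ltr_wpDl//; case: hx.
have Hi := is_diff_map_i x1; have Hj := is_diff_map_j jv0.
rewrite /dmap_ji (diff_val (is_diff_def := Hi)).
set dv := row3 (_ - _) _ _.
rewrite (diff_val (is_diff_def := Hj)) {Hi Hj jv0}.
have key : map_i x 0 0 * dv 0 0 + map_i x 0 1 * dv 0 1 + map_i x 0 2 * dv 0 2 =
    u 0 0 / (1 + x 0 0) ^+ 2.
  move: hx.1 ux; rewrite map_iE /dv !mxE /= /mink.
  move: (x 0 0) (x 0 1) (x 0 2) (x 0 3) (u 0 0) (u 0 1) (u 0 2) (u 0 3) x1.
  move=> a b c d a' b' c' d' a1 h h'.
  transitivity ((b' * b + c' * c + d' * d) / (1 + a) ^+ 2 -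
      (b * b + c * c + d * d) * a' / (1 + a) ^+ 3); first by field.
  have -> : b' * b + c' * c + d' * d = a' * a by move: h'; lra.
  have -> : b * b + c * c + d * d = a * a - 1 by move: h; lra.
  by field.
have dn : djnum (map_i x) dv = - 2 * u 0 0 / (1 + x 0 0) ^+ 2.
  by rewrite /djnum key mulrA.
have dd : djden (map_i x) dv = 2 * ht u / (1 + x 0 0) - 2 * ht x * u 0 0 / (1 + x 0 0) ^+ 2.
  transitivity (2 * (u 0 0 / (1 + x 0 0) ^+ 2 - dv 0 2)); first by rewrite -key /djden; ring.
  by rewrite /dv !mxE /= /ht; field.
rewrite dn dd e1 e2 map_iE /dv !mxE /=.
by congr row3; field; rewrite x1 gt_eqF.
Qed.

Lemma map_ji_inj x x' : hyperboloid x -> hyperboloid x' -> map_ji x = map_ji x' -> x = x'.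
Proof.
move=> hx hx'; rewrite !map_jiE//; have h0 := hyp_ht hx; have h0' := hyp_ht hx'.
move=> /row3_inj[e1 e2 /invr_inj e3]; move: e1 e2; rewrite -e3 => e1 e2.
have {}e1 : x 0 1 = x' 0 1 by apply: (mulIf _ e1); rewrite invr_eq0 gt_eqF.
have {}e2 : x 0 2 = x' 0 2 by apply: (mulIf _ e2); rewrite invr_eq0 gt_eqF.
have e4 : x 0 0 + x 0 3 = x' 0 0 + x' 0 3.
  apply: (mulfI (lt0r_neq0 h0)); rewrite {2}e3 /ht; move: hx.1 hx'.1.
  by rewrite /mink e1 e2; lra.
by rewrite [LHS]row4E [RHS]row4E; move: e3; rewrite /ht => e3; congr row4 => //; lra.
Qed.

Lemma dmap_ji_inj x u u' : hyperboloid x -> mink u x = 0 -> mink u' x = 0 ->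
  dmap_ji x u = dmap_ji x u' -> u = u'.
Proof.
move=> hx ux ux'; have h0 := lt0r_neq0 (hyp_ht hx).
have hi : (ht x)^-1 != 0 by rewrite invr_eq0.
rewrite !dmap_jiE// => /row3_inj[e1 e2 e3].
have {}e3 : ht u = ht u'.
  by apply: oppr_inj; apply: (mulIf _ e3); rewrite invr_eq0 expf_neq0.
have {}e1 : u 0 1 = u' 0 1 by apply: (mulIf hi); move: e1; rewrite e3 => /addIr.
have {}e2 : u 0 2 = u' 0 2 by apply: (mulIf hi); move: e2; rewrite e3 => /addIr.
have e0 : u 0 0 = u' 0 0.
  apply: (mulIf h0); move: ux ux' e3; rewrite /mink e1 e2 /ht; nra.
by rewrite [LHS]row4E [RHS]row4E; move: e3; rewrite /ht => e3; congr row4 => //; lra.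
Qed.

Lemma dmap_ji_isometry x u v : hyperboloid x -> mink u x = 0 -> mink v x = 0 ->
  metricU (map_ji x) (dmap_ji x u) (dmap_ji x v) = - mink u v.
Proof.
move=> hx ux vx; have h0 := lt0r_neq0 (hyp_ht hx).
rewrite !dmap_jiE// map_jiE// /metricU !mxE /=.
have ex : x 0 1 * x 0 1 + x 0 2 * x 0 2 + 1 = ht x * (x 0 0 + x 0 3).
  by move: hx.1; rewrite /mink /ht; lra.
have eu : u 0 1 * x 0 1 + u 0 2 * x 0 2 = u 0 0 * x 0 0 - u 0 3 * x 0 3 by move: ux; rewrite /mink; lra.
have ev : v 0 1 * x 0 1 + v 0 2 * x 0 2 = v 0 0 * x 0 0 - v 0 3 * x 0 3 by move: vx; rewrite /mink; lra.
transitivity (u 0 1 * v 0 1 + u 0 2 * v 0 2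
  - (u 0 1 * x 0 1 + u 0 2 * x 0 2) * ht v / ht x
  - (v 0 1 * x 0 1 + v 0 2 * x 0 2) * ht u / ht x
  + ht u * ht v * (x 0 1 * x 0 1 + x 0 2 * x 0 2 + 1) / ht x ^+ 2).
  by field.
rewrite eu ev ex /mink; move: h0; rewrite /ht => h0; field.
exact: h0.
Qed.

Lemma dmap_jiD x u v : dmap_ji x (u + v) = dmap_ji x u + dmap_ji x v.
Proof. by rewrite /dmap_ji !linearD. Qed.
Lemma dmap_jiZ x a u : dmap_ji x (a *: u) = a *: dmap_ji x u.
Proof. by rewrite /dmap_ji !linearZ. Qed.
Lemma dmap_jiN x u : dmap_ji x (- u) = - dmap_ji x u.
Proof. by rewrite /dmap_ji !linearN. Qed.
End Models.

(** * Frames of unimodular pairs of spinors *)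

(** The number -i, locked so that [negi *: b] is not simplified. *)
HB.lock Definition negi (R : realType) : R[i] := Complex 0 (- 1).

Section SpinorFrames.
Context {R : realType}.
Implicit Types (k b : spinor R) (z : R[i]) (p q u : 'rV[R]_4).

Lemma minkC p q : mink p q = mink q p.
Proof. by rewrite /mink; ring. Qed.
Lemma minkDl p q u : mink (p + q) u = mink p u + mink q u.
Proof. by rewrite (row4E p) (row4E q) (row4E u) !row4_lin !mink4; ring. Qed.
Lemma minkZl (a : R) p u : mink (a *: p) u = a * mink p u.
Proof. by rewrite (row4E p) (row4E u) !row4_lin !mink4; ring. Qed.
Lemma minkNl p u : mink (- p) u = - mink p u.
Proof. by rewrite -scaleN1r minkZl mulN1r. Qed.
Lemma minkDr p q u : mink u (p + q) = mink u p + mink u q.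
Proof. by rewrite minkC minkDl !(minkC u). Qed.
Lemma minkZr (a : R) p u : mink u (a *: p) = a * mink u p.
Proof. by rewrite minkC minkZl (minkC u). Qed.
Lemma minkNr p u : mink u (- p) = - mink u p.
Proof. by rewrite minkC minkNl (minkC u). Qed.
Definition mink_lin := (minkDl, minkZl, minkNl, minkDr, minkZr, minkNr).

Lemma ipC k b : spinor_ip k b = - spinor_ip b k.
Proof. by rewrite /spinor_ip; ring. Qed.
Lemma ipkk k : spinor_ip k k = 0.
Proof. by rewrite /spinor_ip; ring. Qed.
Lemma ipZr z k b : spinor_ip k (z *: b) = z * spinor_ip k b.
Proof. by rewrite /spinor_ip !linE; ring. Qed.
Lemma ipZl z k b : spinor_ip (z *: k) b = z * spinor_ip k b.
Proof. by rewrite /spinor_ip !linE; ring. Qed.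
Lemma ipDr k b b' : spinor_ip k (b + b') = spinor_ip k b + spinor_ip k b'.
Proof. by rewrite /spinor_ip !linE; ring. Qed.
Lemma ipDl k k' b : spinor_ip (k + k') b = spinor_ip k b + spinor_ip k' b.
Proof. by rewrite /spinor_ip !linE; ring. Qed.
Lemma ipNr k b : spinor_ip k (- b) = - spinor_ip k b.
Proof. by rewrite /spinor_ip !linE; ring. Qed.
Lemma ipNl k b : spinor_ip (- k) b = - spinor_ip k b.
Proof. by rewrite /spinor_ip !linE; ring. Qed.
Definition ip_lin := (ipZr, ipZl, ipDr, ipDl, ipNr, ipNl, ipkk).

Local Notation negi := (negi R).
Lemma Re_negi : Re negi = 0. Proof. by rewrite negi.unlock. Qed.
Lemma Im_negi : Im negi = - 1. Proof. by rewrite negi.unlock. Qed.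

Lemma hermC k b : herm k b = herm b k.
Proof. by rewrite !hermE; congr row4; ring. Qed.
Lemma hermDr k b b' : herm k (b + b') = herm k b + herm k b'.
Proof. by rewrite !hermE row4_lin !linE !cE; congr row4; ring. Qed.
Lemma hermDl k b b' : herm (b + b') k = herm b k + herm b' k.
Proof. by rewrite !(hermC _ k) hermDr. Qed.
Lemma hermZr z k b : herm k (z *: b) = Re z *: herm k b - Im z *: herm k (negi *: b).
Proof. by rewrite !hermE !row4_lin !linE !(ReM, ImM) Re_negi Im_negi; congr row4; ring. Qed.
Lemma hermJ z k b : herm (z *: k) b = herm k ((conjc z : R[i]) *: b).
Proof.
rewrite !hermE !linE !(ReM, ImM); case: z => x y /=; congr row4; ring.
Qed.
Lemma hermRl (a : R) k b : herm (a%:C *: k) b = a *: herm k b.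
Proof. by rewrite !hermE row4_lin !linE !(ReM, ImM) /=; congr row4; ring. Qed.
Lemma hermRr (a : R) k b : herm k (a%:C *: b) = a *: herm k b.
Proof. by rewrite hermC hermRl hermC. Qed.
Lemma hermNr k b : herm k (- b) = - herm k b.
Proof. by rewrite !hermE row4_lin !linE !cE; congr row4; ring. Qed.
Lemma hermkk k : herm k k = 2 *: nullv k.
Proof. by rewrite hermE nullvE row4_lin; congr row4; ring. Qed.
Lemma nullvD k b : nullv (k + b) = nullv k + nullv b + herm k b.
Proof. by rewrite hermE !nullvE !row4_lin !linE !cE; congr row4; ring. Qed.
Lemma nullvZ z k : nullv (z *: k) = nsq z *: nullv k.
Proof. by rewrite !nullvE !row4_lin !linE !cE /nsq; congr row4; ring. Qed.
Lemma nullvN k : nullv (- k) = nullv k.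
Proof. by rewrite !nullvE !linE !cE; congr row4; ring. Qed.

Definition mat3 n (a b c : 'rV[R]_n) : 'M[R]_(3, n) := \matrix_(i < 3) [:: a; b; c]`_i.

Lemma mat3P n (M N : 'M[R]_(3, n)) : row 0 M = row 0 N -> row 1 M = row 1 N ->
  row 2 M = row 2 N -> M = N.
Proof.
move=> e0 e1 e2; apply/row_matrixP => j; case: j => [[|[|[|//]]] h].
- by rewrite (_ : Ordinal h = 0) //; apply/val_inj.
- by rewrite (_ : Ordinal h = 1) //; apply/val_inj.
- by rewrite (_ : Ordinal h = 2) //; apply/val_inj.
Qed.
Lemma row_mat3 n (a b c : 'rV[R]_n) :
  (row 0 (mat3 a b c) = a) * (row 1 (mat3 a b c) = b) * (row 2 (mat3 a b c) = c).
Proof. by rewrite !rowK. Qed.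
Lemma mat3E n (M : 'M[R]_(3, n)) : M = mat3 (row 0 M) (row 1 M) (row 2 M).
Proof. by apply: mat3P; rewrite row_mat3. Qed.

(** For (k, b) the standard basis of C^2 this is the point (1, 0, 0, 0) with a
    frame along the axes Z, Y and - X.  The first vector points to the ray of
    [nullv k], so it is the outward normal of the horosphere of k; the second
    is proportional to the flag direction of k modulo [nullv k], see
    [herm_Z]. *)
Definition frH k b : 'rV[R]_4 * 'M[R]_(3, 4) :=
  (2^-1 *: (nullv k + nullv b),
   mat3 (2^-1 *: (nullv k - nullv b)) (2^-1 *: herm k (negi *: b)) (- 2^-1 *: herm k b)).

Definition frU k b : frame R := push_frame (frH k b).

Lemma ch2 (t : R) : ch t + sh t = expR t. Proof. by rewrite /ch /sh; field. Qed.
Lemma ch2' (t : R) : ch t - sh t = expR (- t). Proof. by rewrite /ch /sh; field. Qed.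

Lemma expR_half (t : R) : expR (t / 2) ^+ 2 = expR t.
Proof. by rewrite expr2 -expRD; congr expR; field. Qed.

(** Translation along the first vector is right multiplication by a real diagonal
    matrix, since it scales the null vectors at both ends of the geodesic. *)
Lemma translate_frH (t : R) k b : translateH t (frH k b) =
  frH ((expR (t / 2))%:C *: k) ((expR (- (t / 2)))%:C *: b).
Proof.
have n1 : nullv ((expR (t / 2))%:C *: k) = (ch t + sh t) *: nullv k.
  by rewrite nullvZ ch2 /nsq /= expr0n addr0 expR_half.
have n2 : nullv ((expR (- (t / 2)))%:C *: b) = (ch t - sh t) *: nullv b.
  by rewrite nullvZ ch2' /nsq /= expr0n addr0 -mulNr expR_half.
have e : expR (t / 2) * expR (- (t / 2)) = 1 by rewrite -expRD subrr expR0.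
have h0 b' : herm ((expR (t / 2))%:C *: k) ((expR (- (t / 2)))%:C *: b') = herm k b'.
  by rewrite hermRl hermRr scalerA e scale1r.
have h1 : negi *: ((expR (- (t / 2)))%:C *: b) = (expR (- (t / 2)))%:C *: (negi *: b).
  by rewrite !scalerA mulrC.
rewrite /translateH /frH n1 n2 h1 !h0 /= !row_mat3.
congr pair.
  by apply/rowP => j; rewrite !mxE; field.
apply: mat3P; rewrite ?row_mat3 rowK ?row_mat3 //=.
by apply/rowP => j; rewrite !mxE; field.
Qed.

Definition rotate_frameH (j : 'I_3) (t : R) (F : 'M[R]_(3, 4)) : 'M[R]_(3, 4) :=
  \matrix_a (if a == j then row j F
     else if a == j + 1 then cos t *: row (j + 1) F + sin t *: row (j + 2) F
     else cos t *: row (j + 2) F - sin t *: row (j + 1) F).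

Lemma rotate_push (j : 'I_3) (t : R) xF :
  rotate_frame j t (push_frame xF) = push_frame (xF.1, rotate_frameH j t xF.2).
Proof.
rewrite /push_frame /rotate_frame /=; congr pair; apply/row_matrixP => a.
rewrite !rowK; case: (a == j) => //.
by case: (a == j + 1); rewrite ?dmap_jiD ?dmap_jiN !dmap_jiZ.
Qed.

End SpinorFrames.

Section FrameAction.
Context {R : realType}.
Local Notation negi := (negi R).
Implicit Types (k b : spinor R) (z : R[i]) (p q u : 'rV[R]_4).

Lemma herm_negi k b : herm b (negi *: k) = - herm k (negi *: b).
Proof.
rewrite !hermE !linE !(ReM, ImM) Re_negi Im_negi row4_lin.
by congr row4; ring.
Qed.

Lemma herm_negikk k : herm k (negi *: k) = 0.
Proof.
have := herm_negi k k; move: (herm _ _) => v /rowP e.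
by apply/rowP => j; move: (e j); rewrite !mxE; lra.
Qed.

(** Rotation by t about the second vector is right multiplication by a plane
    rotation of angle t / 2. *)
Lemma rotate1_frH (t : R) k b :
  ((frH k b).1, rotate_frameH 1 t (frH k b).2) =
  (frH ((cos (t / 2))%:C *: k + (sin (t / 2))%:C *: b)
       ((- sin (t / 2))%:C *: k + (cos (t / 2))%:C *: b)).
Proof.
have ht2 : t = t / 2 + t / 2 by field.
rewrite {1}ht2 /rotate_frameH cosD sinD; move: (cos _) (sin _) (cos2Dsin2 (t / 2)) => c s cs.
have e : negi *: ((- s)%:C *: k + c%:C *: b) = (- s)%:C *: (negi *: k) + c%:C *: (negi *: b).
  by rewrite scalerDr !scalerA !(mulrC negi).
have nR (x : R) v : nullv (x%:C *: v) = x ^+ 2 *: nullv v.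
  by rewrite nullvZ /nsq /= expr0n addr0.
rewrite /frH e !nullvD !nR !(hermDl, hermDr) !(hermRl, hermRr) !hermkk !herm_negikk.
rewrite (herm_negi k b) (hermC b k) /=.
move: (nullv k) (nullv b) (herm k b) (herm k _) => n n' h h'.
congr pair.
  apply/rowP => j; rewrite !mxE; move: (n 0 j) (n' 0 j) (h 0 j) => x y w.
  by transitivity (2^-1 * (x + y) * (c ^+ 2 + s ^+ 2)); [rewrite cs mulr1 | field].
have o2 : 1 + 1 = 2 :> 'I_3 by apply/val_inj.
have o3 : 1 + 2 = 0 :> 'I_3 by apply/val_inj.
rewrite o2 o3 !row_mat3.
apply: mat3P; rewrite ?row_mat3 rowK ?row_mat3 /= ?row_mat3.
- apply/rowP => j; rewrite !mxE; move: (n 0 j) (n' 0 j) (h 0 j) => x y w.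
  by field.
- apply/rowP => j; rewrite !mxE; move: (h' 0 j) => x.
  by transitivity (2^-1 * x * (c ^+ 2 + s ^+ 2)); [rewrite cs mulr1 | field].
- apply/rowP => j; rewrite !mxE; move: (n 0 j) (n' 0 j) (h 0 j) => x y w.
  by field.
Qed.

(** Rotation about the first vector fixes both null vectors, so it only changes
    the phases of k and b. *)
Lemma rotate0_frH (t : R) k b :
  ((frH k b).1, rotate_frameH 0 t (frH k b).2) =
  (frH ((cos (t / 2) +i* sin (t / 2)) *: k) ((cos (t / 2) -i* sin (t / 2)) *: b)).
Proof.
have ht2 : t = t / 2 + t / 2 by field.
rewrite {1}ht2 /rotate_frameH cosD sinD; move: (cos _) (sin _) (cos2Dsin2 (t / 2)) => c s cs.
have nR (x y : R) v : x ^+ 2 + y ^+ 2 = 1 -> nullv ((x +i* y) *: v) = nullv v.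
  by move=> xy; rewrite nullvZ /nsq /= xy scale1r.
have sc : c ^+ 2 + (- s) ^+ 2 = 1 by rewrite sqrrN.
rewrite /frH !nR//.
have z2 : (c -i* s) * (c -i* s) = (c * c - s * s) -i* (c * s + s * c) :> R[i].
  by apply: complexP => /=; ring.
have h1 : herm ((c +i* s) *: k) ((c -i* s) *: b) =
    (c * c - s * s) *: herm k b + (s * c + c * s) *: herm k (negi *: b).
  by rewrite hermJ scalerA z2 hermZr /= scaleNr opprK (addrC (c * s)).
have h2 : herm ((c +i* s) *: k) (negi *: ((c -i* s) *: b)) =
    (c * c - s * s) *: herm k (negi *: b) - (s * c + c * s) *: herm k b.
  rewrite hermJ !scalerA mulrAC z2 -scalerA hermZr /= scaleNr opprK scalerA.
  have -> : negi * negi = -1 by apply: complexP; rewrite ?(ReM, ImM) Re_negi Im_negi /=; ring.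
  by rewrite scaleN1r hermNr scalerN (addrC (c * s)).
rewrite h1 h2 /=.
move: (nullv k) (nullv b) (herm k b) (herm k _) => n n' h h'.
congr pair.
have o2 : 0 + 1 = 1 :> 'I_3 by apply/val_inj.
have o3 : 0 + 2 = 2 :> 'I_3 by apply/val_inj.
rewrite o2 o3 !row_mat3.
apply: mat3P; rewrite ?row_mat3 rowK ?row_mat3 /= ?row_mat3 //.
- by apply/rowP => j; rewrite !mxE; field.
- by apply/rowP => j; rewrite !mxE; field.
Qed.

End FrameAction.

Section UnimodularPairs.
Context {R : realType}.
Local Notation negi := (negi R).
Implicit Types (k b : spinor R) (z : R[i]) (p q u : 'rV[R]_4).

Lemma det_mx33 (M : 'M[R]_3) : \det M =
  M 0 0 * (M 1 1 * M 2 2 - M 1 2 * M 2 1)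
  - M 0 1 * (M 1 0 * M 2 2 - M 1 2 * M 2 0)
  + M 0 2 * (M 1 0 * M 2 1 - M 1 1 * M 2 0).
Proof.
rewrite (expand_det_row _ 0) !big_ord_recl big_ord0 /cofactor.
rewrite !(expand_det_row _ (0 : 'I_2)) !big_ord_recl !big_ord0 /cofactor !det_mx11 !mxE /=.
pose f (i j : nat) : R := M (inord i) (inord j).
have fE i j : M i j = f i j by rewrite /f !inord_val.
by rewrite !fE /= /bump /=; ring.
Qed.

Definition det3 (u v w : 'rV[R]_3) : R :=
  u 0 0 * (v 0 1 * w 0 2 - v 0 2 * w 0 1) - u 0 1 * (v 0 0 * w 0 2 - v 0 2 * w 0 0)
  + u 0 2 * (v 0 0 * w 0 1 - v 0 1 * w 0 0).

Section Pair.
Variables (k b : spinor R).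
Hypothesis kb : spinor_ip k b = 1.

Lemma hyperboloid_frH : hyperboloid (frH k b).1.
Proof.
rewrite /frH; split.
  by rewrite !mink_lin !mink_nullv (ipC b k) !ipkk kb /nsq /=; field.
rewrite !nullvE !row4_lin mxE /= mulr_gt0 ?invr_gt0//.
have h : Re (spinor_ip k b) = 1 by rewrite kb.
move: h; rewrite ip_re.
move: (Re (k 0 0)) (Im (k 0 0)) (Re (k 1 0)) (Im (k 1 0)).
move: (Re (b 0 0)) (Im (b 0 0)) (Re (b 1 0)) (Im (b 1 0)) => a a' c c' x x' y y' e.
have := (sqr_ge0 (x - c), sqr_ge0 (x' + c'), sqr_ge0 (a + y), sqr_ge0 (a' - y')).
by move=> [[[]]]; nra.
Qed.

Lemma Re0 : Re (0 : R[i]) = 0. Proof. by []. Qed.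
Lemma Im0 : Im (0 : R[i]) = 0. Proof. by []. Qed.

Lemma I3P (P : 'I_3 -> Prop) : P 0 -> P 1 -> P 2 -> forall a, P a.
Proof.
move=> p0 p1 p2 a; case: a => [[|[|[|//]]] h].
- by rewrite (_ : Ordinal h = 0) //; apply/val_inj.
- by rewrite (_ : Ordinal h = 1) //; apply/val_inj.
- by rewrite (_ : Ordinal h = 2) //; apply/val_inj.
Qed.

Lemma frH_tangent a : mink (row a (frH k b).2) (frH k b).1 = 0.
Proof.
have h z : mink (nullv k + nullv b) (herm k (z *: b)) = 0.
  by rewrite !mink_lin !mink_nullv_herm !ip_lin mulr0 !Re0 !Im0; ring.
rewrite /frH; move: a; apply: I3P; rewrite row_mat3 minkZl minkZr.
- by rewrite !mink_lin (minkC (nullv k) (nullv b)) !mink_nullv !ip_lin /nsq /=; ring.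
- by rewrite minkC h !mulr0.
- by rewrite minkC -[b in herm k b]scale1r h !mulr0.
Qed.

Lemma frH_orthonormal a c : - mink (row a (frH k b).2) (row c (frH k b).2) = (a == c)%:R.
Proof.
have h1 : mink (nullv k - nullv b) (nullv k - nullv b) = - 4.
  by rewrite !mink_lin !mink_nullv (ipC b k) !ipkk kb /nsq /=; ring.
have h2 : mink (herm k (negi *: b)) (herm k (negi *: b)) = - 4.
  by rewrite mink_herm !ip_lin (ipC b k) kb ?(ReM, ImM, ReN, ImN, Re_negi, Im_negi) /=; ring.
have h3 : mink (herm k b) (herm k b) = - 4.
  by rewrite mink_herm !ip_lin (ipC b k) kb /=; ring.
have h4 : mink (herm k b) (herm k (negi *: b)) = 0.
  by rewrite mink_herm !ip_lin (ipC b k) kb ?(ReM, ImM, ReN, ImN, Re_negi, Im_negi) /=; ring.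
have h5 z : mink (nullv k - nullv b) (herm k (z *: b)) = 0.
  by rewrite !mink_lin !mink_nullv_herm !ip_lin mulr0 !Re0 !Im0; ring.
have h6 : mink (nullv k - nullv b) (herm k b) = 0 by rewrite -[b in herm k b]scale1r h5.
rewrite /frH; move: (nullv k - nullv b) (herm k b) (herm k _) h1 h2 h3 h4 h6 (h5 negi).
move=> n h h' h1 h2 h3 h4 h6 {}h5.
move: a c; apply: I3P; apply: I3P; rewrite !row_mat3 minkZl minkZr ?(minkC h n) ?(minkC h' n) ?(minkC h' h);
  rewrite ?h1 ?h2 ?h3 ?h4 ?h5 ?h6 /=; by field.
Qed.
End Pair.
End UnimodularPairs.

Section PushedFrames.
Context {R : realType}.
Local Notation negi := (negi R).
Implicit Types (k b : spinor R) (z : R[i]) (x p q u : 'rV[R]_4).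

Lemma det_mat3 (u v w : 'rV[R]_3) : \det (mat3 u v w) = det3 u v w.
Proof. by rewrite det_mx33 /det3 !mxE. Qed.

Lemma sum4 (V : nmodType) (F : 'I_4 -> V) : \sum_i F i = F 0 + F 1 + F 2 + F 3.
Proof.
rewrite !big_ord_recl big_ord0 addr0 !addrA.
by congr (_ + _ + _ + _); congr F; apply/val_inj.
Qed.

(** The orientation of a frame survives the passage to the upper half space. *)
Lemma det_push x (F : 'M[R]_(3, 4)) : hyperboloid x ->
  (forall a, mink (row a F) x = 0) ->
  \det (push_frame (x, F)).2 = \det (col_mx x F : 'M[R]_4) / ht x ^+ 3.
Proof.
move=> hx tF; have h0 := lt0r_neq0 (hyp_ht hx).
pose w := (ht x)^-1.
(* Applied to a vector u, the matrix P returns its product with x followed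
   by dmap_ji x u; so the first column of (x, F) P is (1, 0, 0, 0). *)
pose P : 'M[R]_4 := \matrix_(i < 4, j < 4) (nth [::] [::
   [:: x 0 0; - (x 0 1 * w ^+ 2); - (x 0 2 * w ^+ 2); - w ^+ 2];
   [:: - x 0 1; w; 0; 0]; [:: - x 0 2; 0; w; 0];
   [:: - x 0 3; x 0 1 * w ^+ 2; x 0 2 * w ^+ 2; w ^+ 2]] i)`_j.
have PJ u : u *m P = row4 (mink u x) (u 0 1 / ht x - x 0 1 * ht u / ht x ^+ 2)
       (u 0 2 / ht x - x 0 2 * ht u / ht x ^+ 2) (- ht u / ht x ^+ 2).
  have M j : (u *m P) 0 j = u 0 0 * P 0 j + u 0 1 * P 1 j + u 0 2 * P 2 j + u 0 3 * P 3 j. by rewrite mxE sum4.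
  rewrite /mink /ht; apply: row4P; rewrite M !mxE /= /w -?exprVn /ht; ring.
have dP : \det P = w ^+ 3.
  transitivity (ht x * w ^+ 4); last by rewrite /w; field.
  have [P0 P1 P2 P3] : [/\ P 1 0 = - x 0 1, P 1 1 = w, P 1 2 = 0 & P 1 3 = 0].
    by rewrite !mxE.
  rewrite (expand_det_row _ 1) sum4 P0 P1 P2 P3 !mul0r !addr0 /cofactor !det_mx33.
  by rewrite !mxE /= /bump /= /ht; ring.
have -> : \det (push_frame (x, F)).2 = \det ((col_mx x F : 'M[R]_4) *m P).
  have E i : row (lift 0 i) ((col_mx x F : 'M[R]_4) *m P) = row i F *m P.
    rewrite row_mul; congr (_ *m P); have -> : lift 0 i = @rshift 1 3 i by apply/val_inj.
    exact: rowKd.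
  have E0 : row 0 ((col_mx x F : 'M[R]_4) *m P) = x *m P.
    rewrite row_mul; congr (_ *m P); have -> : 0 = @lshift 1 3 0 by apply/val_inj.
    by etransitivity; [exact: (rowKu 0 x F) | apply/rowP => j; rewrite mxE].
  have N00 : ((col_mx x F : 'M[R]_4) *m P) 0 0 = 1.
    by have /rowP/(_ 0) := E0; rewrite PJ !mxE /= => ->; case: hx.
  have N0 i : ((col_mx x F : 'M[R]_4) *m P) (lift 0 i) 0 = 0.
    by have /rowP/(_ 0) := E i; rewrite PJ !mxE /= => ->; rewrite tF.
  rewrite [RHS](expand_det_col _ 0) big_ord_recl big1 ?addr0 => [|i _]; last by rewrite N0 mul0r.
  rewrite N00 mul1r /cofactor expr0 mul1r; congr (\det _).
  apply/row_matrixP => a; rewrite rowK dmap_jiE//.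
  apply/rowP => j; have /rowP/(_ (lift 0 j)) := E a; rewrite PJ.
  rewrite [LHS]mxE => e; rewrite [RHS]mxE [RHS]mxE [RHS]mxE {}e.
  by rewrite !mxE; case: j => [[|[|[|//]]] ?].
by rewrite det_mulmx dP /w exprVn.
Qed.

Lemma frameU_push x (F : 'M[R]_(3, 4)) : hyperboloid x ->
  (forall a, mink (row a F) x = 0) ->
  (forall a c, - mink (row a F) (row c F) = (a == c)%:R) ->
  0 < \det (push_frame (x, F)).2 -> frameU R (push_frame (x, F)).
Proof.
move=> hx tF oF dF; split; first by rewrite /= map_jiE// mxE /= invr_gt0 hyp_ht.
by split => // a c; rewrite !rowK dmap_ji_isometry.
Qed.

End PushedFrames.

Section Explicit.
Context {R : realType}.
Local Notation negi := (negi R).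

Variables (k b : spinor R).
Hypothesis kb : spinor_ip k b = 1.
Let c1 := Re (k 1 0). Let c2 := Im (k 1 0).
Let d1 := Re (b 1 0). Let d2 := Im (b 1 0).
Let w := c1 ^+ 2 + c2 ^+ 2 + (d1 ^+ 2 + d2 ^+ 2).

Lemma ht_frH : ht (frH k b).1 = w.
Proof. by rewrite /frH !nullvE !row4_lin /ht !mxE /= /w /c1 /c2 /d1 /d2; field. Qed.

(** Up to a common factor the entries are polynomials in the second components
    of k and b, modulo {k, b} = 1.  This form shows that the frame is right-handed and depends
    continuously on (k, b). *)
Lemma frU_explicit : (frU k b).2 = w ^- 2 *: mat3
  (row3 (2 * (c1 * d1 - c2 * d2)) (- 2 * (c1 * d2 + c2 * d1))
        (d1 ^+ 2 + d2 ^+ 2 - (c1 ^+ 2 + c2 ^+ 2)))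
  (row3 (2 * (c1 * c2 + d1 * d2)) (c1 ^+ 2 - c2 ^+ 2 + d1 ^+ 2 - d2 ^+ 2)
        (2 * (c2 * d1 - c1 * d2)))
  (row3 (c1 ^+ 2 - c2 ^+ 2 - d1 ^+ 2 + d2 ^+ 2) (2 * (d1 * d2 - c1 * c2))
        (2 * (c1 * d1 + c2 * d2))).
Proof.
(* P and P' are the coefficients of the real and imaginary parts of
   {k, b} = 1 in the proof of an entry. *)
have lin (L P P' E1 E2 : R) : E1 = 1 -> E2 = 0 -> L = P * E1 - P' * E2 -> L = P.
  by move=> -> ->; rewrite mulr1 mulr0 subr0.
have lin' (L P' P E1 E2 : R) : E1 = 1 -> E2 = 0 -> L = P' * E1 + P * E2 -> L = P'.
  by move=> -> ->; rewrite mulr1 mulr0 addr0.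
have hx := hyperboloid_frH kb; have tF := @frH_tangent R k b.
have w0 : w != 0 by rewrite -ht_frH gt_eqF// hyp_ht.
have e1 : Re (spinor_ip k b) = 1 by rewrite kb.
have e2 : Im (spinor_ip k b) = 0 by rewrite kb.
move: e1 e2; rewrite ip_re ip_im -/c1 -/c2 -/d1 -/d2.
have scl (a b' c : R) u v t : a = u / w ^+ 2 -> b' = v / w ^+ 2 -> c = t / w ^+ 2 ->
    row3 a b' c = w ^- 2 *: row3 u v t.
  by move=> -> -> ->; rewrite row3Z ![w ^- 2 * _]mulrC.
have rz a (M : 'M[R]_3) : row a (w ^- 2 *: M) = w ^- 2 *: row a M by apply/rowP => j; rewrite !mxE.
move=> e1 e2.
have red (X Y u0 W : R) : W = w -> X / W - Y * u0 / W ^+ 2 = (X * w - Y * u0) / w ^+ 2.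
  by move=> ->; field.
have red' (u0 W : R) : W = w -> - u0 / W ^+ 2 = - u0 / w ^+ 2 by move=> ->.
apply: mat3P; rewrite rz !row_mat3 rowK dmap_jiE// ?row_mat3; apply: scl;
  rewrite ?(red _ _ _ _ ht_frH) ?(red' _ _ ht_frH); congr (_ / _).
all: rewrite /frH !(hermE, nullvE) !row4_lin /ht !mxE /= ?linE ?(ReM, ImM, Re_negi, Im_negi) /w -/c1 -/c2 -/d1 -/d2.
all: move: e1 e2; clear -lin lin'; move: c1 c2 d1 d2 (Re (k 0 0)) (Im (k 0 0)) (Re (b 0 0)) (Im (b 0 0)).
all: move=> x1 x2 y1 y2 a1 a2 b1 b2 e1 e2.
- by apply: (lin _ _ (- 2 * (x1 * y2 + x2 * y1)) _ _ e1 e2); field.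
- by apply: (lin' _ _ (2 * (x1 * y1 - x2 * y2)) _ _ e1 e2); field.
- by field.
- by apply: (lin _ _ (x1 ^+ 2 - x2 ^+ 2 + y1 ^+ 2 - y2 ^+ 2) _ _ e1 e2); field.
- by apply: (lin' _ _ (2 * (x1 * x2 + y1 * y2)) _ _ e1 e2); field.
- by field.
- by apply: (lin _ _ (2 * (y1 * y2 - x1 * x2)) _ _ e1 e2); field.
- by apply: (lin' _ _ (x1 ^+ 2 - x2 ^+ 2 - y1 ^+ 2 + y2 ^+ 2) _ _ e1 e2); field.
- by field.
Qed.

Lemma frU_det_gt0 : 0 < \det (frU k b).2.
Proof.
have w0 : 0 < w by rewrite -ht_frH; exact: hyp_ht (hyperboloid_frH kb).
rewrite frU_explicit detZ det_mat3 mulr_gt0 ?exprn_gt0 ?invr_gt0 ?exprn_gt0//.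
set D := det3 _ _ _; suff -> : D = w ^+ 3 by rewrite exprn_gt0.
by rewrite /D /det3 !mxE /= /w; ring.
Qed.

Lemma frameU_frU : frameU R (frU k b).
Proof.
exact: (frameU_push (hyperboloid_frH kb) (@frH_tangent R k b) (frH_orthonormal kb) frU_det_gt0).
Qed.

Lemma frameH_frH : frameH (frH k b).
Proof.
have hx := hyperboloid_frH kb.
split => //; split; first exact: frH_tangent; split; first exact: frH_orthonormal.
have := frU_det_gt0; rewrite (det_push hx (@frH_tangent R k b)).
by rewrite pmulr_lgt0// invr_gt0 exprn_gt0// hyp_ht.
Qed.
End Explicit.

(** * Horospheres of spinors *)

Section Horospheres.
Context {R : realType}.
Local Notation negi := (negi R).
Implicit Types (k b : spinor R) (z : R[i]) (x p q u : 'rV[R]_4).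

Lemma nullv_map_g k : nullv k = map_g (spinor_f k). Proof. by rewrite nullv.unlock. Qed.
Lemma herm_map_g k b : herm k b = map_g (spinor_Df k b). Proof. by rewrite herm.unlock. Qed.

Lemma nsq_eq0 z : (nsq z == 0) = (z == 0).
Proof.
rewrite /nsq paddr_eq0 ?sqr_ge0// !sqrf_eq0; case: z => a b.
by rewrite eq_complex.
Qed.

Lemma nsq_ge0 z : 0 <= nsq z. Proof. by rewrite addr_ge0 ?sqr_ge0. Qed.

Lemma spinor_eq0 k : (k == 0) = (k 0 0 == 0) && (k 1 0 == 0).
Proof.
apply/eqP/andP => [->|[/eqP e0 /eqP e1]]; first by rewrite !mxE eqxx.
by apply: colP2; rewrite ?e0 ?e1 mxE.
Qed.

Lemma ip_eq0 k b : k != 0 -> spinor_ip k b = 0 -> exists c : R[i], b = c *: k.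
Proof.
rewrite spinor_eq0 negb_and /spinor_ip => k0 /eqP; rewrite subr_eq0 => /eqP e.
case/orP: k0 => k0.
  exists (b 0 0 / k 0 0); apply: colP2; rewrite mxE; first by rewrite mulfVK.
  by rewrite mulrAC -e mulrAC mulfV// mul1r.
exists (b 1 0 / k 1 0); apply: colP2; rewrite mxE; last by rewrite mulfVK.
by rewrite mulrAC (mulrC (b 1 0)) e mulfK.
Qed.

Lemma unimodular_neq0 k b : spinor_ip k b = 1 -> k != 0.
Proof.
by move=> kb; apply: contra_eq_neq kb => ->; rewrite /spinor_ip !mxE !(mul0r, mulr0) subr0 eq_sym oner_neq0.
Qed.

Lemma exists_unimodular k : k != 0 -> exists b, spinor_ip k b = 1.
Proof.
rewrite spinor_eq0 negb_and => /orP[] k0.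
  exists (\col_j [:: 0; (k 0 0)^-1]`_j).
  by rewrite /spinor_ip !mxE /= mul0r subr0 mulfV.
exists (\col_j [:: - (k 1 0)^-1; 0]`_j).
by rewrite /spinor_ip !mxE /= mulr0 sub0r mulNr opprK mulVf.
Qed.

Lemma nullv_light k : k != 0 -> light_cone (nullv k).
Proof.
move=> k0; split; first by rewrite mink_nullv ipkk /nsq /= ?expr0n /= !addr0 mulr0.
rewrite nullvE mxE /= -/(nsq (k 0 0)) -/(nsq (k 1 0)) lt_def addr_ge0 ?nsq_ge0// andbT.
by rewrite paddr_eq0 ?nsq_ge0// !nsq_eq0 -spinor_eq0.
Qed.

(** A null vector (T, X, Y, Z) of the future cone comes from the spinor
    (s, (X - iY) / (2 s)) with s^2 = (T + Z) / 2, or from (0, sqrt T) when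
    T + Z vanishes. *)
Lemma light_nullv p : light_cone p -> exists2 k, k != 0 & nullv k = p.
Proof.
rewrite [in X in X -> _](row4E p); move=> -[]; rewrite mink4 mxE /=.
case: (eqVneq (p 0 0 + p 0 3) 0) => [e|n0] h p0.
  have e3 : p 0 3 = - p 0 0 by apply/eqP; rewrite -addr_eq0 addrC e.
  move: h; rewrite e3 => h; have {}h : p 0 1 ^+ 2 + p 0 2 ^+ 2 = 0 by lra.
  have := h => /eqP; rewrite paddr_eq0 ?sqr_ge0// !sqrf_eq0 => /andP[/eqP e1 /eqP e2].
  exists (\col_j [:: 0; (Num.sqrt (p 0 0))%:C]`_j).
    by rewrite spinor_eq0 !mxE /= eqxx /= eq_complex /= eqxx andbT sqrtr_eq0 -ltNge.
  rewrite [RHS]row4E e3 e1 e2 nullvE !mxE /= expr0n /= !(mul0r, mulr0, add0r, addr0, subr0).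
  by rewrite sqr_sqrtr ?ltW// oppr0 mulr0.
have n1 : 0 < p 0 0 + p 0 3.
  rewrite lt_def n0 /=; rewrite leNgt; apply/negP => lt0.
  nra.
set s := Num.sqrt ((p 0 0 + p 0 3) / 2).
have s2 : s ^+ 2 = (p 0 0 + p 0 3) / 2 by rewrite sqr_sqrtr// divr_ge0 ?ltW.
have s0 : s != 0 by rewrite sqrtr_eq0 -ltNge divr_gt0.
exists (\col_j [:: s%:C; (p 0 1 / (2 * s)) -i* (p 0 2 / (2 * s))]`_j).
  by rewrite spinor_eq0 !mxE /= eq_complex /= (negPf s0).
have e : (p 0 1 / (2 * s)) ^+ 2 + (- (p 0 2 / (2 * s))) ^+ 2 = (p 0 0 - p 0 3) / 2.
  transitivity ((p 0 1 * p 0 1 + p 0 2 * p 0 2) / (4 * s ^+ 2)); first by field.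
  have -> : p 0 1 * p 0 1 + p 0 2 * p 0 2 = (p 0 0 - p 0 3) * (p 0 0 + p 0 3) by move: h; lra.
  rewrite s2; field.
  exact: n0.
rewrite [RHS]row4E nullvE !mxE /= e expr0n /= s2.
by congr row4; field.
Qed.

Lemma horosphere_pt k b : spinor_ip k b = 1 -> horosphere (nullv k) (frH k b).1.
Proof.
move=> kb; split; first exact: hyperboloid_frH.
rewrite /frH minkZl minkDl !mink_nullv ipkk (ipC b k) kb /nsq /=; by field.
Qed.

Lemma ip_shear k b z : spinor_ip k b = 1 -> spinor_ip k (b + z *: k) = 1.
Proof. by move=> kb; rewrite ipDr ipZr ipkk mulr0 addr0. Qed.

(** The points of the pairs (k, b + t k), t real, lie on the horosphere of k.
    That they satisfy the equation of another one is a polynomial identity of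
    degree two in t; its leading coefficient says that k and k' are
    proportional. *)
Lemma horosphere_inj k p : k != 0 -> light_cone p ->
  horosphere (nullv k) `<=` horosphere p -> p = nullv k.
Proof.
move=> k0 /light_nullv[k' k'0 <-{p}] sub; have [b kb] := exists_unimodular k0.
have H t : mink (2^-1 *: (nullv k + nullv (b + t%:C *: k))) (nullv k') = 1.
  by have [] := sub _ (horosphere_pt (ip_shear t%:C kb)).
have nR (x : R) v : nullv (x%:C *: v) = x ^+ 2 *: nullv v.
  by rewrite nullvZ /nsq /= expr0n addr0.
have {}H (t : R) : (1 + t ^+ 2) * mink (nullv k) (nullv k') + mink (nullv b) (nullv k')
    + t * mink (herm b k) (nullv k') = 2.
  move: (H t); rewrite nullvD nR hermRr !(minkZl, minkDl) => e.
  by apply: (@mulfI _ 2^-1); rewrite ?invr_eq0// mulVf// -[RHS]e; ring.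
have e0 : mink (nullv k) (nullv k') = 0 by move: (H 0) (H 1) (H (-1)); lra.
move: e0; rewrite mink_nullv => /eqP; rewrite mulf_eq0 pnatr_eq0 /= nsq_eq0 => /eqP e.
have [c k'E] := ip_eq0 k0 e; move: (H 0); rewrite k'E nullvZ !minkZr !mink_nullv ipkk (ipC b k) kb.
rewrite /nsq /= !(expr0n, addr0, mulr0, mul0r, add0r, sqrrN, expr1n, oppr0, mulr1) => h.
by rewrite (_ : _ + _ = 1) ?scale1r//; lra.
Qed.

(** By the Cauchy-Schwarz inequality, a null vector and a vector of the
    hyperboloid with positive product have the same time orientation. *)
Lemma future_null q x : mink q q = 0 -> mink q x = 1 -> hyperboloid x -> 0 < q 0 0.
Proof.
rewrite /mink => q0 qx [hx x0]; rewrite ltNge; apply/negP => le0.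
move: q0 qx hx x0 le0; rewrite /mink.
move: (q 0 0) (q 0 1) (q 0 2) (q 0 3) (x 0 0) (x 0 1) (x 0 2) (x 0 3) => a b c d a' b' c' d'.
move=> q0 qx hx x0 le0.
have h1 := sqr_ge0 (b * c' - c * b'); have h2 := sqr_ge0 (b * d' - d * b').
have h3 := sqr_ge0 (c * d' - d * c').
have e : (a * a' - 1) ^+ 2 + (b * c' - c * b') ^+ 2 + (b * d' - d * b') ^+ 2 + (c * d' - d * c') ^+ 2
    = (b * b + c * c + d * d) * (b' * b' + c' * c' + d' * d').
  have -> : a * a' - 1 = b * b' + c * c' + d * d' by lra.
  ring.
have e1 : b * b + c * c + d * d = a * a by lra.
have e2 : b' * b' + c' * c' + d' * d' = a' * a' - 1 by lra.
rewrite e1 e2 in e.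
have : 0 <= - (a * a') by rewrite -mulNr mulr_ge0 ?oppr_ge0// ltW.
nra.
Qed.

(** The reflection 2 x - p of p = [nullv k] in x is null and future pointing,
    hence of the form [nullv b]; the phase of b is free and is used to get
    {k, b} = 1. *)
Lemma horosphereP k x : k != 0 -> horosphere (nullv k) x ->
  exists2 b, spinor_ip k b = 1 & x = (frH k b).1.
Proof.
move=> k0 [hx xk]; pose q := 2 *: x - nullv k.
have pp : mink (nullv k) (nullv k) = 0 by case: (nullv_light k0).
have qq : mink q q = 0 by rewrite /q !mink_lin pp (minkC _ x) xk hx.1; ring.
have qx : mink q x = 1 by rewrite /q !mink_lin (minkC _ x) xk hx.1; ring.
have [b _ bq] : exists2 b, b != 0 & nullv b = q.
  by apply: light_nullv; split => //; exact: future_null qx hx.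
have nkb : nsq (spinor_ip k b) = 1.
  have : mink (nullv k) q = 2 by rewrite /q !mink_lin pp (minkC _ x) xk; ring.
  by rewrite -bq mink_nullv; lra.
exists (conjc (spinor_ip k b) *: b).
  rewrite ipZr; move: nkb; rewrite /nsq; case: (spinor_ip k b) => u v /= uv.
  by apply: complexP => /=; [rewrite -uv; ring | ring].
rewrite /frH nullvZ (_ : nsq _ = 1) ?scale1r; last by rewrite -nkb /nsq ReJ ImJ sqrrN.
by rewrite /= bq /q addrC subrK scalerA mulVf ?scale1r ?pnatr_eq0.
Qed.
End Horospheres.

Section DecoratedHorospheres.
Context {R : realType}.
Local Notation negi := (negi R).
Implicit Types (k b : spinor R) (z : R[i]) (x p q u : 'rV[R]_4).

Lemma map_ji_horosphere_inj k p : k != 0 -> light_cone p ->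
  map_ji @` horosphere (nullv k) = map_ji @` horosphere p -> p = nullv k.
Proof.
move=> k0 lp e; apply: horosphere_inj => // x hx.
have : (map_ji @` horosphere p) (map_ji x) by rewrite -e; exists x.
by case=> x' hx' /map_ji_inj <-//; [exact: hx'.1 | exact: hx.1].
Qed.

Lemma dh_set_map_K k : dh_set (map_K k) = map_ji @` horosphere (nullv k).
Proof. by rewrite nullv_map_g [LHS]image_comp. Qed.

Lemma centre_map_K k : k != 0 -> centre (dh_set (map_K k)) = ray (nullv k).
Proof.
move=> k0; rewrite dh_set_map_K; apply/seteqP; split => x /=.
  by case=> p [lp [e xp]]; rewrite -(map_ji_horosphere_inj k0 lp e).
by move=> xk; exists (nullv k); split => //; exact: nullv_light.
Qed.

(** Modulo k, the vector Z(k) is - i |k|^2 b. *)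
Lemma herm_Z k b : spinor_ip k b = 1 ->
  exists a : R, herm k (spinor_Z k) =
    a *: nullv k + (nsq (k 0 0) + nsq (k 1 0)) *: herm k (negi *: b).
Proof.
move=> kb; pose s := nsq (k 0 0) + nsq (k 1 0).
have kZ : spinor_ip k (spinor_Z k) = s%:C * negi.
  rewrite /spinor_ip !mxE /= imaginaryE; apply: complexP;
  rewrite ?cE Re_negi Im_negi /s /nsq /=; ring.
have [|c Zc] := @ip_eq0 R k (spinor_Z k - (s%:C * negi) *: b) (unimodular_neq0 kb).
  by rewrite ipDr ipNr ipZr kb mulr1 kZ subrr.
exists (2 * Re c).
have -> : spinor_Z k = c *: k + (s%:C * negi) *: b by rewrite -Zc subrK.
rewrite hermDr hermZr herm_negikk scaler0 subr0 hermkk -scalerA hermRr scalerA.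
by rewrite (mulrC 2).
Qed.

Lemma dh_dir_map_K k b v : k != 0 -> spinor_ip k b = 1 ->
  dh_dir (map_K k) (map_ji (frH k b).1, v) ->
  exists2 a : R, 0 < a & v = a *: row 1 (frU k b).2.
Proof.
move=> k0 kb; rewrite /map_K /push_dec /=.
case=> -[y w] [[x u] /= [hx [[_ [ux up]] or]]] [<- <-] [e <-].
move: hx up or; rewrite -nullv_map_g => hx up or.
have {}e : x = (frH k b).1 by apply: map_ji_inj => //; [exact: hx.1 | exact: hyperboloid_frH].
case: or => _ [a [c [c0 ->]]] uE.
have [a' hZ] := herm_Z kb.
set s := nsq _ + nsq _ in hZ.
have s0 : 0 < s.
  by have := (nullv_light k0).2; rewrite nullvE mxE.
have {}uE : u = (a + c * a') *: nullv k + (c * s) *: herm k (negi *: b).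
  rewrite -uE scalerDl -addrA -!scalerA -scalerDr -hZ nullv_map_g herm_map_g.
  by apply: row4P; rewrite [LHS]mxE !mxE /= !cE /=; ring.
have a0 : a + c * a' = 0.
  have t1 : mink (herm k (negi *: b)) (frH k b).1 = 0.
    have := @frH_tangent R k b 1; rewrite row_mat3 minkZl => /eqP.
    by rewrite mulf_eq0 invr_eq0 pnatr_eq0 /= => /eqP.
  have := ux; rewrite uE e minkDl !minkZl t1 mulr0 addr0.
  by rewrite (minkC (nullv k)) (horosphere_pt kb).2 mulr1.
exists (2 * (c * s)); first by rewrite !mulr_gt0.
rewrite rowK row_mat3 -dmap_jiZ e uE a0 scale0r add0r scalerA.
by rewrite (_ : _ * 2^-1 = c * s)//; field.
Qed.

End DecoratedHorospheres.

Section FrameDetermined.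
Context {R : realType}.

Lemma sum3 (V : nmodType) (F : 'I_3 -> V) : \sum_i F i = F 0 + F 1 + F 2.
Proof.
rewrite !big_ord_recl big_ord0 addr0 !addrA.
by congr (_ + _ + _); congr F; apply/val_inj.
Qed.

Lemma metricU_dot (q u v : 'rV[R]_3) : 0 < q 0 2 ->
  metricU q u v = (u *m (q 0 2 ^- 2 *: v^T)) 0 0.
Proof.
by move=> q0; rewrite /metricU -scalemxAr mxE [in RHS]mxE sum3 !mxE mulrC.
Qed.

Lemma metricUZ (q u v : 'rV[R]_3) (a c : R) :
  metricU q (a *: u) (c *: v) = a * c * metricU q u v.
Proof. by rewrite /metricU !mxE; ring. Qed.

(** The third vector of an orthonormal frame is determined up to sign by the
    first two, and the sign by the orientation. *)
Lemma frameU_eq (f f' : frame R) : frameU R f -> frameU R f' -> f.1 = f'.1 ->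
  row 0 f.2 = row 0 f'.2 -> row 1 f.2 = row 1 f'.2 -> f = f'.
Proof.
case: f f' => q M [q' M'] /= [z0 [oM dM]] [_ [oM' dM']] /= eq; subst q'.
move=> e0 e1; congr pair; set z := q 0 2 in z0.
have dot (N N' : 'M[R]_3) a b : (N *m (z ^- 2 *: N'^T)) a b = metricU q (row a N) (row b N').
  by rewrite metricU_dot// -!scalemxAr !mxE; congr (_ * _); apply: eq_bigr => i _; rewrite !mxE.
have MM : M *m (z ^- 2 *: M^T) = 1%:M by apply/matrixP => a b; rewrite dot oM mxE.
pose t := metricU q (row 2 M') (row 2 M).
have e2 : row 2 M' = t *: row 2 M.
  have -> : row 2 M' = row 2 (M' *m (z ^- 2 *: M^T)) *m M.
    by rewrite -row_mul -mulmxA (mulmx1C MM) mulmx1.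
  rewrite mulmx_sum_row sum3 ![row 2 _ 0 _]mxE !dot e0 e1 !oM' /=.
  by rewrite !scale0r !add0r.
have dE : \det M' = t * \det M.
  rewrite (mat3E M') (mat3E M) !det_mat3 e0 e1 e2 /det3 !mxE; ring.
have t0 : 0 < t by move: dM'; rewrite dE pmulr_lgt0.
have tt : t * t = 1 by have := oM' 2 2; rewrite e2 metricUZ oM mulr1.
have t1 : t = 1 by nra.
by apply: mat3P => //; rewrite e2 t1 scale1r.
Qed.

Local Notation negi := (negi R).
Implicit Types (k b : spinor R) (x p : 'rV[R]_4).

(** The first vector of f^out is the normal of the horosphere, which is the
    first vector of [frU k b], and the second one is the unit vector of the
    decoration. *)
Lemma is_fout_frU k q f : k != 0 -> is_fout (map_K k) q f ->
  exists2 b, spinor_ip k b = 1 & f = frU k b.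
Proof.
move=> k0 [fU [fq [[p [x [N [lp [hE [px [qx [nN [Nx [_ [_ rN]]]]]]]]]]] dir]]].
have pk : p = nullv k by apply: (map_ji_horosphere_inj k0 lp); rewrite -hE dh_set_map_K.
subst p; have [b kb xb] := horosphereP k0 px.
have fU' := frameU_frU kb.
exists b => //; apply: frameU_eq => //; first by rewrite fq qx xb.
  rewrite nN rowK row_mat3 -xb; congr dmap_ji.
  case: rN => a a0 e.
  have a1 : a = 1.
    have : mink (x + N) x = a by rewrite e minkZl minkC px.2 mulr1.
    by rewrite minkDl Nx addr0 px.1.1.
  move: e; rewrite a1 scale1r xb => /(canRL (addKr _)) ->.
  by apply/rowP => j; rewrite !mxE; field.
move: dir; rewrite qx xb => /(dh_dir_map_K k0 kb)[a a0 e].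
have := fU.2.1 1 1; rewrite e metricUZ fq qx xb.
have -> : map_ji (frH k b).1 = (frU k b).1 by [].
rewrite (fU'.2.1 1 1) mulr1 => aa.
have {}aa : a * a = 1 by [].
have a1 : a = 1 by nra.
by rewrite a1 scale1r.
Qed.

Lemma push_frame_inj (xF xF' : 'rV[R]_4 * 'M[R]_(3, 4)) : frameH xF -> frameH xF' -> push_frame xF = push_frame xF' -> xF = xF'.
Proof.
case: xF xF' => x F [x' F'] [hx [tF _]] [hx' [tF' _]] [e1 e2].
rewrite /= in hx hx' tF tF'; have ex := map_ji_inj hx hx' e1; subst x'; congr pair.
apply/row_matrixP => a; apply: (dmap_ji_inj hx (tF a) (tF' a)).
by have := congr1 (row a) e2; rewrite !rowK.
Qed.

(** The kernel of SL(2, C) -> SO(1, 3) is {1, -1}.  The null vectors [nullv k]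
    and [nullv b] determine k and b up to phases c and d with c d = 1, and the
    vector [herm k b] determines the square of c. *)
Lemma frU_inj k b k' b' : spinor_ip k b = 1 -> spinor_ip k' b' = 1 ->
  frU k b = frU k' b' -> k' = k /\ b' = b \/ k' = - k /\ b' = - b.
Proof.
move=> kb kb' /(push_frame_inj (frameH_frH kb) (frameH_frH kb'))[e1 e2].
have r a := congr1 (row a) e2.
have r0 := r 0; have r2 := r 2; move: r0 r2 e1; rewrite /frH !row_mat3 => r0 r2 e1.
have nk : nullv k = nullv k'.
  apply/rowP => j; move/rowP: r0 => /(_ j); move/rowP: e1 => /(_ j); rewrite !mxE; lra.
have nb : nullv b = nullv b'.
  apply/rowP => j; move/rowP: r0 => /(_ j); move/rowP: e1 => /(_ j); rewrite !mxE; lra.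
have hh : herm k b = herm k' b'.
  by apply/rowP => j; move/rowP: r2 => /(_ j); rewrite !mxE; lra.
have ip0 (u v : spinor R) : nullv u = nullv v -> spinor_ip u v = 0.
  move=> e; have : mink (nullv u) (nullv v) = 0 by rewrite -e mink_nullv ipkk /nsq /= expr0n addr0 mulr0.
  by rewrite mink_nullv => /eqP; rewrite mulf_eq0 pnatr_eq0 /= nsq_eq0 => /eqP.
have [c kc] := ip_eq0 (unimodular_neq0 kb) (ip0 _ _ nk).
have b0 : b != 0.
  by apply: (@unimodular_neq0 _ b (- k)); rewrite ipNr ipC opprK.
have [d bd] := ip_eq0 b0 (ip0 _ _ nb).
have cd : c * d = 1 by move: kb'; rewrite kc bd ipZl ipZr kb mulr1.
have c1 : nsq c = 1.
  have : nsq c *: nullv k = 1 *: nullv k by rewrite -nullvZ -kc -nk scale1r.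
  move/rowP/(_ 0); rewrite !mxE; apply: mulIf.
  by rewrite gt_eqF// (nullv_light (unimodular_neq0 kb)).2.
have dc : d = conjc c.
  have c0 : c != 0 by rewrite -nsq_eq0 c1 oner_eq0.
  apply: (mulfI c0); rewrite cd; move: c1; rewrite /nsq; case: (c) => x y /= xy.
  by apply: complexP => /=; [rewrite -xy; ring | ring].
move: hh; rewrite kc bd hermJ scalerA dc hermZr => hh.
have h1 : mink (herm k b) (herm k b) = - 4.
  by rewrite mink_herm !ip_lin (ipC b k) kb /=; ring.
have h2 : mink (herm k b) (herm k (negi *: b)) = 0.
  have := frH_orthonormal kb 2 1; rewrite !row_mat3 minkZl minkZr /=; lra.
have : Re (conjc c * conjc c) = 1.
  by move: (congr1 (mink (herm k b)) hh); rewrite minkDr minkNr !minkZr h1 h2; lra.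
move: c1; rewrite /nsq; case: (c) dc => x y dc /= xy xx.
have y0 : y = 0 by nra.
have : (x - 1) * (x + 1) = 0 by move: xx; rewrite y0; lra.
move=> /eqP; rewrite mulf_eq0 subr_eq0 addr_eq0 => /orP[] /eqP x1.
  left; have -> : (x +i* y) = 1 :> R[i] by rewrite x1 y0.
  have -> : (x -i* y) = 1 :> R[i] by rewrite x1 y0 oppr0.
  by rewrite !scale1r.
right; have -> : (x +i* y) = -1 :> R[i] by rewrite x1 y0; apply: complexP => /=; rewrite ?oppr0.
have -> : (x -i* y) = -1 :> R[i] by rewrite x1 y0; apply: complexP => /=; rewrite ?oppr0.
by rewrite !scaleN1r.
Qed.
End FrameDetermined.

(** * Uniqueness of lifts along paths *)

Section UniqueLifting.
Context {R : realType} {E B : topologicalType} (A : set B) (p : E -> B).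
Hypothesis cov : double_covering A p.

Lemma connected_setT : connected [set: R].
Proof. by apply/connected_intervalP => x y _ _ z. Qed.

Lemma sheet e : exists U, exists V : bool -> set E, exists i,
  [/\ open_nbhs (p e) U, (forall j, open (V j)), V true `&` V false = set0,
      p @^-1` U = V true `|` V false & V i e /\ set_bij (V i) (U `&` A) p /\
     forall O, open O -> O `<=` V i -> exists2 O', open O' & p @` O = O' `&` A].
Proof.
case: cov => _ [im loc]; have [|U oU [V [oV [dV [eV bV]]]]] := loc (p e).
  by rewrite -im; exists e.
have : (V true `|` V false) e by rewrite -eV; exact: nbhs_singleton (open_nbhs_nbhs oU).
by case=> Ve; exists U, V; [exists true | exists false]; split => //; split => //; exact: bV.
Qed.

(** The set where two lifts agree is open and closed, because the sheets over
    an evenly covered set are open and disjoint. *)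
Lemma lift_unique (s t : R -> E) u0 : continuous s -> continuous t ->
  (forall u, p (s u) = p (t u)) -> s u0 = t u0 -> s =1 t.
Proof.
move=> cs ct pst e0; pose D := [set u | s u = t u].
have key u : (D u -> \forall v \near u, D v) /\ (~ D u -> \forall v \near u, ~ D v).
  have [U [V [i [oU oV dV eV [Vi [[_ inj _] _]]]]]] := sheet (s u).
  have si : \forall v \near u, V i (s v) by apply: cs; exact: open_nbhs_nbhs.
  have [j Vj] : exists j, V j (t u).
    have : (V true `|` V false) (t u).
      by rewrite -eV /= -pst; exact: nbhs_singleton (open_nbhs_nbhs oU).
    by case; [exists true | exists false].
  have tj : \forall v \near u, V j (t v) by apply: ct; exact: open_nbhs_nbhs.
  have [ij|ij] := eqVneq i j.
    subst j; have Dv : \forall v \near u, D v.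
      near=> v; apply: inj; rewrite ?inE //; [near: v; exact: si|near: v; exact: tj].
    by split => // /(_ (nbhs_singleton Dv)).
  have Dv : \forall v \near u, ~ D v.
    near=> v => Dv; have : V i (s v) by near: v.
    have : V j (s v) by rewrite (Dv : s v = t v); near: v.
    have : V true `&` V false `<=` set0 by rewrite dV.
    move=> + Vjv Viv; move=> /(_ (s v)); apply.
    by move: ij Vjv Viv; case: (i) (j) => [] [].
  by split => // Du; have := nbhs_singleton Dv.
have DT : D = [set: R].
  apply: connected_setT; first by exists u0.
    exists D; rewrite ?setTI// openE => u Du; exact: (key u).1.
  exists D; rewrite ?setTI// -openC openE => u Du; exact: (key u).2.
by move=> u; have : D u by rewrite DT.
Unshelve. all: by end_near.
Qed.
End UniqueLifting.

(** * Continuity of frames *)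

(** Continuity at a point, as a constant on which the tactic [cont] can
    match. *)
Definition cont_at (T U : topologicalType) (f : T -> U) (x : T) : Prop :=
  f @ x --> f x.

Section Continuity.
Context {R : realType} {T : topologicalType}.
Implicit Types (f g : T -> R) (x : T).

Lemma cont_eq (U : topologicalType) (f g : T -> U) x :
  (forall t, f t = g t) -> cont_at f x -> cont_at g x.
Proof. by move=> /funext ->. Qed.

Lemma cont_comp (U V : topologicalType) (f : T -> U) (g : U -> V) x :
  cont_at f x -> cont_at g (f x) -> cont_at (fun t => g (f t)) x.
Proof. by move=> cf cg; exact: (cvg_comp f g cf cg). Qed.

Lemma contD f g x : cont_at f x -> cont_at g x ->
  cont_at (fun t => f t + g t) x.
Proof. by move=> cf cg; apply: cvgD. Qed.
Lemma contM f g x : cont_at f x -> cont_at g x ->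
  cont_at (fun t => f t * g t) x.
Proof. by move=> cf cg; apply: cvgM. Qed.
Lemma contN f x : cont_at f x -> cont_at (fun t => - f t) x.
Proof. by move=> cf; apply: cvgN. Qed.
Lemma contV f x : f x != 0 -> cont_at f x -> cont_at (fun t => (f t)^-1) x.
Proof. by move=> fx cf; apply: cvgV. Qed.
Lemma contX f n x : cont_at f x -> cont_at (fun t => f t ^+ n) x.
Proof.
move=> cf; elim: n => [|n ih]; first exact: cst_continuous.
by apply: (cont_eq (fun t => esym (exprS (f t) n))); exact: contM.
Qed.
Lemma contC (c : R) x : cont_at (fun _ : T => c) x.
Proof. exact: cst_continuous. Qed.

Lemma cont_mx (U : topologicalType) m n (f : T -> 'M[U]_(m, n)) x :
  (forall i j, cont_at (fun t => f t i j) x) -> cont_at f x.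
Proof.
move=> H A [P HP sPA].
have : \forall t \near x, forall i j, P i j (f t i j).
  by apply: filter_forall => i; apply: filter_forall => j; exact: H.
by apply: filterS => t Pt; exact: sPA.
Qed.

Lemma cont_row3 f g (h : T -> R) x : cont_at f x -> cont_at g x ->
  cont_at h x -> cont_at (fun t => row3 (f t) (g t) (h t)) x.
Proof.
move=> cf cg ch; apply: cont_mx => i j; rewrite ord1.
move: j; apply: I3P.
- by apply: cont_eq cf => t; rewrite mxE.
- by apply: cont_eq cg => t; rewrite mxE.
- by apply: cont_eq ch => t; rewrite mxE.
Qed.

Lemma cont_mat3 (f g h : T -> 'rV[R]_3) x : cont_at f x -> cont_at g x ->
  cont_at h x -> cont_at (fun t => mat3 (f t) (g t) (h t)) x.
Proof.
move=> cf cg ch; apply: cont_mx => i j; move: i.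
have co (F : T -> 'rV[R]_3) : cont_at F x -> cont_at (fun t => F t 0 j) x.
  by move=> cF; apply: (@cont_comp _ _ F (fun M : 'rV[R]_3 => M 0 j)) => //; exact: coord_continuous.
apply: I3P.
- by apply: cont_eq (co _ cf) => t; rewrite mxE.
- by apply: cont_eq (co _ cg) => t; rewrite mxE.
- by apply: cont_eq (co _ ch) => t; rewrite mxE.
Qed.

Lemma cont_complex (f : T -> R[i]) x : cont_at (fun t => Re (f t)) x ->
  cont_at (fun t => Im (f t)) x -> cont_at f x.
Proof.
move=> cr ci; apply/cvgrPdist_lt => e; rewrite ltcE => /andP[/eqP /= e0 /= e1].
have -> : e = (Re e)%:C by apply: complexP.
have e2 : 0 < Re e / 2 by rewrite divr_gt0.
move/cvgrPdist_lt/(_ _ e2): cr => cr; move/cvgrPdist_lt/(_ _ e2): ci => ci.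
near=> t; rewrite normc_def ltcR !cE.
have h1 : `|Re (f x) - Re (f t)| < Re e / 2 by near: t.
have h2 : `|Im (f x) - Im (f t)| < Re e / 2 by near: t.
have -> : Re e = Num.sqrt (Re e ^+ 2) by rewrite sqrtr_sqr ger0_norm// ltW.
rewrite ltr_sqrt ?exprn_gt0//.
rewrite -(real_normK (num_real (_ - _))) -[X in _ + X](real_normK (num_real (_ - _))).
have := normr_ge0 (Re (f x) - Re (f t)); have := normr_ge0 (Im (f x) - Im (f t)).
nra.
Unshelve. all: by end_near.
Qed.

Definition cont_spinor x (k : T -> spinor R) := forall j,
  cont_at (fun t => Re (k t j 0)) x /\ cont_at (fun t => Im (k t j 0)) x.

Lemma cont_spinorP x k : cont_spinor x k -> cont_at k x.
Proof.
move=> ck; apply: cont_mx => i j; rewrite (ord1 j).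
exact: cont_complex (ck i).1 (ck i).2.
Qed.
End Continuity.
Lemma cont_scale_mx {R : realType} {T : topologicalType} m n (f : T -> R) (M : T -> 'M[R]_(m.+1, n.+1)) x :
  cont_at f x -> cont_at M x -> cont_at (fun t => f t *: M t) x.
Proof.
move=> cf cM; apply: cont_mx => i j.
apply: (cont_eq (f := fun t => f t * M t i j)); first by move=> t; rewrite mxE.
apply: contM => //.
by apply: (@cont_comp _ _ _ M (fun N : 'M[R]_(m.+1, n.+1) => N i j)) => //; exact: coord_continuous.
Qed.

Ltac cont := repeat lazymatch goal with
  | |- cont_at (fun t => @?f t + @?g t) _ => apply: contD
  | |- cont_at (fun t => @?f t * @?g t) _ => apply: contM
  | |- cont_at (fun t => - @?f t) _ => apply: contN
  | |- cont_at (fun t => @?f t ^+ _) _ => apply: contX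
  | |- cont_at (fun _ => ?c) _ => exact: contC
  | |- _ => assumption
  end.

Section FrameContinuity.
Context {R : realType} {T : topologicalType}.
Implicit Types (k b : T -> spinor R).

Lemma cont_pair (U V : topologicalType) (f : T -> U) (g : T -> V) x :
  cont_at f x -> cont_at g x -> cont_at (fun t => (f t, g t)) x.
Proof. by move=> cf cg; apply: cvg_pair. Qed.

Lemma frU_pt (k b : spinor R) : spinor_ip k b = 1 ->
  let w := Re (k 1 0) ^+ 2 + Im (k 1 0) ^+ 2 + (Re (b 1 0) ^+ 2 + Im (b 1 0) ^+ 2) in
  0 < w /\ (frU k b).1 = row3
    ((Re (k 0 0) * Re (k 1 0) + Im (k 0 0) * Im (k 1 0)
      + (Re (b 0 0) * Re (b 1 0) + Im (b 0 0) * Im (b 1 0))) / w)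
    ((Im (k 0 0) * Re (k 1 0) - Re (k 0 0) * Im (k 1 0)
      + (Im (b 0 0) * Re (b 1 0) - Re (b 0 0) * Im (b 1 0))) / w)
    w^-1.
Proof.
move=> kb w; have hx := hyperboloid_frH kb.
have hw : ht (frH k b).1 = w by exact: ht_frH.
split; first by rewrite -hw; exact: hyp_ht.
rewrite /= map_jiE// hw !nullvE row4_lin row4_lin !mxE /=.
by congr row3; congr (_ / _); field.
Qed.

Lemma cont_frU k b x : cont_spinor x k -> cont_spinor x b ->
  (forall t, spinor_ip (k t) (b t) = 1) -> cont_at (fun t => frU (k t) (b t)) x.
Proof.
move=> ck cb kb.
have [k0r k0i] := ck 0; have [k1r k1i] := ck 1; have [b0r b0i] := cb 0; have [b1r b1i] := cb 1.
pose w t := Re (k t 1 0) ^+ 2 + Im (k t 1 0) ^+ 2 + (Re (b t 1 0) ^+ 2 + Im (b t 1 0) ^+ 2).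
have cw : cont_at w x by rewrite /w; cont.
have cwi : cont_at (fun t => (w t)^-1) x.
  by apply: contV => //; rewrite gt_eqF// (frU_pt (kb x)).1.
apply: (cont_eq (f := fun t => ((frU (k t) (b t)).1, (frU (k t) (b t)).2))).
  by move=> t; case: (frU _ _).
apply: cont_pair.
  apply: (cont_eq (fun t => esym (frU_pt (kb t)).2)).
  by apply: cont_row3; cont.
apply: (cont_eq (fun t => esym (frU_explicit (kb t)))).
apply: cont_scale_mx.
  by apply: (cont_eq (f := fun t => (w t)^-1 ^+ 2)); [move=> t; rewrite exprVn | cont].
by apply: cont_mat3; apply: cont_row3; cont.
Qed.

(** 2 (cosh r - 1) for points at hyperbolic distance r, see [map_j_isometry]. *)
Definition hdelta (q q' : 'rV[R]_3) := sqn (q - q') / (q 0 2 * q' 0 2).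

Lemma hdelta_mink (x x' : 'rV[R]_4) : hyperboloid x -> hyperboloid x' ->
  hdelta (map_ji x) (map_ji x') = 2 * mink x x' - 2.
Proof.
move=> hx hx'; have h0 := lt0r_neq0 (hyp_ht hx); have h0' := lt0r_neq0 (hyp_ht hx').
rewrite !map_jiE// /hdelta /sqn !mxE /=.
have ex : x 0 1 * x 0 1 + x 0 2 * x 0 2 + 1 = ht x * (x 0 0 + x 0 3).
  by move: hx.1; rewrite /mink /ht; lra.
have ex' : x' 0 1 * x' 0 1 + x' 0 2 * x' 0 2 + 1 = ht x' * (x' 0 0 + x' 0 3).
  by move: hx'.1; rewrite /mink /ht; lra.
transitivity ((x 0 1 * x 0 1 + x 0 2 * x 0 2 + 1) * ht x' / ht x
   + (x' 0 1 * x' 0 1 + x' 0 2 * x' 0 2 + 1) * ht x / ht x'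
   - 2 * (x 0 1 * x' 0 1 + x 0 2 * x' 0 2 + 1)).
  by field; rewrite h0 h0'.
rewrite ex ex' /mink; transitivity ((x 0 0 + x 0 3) * ht x' + (x' 0 0 + x' 0 3) * ht x
   - 2 * (x 0 1 * x' 0 1 + x 0 2 * x' 0 2 + 1)); first by field; rewrite h0 h0'.
by rewrite /ht; ring.
Qed.

(** On a horosphere the shear b + z k displaces the point by a distance that
    depends on |z| only. *)
Lemma hdelta_shear (k b : spinor R) z : spinor_ip k b = 1 ->
  hdelta (frU k b).1 (frU k (b + z *: k)).1 = nsq z.
Proof.
move=> kb; have kb' := ip_shear z kb.
rewrite (hdelta_mink (hyperboloid_frH kb) (hyperboloid_frH kb')).
rewrite minkZl minkZr !minkDl !minkDr !mink_nullv !ip_lin (ipC b k) kb !(addr0, mulr0, mulr1).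
by rewrite /nsq !cE /=; field.
Qed.
End FrameContinuity.

(** * Spin frames of unimodular pairs *)

Section SpinFrameMap.
Context {R : realType} {Spin : topologicalType} {pr : Spin -> frame R}.
Hypothesis cov : double_covering (frameU R) pr.
Variable Kt : spinor R -> spin_dec_horosphere pr.
Hypothesis HKt : is_spin_lift Kt.
Implicit Types (k b : spinor R).

Definition spin_frame k b : Spin := sd_out (Kt k) (frU k b).1.

Lemma cont_spinor_comp (T U : topologicalType) (f : T -> U) (k : U -> spinor R) x :
  cont_at f x -> cont_spinor (f x) k -> cont_spinor x (fun t => k (f t)).
Proof.
move=> cf ck j; have [cr ci] := ck j.
by split; [exact: (cont_comp cf cr) | exact: (cont_comp cf ci)].
Qed.

Lemma frU_pt_inj k b b' : spinor_ip k b = 1 -> spinor_ip k b' = 1 ->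
  (frU k b).1 = (frU k b').1 -> b' = b.
Proof.
move=> kb kb' e.
have [c bc] : exists c : R[i], b' = b + c *: k.
  have [|c e'] := @ip_eq0 R k (b' - b) (unimodular_neq0 kb).
    by rewrite ipDr ipNr kb kb' subrr.
  by exists c; rewrite -e' addrC subrK.
have := hdelta_shear c kb; rewrite -bc -e.
have -> : hdelta (frU k b).1 (frU k b).1 = 0.
  by rewrite /hdelta /sqn subrr !mxE expr0n /= !addr0 mul0r.
by move=> /esym/eqP; rewrite nsq_eq0 bc => /eqP ->; rewrite scale0r addr0.
Qed.

Lemma dh_set_frU k b : spinor_ip k b = 1 -> dh_set (sd_dec (Kt k)) (frU k b).1.
Proof.
move=> kb; rewrite HKt.2 ?(unimodular_neq0 kb)// dh_set_map_K.
by exists (frH k b).1 => //; exact: horosphere_pt.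
Qed.

Lemma sd_out_spin_frame k q : k != 0 -> dh_set (sd_dec (Kt k)) q ->
  exists2 b, spinor_ip k b = 1 & q = (frU k b).1 /\ pr (sd_out (Kt k) q) = frU k b.
Proof.
move=> k0 hq; have := sd_out_lift hq; rewrite HKt.2// => hf.
have [b kb e] := is_fout_frU k0 hf.
by exists b => //; split => //; rewrite -e; case: hf => _ [].
Qed.

Lemma pr_spin_frame k b : spinor_ip k b = 1 -> pr (spin_frame k b) = frU k b.
Proof.
move=> kb; have [b' kb' [e1 e2]] := sd_out_spin_frame (unimodular_neq0 kb) (dh_set_frU kb).
by rewrite /spin_frame e2 (frU_pt_inj kb kb' e1).
Qed.

Lemma cont_at_open (T U : topologicalType) (f : T -> U) (x : T) (O : set U) :
  cont_at f x -> open O -> O (f x) -> \forall t \near x, O (f t).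
Proof. by move=> cf oO Ox; apply: cf; exact: open_nbhs_nbhs. Qed.

(** The topology of spin-decorated horospheres is generated by the sets of those
    that meet a given open set of spin frames. *)
Lemma open_sd_meets (O : set Spin) : open O -> open (sd_meets O : set (spin_dec_horosphere pr)).
Proof.
move=> oO; exists [set sd_meets O]; last by rewrite bigcup_set1.
by move=> _ ->; exact: finI_from1.
Qed.

Lemma connected_one_sheet (E : topologicalType) (C V W : set E) x :
  connected C -> open V -> open W -> V `&` W = set0 -> C `<=` V `|` W -> C x -> V x -> C `<=` V.
Proof.
move=> cC oV oW VW CVW Cx Vx.
suff <- : C `&` V = C by move=> y [].
apply: cC; first by exists x.
  by exists V.
exists (~` W); first exact: open_closedC.
apply/seteqP; split => y [Cy Vy]; split => //.
  by move=> Wy; have : (V `&` W) y by []; rewrite VW.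
by case: (CVW _ Cy).
Qed.

Lemma cont_within (T U V : topologicalType) (A : set U) (f : T -> U) (g : U -> V) x :
  {within A, continuous g} -> cont_at f x -> (forall t, A (f t)) -> cont_at (fun t => g (f t)) x.
Proof.
move=> /subspace_continuousP cg cf Af.
apply: (cvg_comp f g _ (cg _ (Af x))).
move=> B HB; have H : \forall t \near x, A (f t) -> B (f t) by exact: cf HB.
have : \forall t \near x, B (f t) by apply: filterS H => t Ht; exact: (Ht (Af t)).
by [].
Qed.

Lemma cont_spin_frame_horosphere k (b : R -> spinor R) u :
  cont_spinor u b -> (forall t, spinor_ip k (b t) = 1) -> cont_at (fun t => spin_frame k (b t)) u.
Proof.
move=> cb kb; apply: (cont_within (@sd_out_continuous _ _ _ (Kt k))).
  have ck : cont_spinor u (fun _ : R => k) by move=> j; split; exact: contC.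
  by apply: (@cont_comp _ _ _ _ fst); [exact: cont_frU | exact: cvg_fst].
by move=> t; exact: dh_set_frU.
Qed.

Lemma hdeltaE (q q' : 'rV[R]_3) : hdelta q q' =
  ((q 0 0 - q' 0 0) ^+ 2 + (q 0 1 - q' 0 1) ^+ 2 + (q 0 2 - q' 0 2) ^+ 2)
  * (q 0 2 * q' 0 2)^-1.
Proof. by rewrite /hdelta /sqn !mxE. Qed.

Section Near.
Variables (T : topologicalType) (k b : T -> spinor R) (u : T).
Hypotheses (ck : cont_spinor u k) (cb : cont_spinor u b).
Hypothesis kb : forall t, spinor_ip (k t) (b t) = 1.

(** The spin frame of Kt (k t) found near a given one differs from that of the
    pair (k t, b t) by a shear; this bounds the shears, uniformly in t, for
    which the frames remain over an evenly covered set. *)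
Lemma near_shear (N : set (frame R)) : nbhs (frU (k u) (b u)) N ->
  exists2 e : R, 0 < e & \forall t \near u, forall z : R[i],
    nsq z < e ^+ 2 -> N (frU (k t) (b t + z *: k t)).
Proof.
move=> QU.
pose kz (tz : T * (R * R)) := k tz.1.
pose bz (tz : T * (R * R)) := b tz.1 + (tz.2.1 +i* tz.2.2) *: k tz.1.
pose x0 : T * (R * R) := (u, (0, 0)).
have c1 : cont_at fst x0 by exact: cvg_fst.
have c2 : cont_at (fun tz : T * (R * R) => tz.2.1) x0.
  by apply: (@cont_comp _ _ _ snd fst); [exact: cvg_snd | exact: cvg_fst].
have c3 : cont_at (fun tz : T * (R * R) => tz.2.2) x0.
  by apply: (@cont_comp _ _ _ snd snd); [exact: cvg_snd | exact: cvg_snd].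
have ckz : cont_spinor x0 kz by exact: cont_spinor_comp c1 ck.
have [cb0 cb1] : (forall j, cont_at (fun tz : T * (R * R) => Re (b tz.1 j 0)) x0) /\
    (forall j, cont_at (fun tz : T * (R * R) => Im (b tz.1 j 0)) x0).
  have cbf := cont_spinor_comp (x := x0) c1 cb.
  by split=> j; have [] := cbf j.
have cbz : cont_spinor x0 bz.
  move=> j; have [c4 c5] := ckz j; have c6 := cb0 j; have c7 := cb1 j; split.
    apply: (cont_eq (f := fun tz : T * (R * R) => Re (b tz.1 j 0) +
        (tz.2.1 * Re (kz tz j 0) + - (tz.2.2 * Im (kz tz j 0))))); last by cont.
    by move=> tz; rewrite /bz !linE ReD ReM.
  apply: (cont_eq (f := fun tz : T * (R * R) => Im (b tz.1 j 0) +
      (tz.2.1 * Im (kz tz j 0) + tz.2.2 * Re (kz tz j 0)))); last by cont.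
  by move=> tz; rewrite /bz !linE ImD ImM.
have cf := cont_frU ckz cbz (fun tz => ip_shear _ (kb tz.1)).
have : \forall tz \near x0, N (frU (kz tz) (bz tz)).
  have E : frU (kz x0) (bz x0) = frU (k u) (b u).
    by congr frU; rewrite /bz (_ : _ +i* _ = 0)// scale0r addr0.
  by apply: cf; rewrite E.
case=> -[N1 N2] /= [n1 /nbhs_ballP[e /= e0 n2]] sub.
exists e => //; apply: filterS n1 => t N1t z ze.
have := sub (t, (Re z, Im z)); rewrite /kz /bz /= (_ : Re z +i* Im z = z); last by case: (z).
apply; split => //; apply: n2; rewrite /ball /= /ball /=.
have h (r : R) : r ^+ 2 < e ^+ 2 -> `|0 - r| < e.
  by move=> re; rewrite sub0r normrN -(ltr_pXn2r (n := 2)) ?nnegrE ?(ltW e0)// real_normK ?num_real.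
by split; apply: h; move: ze; rewrite /nsq; apply: le_lt_trans; rewrite ?lerDl ?lerDr sqr_ge0.
Qed.

Lemma near_hdelta (e : R) : 0 < e ->
  \forall t \near u & f \near frU (k u) (b u), hdelta (frU (k t) (b t)).1 f.1 < e.
Proof.
move=> e0.
pose x0 : T * frame R := (u, frU (k u) (b u)).
pose q1 (x : T * frame R) := (frU (k x.1) (b x.1)).1.
pose q2 (x : T * frame R) : 'rV[R]_3 := x.2.1.
have cq1 : cont_at q1 x0.
  have c1 : cont_at fst x0 by exact: cvg_fst.
  apply: (cont_comp (g := fun t => (frU (k t) (b t)).1) c1).
  by apply: (@cont_comp _ _ _ _ fst); [exact: cont_frU | exact: cvg_fst].
have cq2 : cont_at q2 x0.
  by apply: (@cont_comp _ _ _ snd fst); [exact: cvg_snd | exact: cvg_fst].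
have co (q : T * frame R -> 'rV[R]_3) j : cont_at q x0 -> cont_at (fun x => q x 0 j) x0.
  by move=> cq; apply: (@cont_comp _ _ _ q (fun M : 'rV[R]_3 => M 0 j)) => //; exact: coord_continuous.
have z0 : q1 x0 0 2 * q2 x0 0 2 != 0.
  have [w0 e1] := frU_pt (kb u).
  have -> : q1 x0 = (frU (k u) (b u)).1 by [].
  have -> : q2 x0 = (frU (k u) (b u)).1 by [].
  by rewrite e1 !mxE mulf_neq0 ?invr_eq0 ?gt_eqF.
have cd : cont_at (fun x => hdelta (q1 x) (q2 x)) x0.
  have [[c0 c1] c2] := (co _ 0 cq1, co _ 1 cq1, co _ 2 cq1).
  have [[d0 d1] d2] := (co _ 0 cq2, co _ 1 cq2, co _ 2 cq2).
  have ci : cont_at (fun x => (q1 x 0 2 * q2 x 0 2)^-1) x0 by apply: (contV (f := fun x => q1 x 0 2 * q2 x 0 2) z0); exact: contM.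
  apply: (cont_eq (f := fun x => ((q1 x 0 0 + - q2 x 0 0) ^+ 2 + (q1 x 0 1 + - q2 x 0 1) ^+ 2
    + (q1 x 0 2 + - q2 x 0 2) ^+ 2) * (q1 x 0 2 * q2 x 0 2)^-1)).
    by move=> x; rewrite hdeltaE.
  by apply: (contM _ ci); cont.
have : \forall x \near x0, hdelta (q1 x) (q2 x) < e.
  apply: (cvgr_lt _ cd); rewrite /q1 /q2 /x0 /= /hdelta /sqn subrr !mxE expr0n /= !addr0 mul0r.
  exact: e0.
by [].
Qed.
End Near.

(** Continuity of Kt only says that for t near u the decoration of Kt (k t)
    meets each neighbourhood P of the spin frame at u, at some point that need
    not be the one of (k t, b t).  That point belongs to a pair
    (k t, b t + c k t), and c is small because the points are close
    ([near_hdelta], [hdelta_shear]).  The path of pairs (k t, b t + r c k t),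
    r in [0, 1], stays over one evenly covered set, and on it the decoration of
    the fixed horosphere is continuous; so the path of spin frames stays in one
    sheet, on which the projection is injective. *)
Lemma spin_frame_continuous (T : topologicalType) (k b : T -> spinor R) (u : T) :
  cont_spinor u k -> cont_spinor u b -> (forall t, spinor_ip (k t) (b t) = 1) ->
  cont_at (fun t => spin_frame (k t) (b t)) u.
Proof.
move=> ck cb kb W nW; set s0 := spin_frame (k u) (b u) in nW *.
have prs0 : pr s0 = frU (k u) (b u) by exact: pr_spin_frame.
have k0 t : k t != 0 := unimodular_neq0 (kb t).
have [U [V [i [oU oV dV eV [Vi [[_ inj _] loc]]]]]] := sheet cov s0.
have cpr : continuous pr by case: cov.
pose P := V i `&` W°.
have oP : open P by apply: openI; [exact: oV | exact: open_interior].
have Ps0 : P s0 by split.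
have [|Q oQ eQ] := loc P oP; first by move=> x [].
have QU : nbhs (frU (k u) (b u)) (Q `&` U).
  apply: filterI; last by rewrite -prs0; exact: open_nbhs_nbhs.
  have : (Q `&` frameU R) (frU (k u) (b u)) by rewrite -eQ; exists s0.
  by case=> Qf _; exact: open_nbhs_nbhs.
have [e e0 near1] := near_shear ck cb kb QU.
have e2 : 0 < e ^+ 2 by rewrite exprn_gt0.
have near2 := near_hdelta ck cb kb e2.
case: near2 => -[N3 N4] [/= n3 n4] near2.
pose P1 := P `&` pr @^-1` N4°.
have oP1 : open P1 by apply: openI => //; apply: open_comp => [x _|]; [exact: cpr | exact: open_interior].
have P1s0 : P1 s0 by split => //; rewrite /= prs0.
have meets : \forall t \near u, sd_meets P1 (Kt (k t)).
  have ckt : cont_at k u by exact: cont_spinorP.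
  have cKt := HKt.1.
  have cK := cont_within cKt ckt k0.
  have mu : sd_meets P1 (Kt (k u)) by exists (frU (k u) (b u)).1 => //; exact: dh_set_frU.
  exact: (cont_at_open cK (open_sd_meets oP1) mu).
suff : \forall t \near u, W (spin_frame (k t) (b t)) by [].
near=> t.
(* The decoration of Kt (k t) passes through P1 at q, the point of the pair
   (k t, b'). *)
have [q hq [Pq N4q]] : sd_meets P1 (Kt (k t)) by near: t.
have [b' kb' [qb' prq]] := sd_out_spin_frame (k0 t) hq.
have [c bc] : exists c : R[i], b' = b t + c *: k t.
  have [|c e'] := @ip_eq0 R (k t) (b' - b t) (k0 t).
    by rewrite ipDr ipNr kb kb' subrr.
  by exists c; rewrite -e' addrC subrK.
have ce : nsq c < e ^+ 2.
  rewrite -(hdelta_shear c (kb t)) -bc.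
  have := near2 (t, frU (k t) b'); apply; split => /=; first by near: t.
  by rewrite -prq; exact: interior_subset N4q.
have n1t : forall z : R[i], nsq z < e ^+ 2 -> (Q `&` U) (frU (k t) (b t + z *: k t)) by near: t.
pose sg (r : R) := spin_frame (k t) (b t + (r%:C * c) *: k t).
have ipr (r : R) : spinor_ip (k t) (b t + (r%:C * c) *: k t) = 1 by exact: ip_shear.
have csg : continuous sg.
  move=> r; apply: cont_spin_frame_horosphere => // j.
  have cid : cont_at (fun r : R => r) r by exact: cvg_id.
  split.
    apply: (cont_eq (f := fun r : R => Re (b t j 0) + r * (Re c * Re (k t j 0) - Im c * Im (k t j 0)))); last by cont.
    by move=> r'; rewrite !linE !cE /=; ring.
  apply: (cont_eq (f := fun r : R => Im (b t j 0) + r * (Re c * Im (k t j 0) + Im c * Re (k t j 0)))); last by cont.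
  by move=> r'; rewrite !linE !cE /=; ring.
have sg1 : sg 1 = sd_out (Kt (k t)) q by rewrite /sg mul1r -bc qb'.
have sg0 : sg 0 = spin_frame (k t) (b t) by rewrite /sg mul0r scale0r addr0.
have I01 : `[0, 1]%classic (0 : R) /\ `[0, 1]%classic (1 : R) by split; rewrite /= in_itv /= lexx ler01.
have QUr r : `[0, 1]%classic r -> (Q `&` U) (pr (sg r)).
  rewrite /= in_itv /= => /andP[r0 r1]; rewrite pr_spin_frame//; apply: n1t.
  apply: le_lt_trans ce; rewrite /nsq !cE /= !mul0r subr0 addr0 !exprMn -mulrDr.
  by rewrite ler_piMl ?addr_ge0 ?sqr_ge0// expr_le1.
(* The path sg leads from the given spin frame to the one at q without
   leaving the sheet V i. *)
have sub : sg @` `[0, 1]%classic `<=` V i.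
  apply: (@connected_one_sheet _ _ _ (V (~~ i)) (sg 1)) => //.
  - by apply: connected_continuous_connected; [exact: segment_connected | exact: continuous_subspaceT csg].
  - by case: (i); rewrite // setIC.
  - move=> _ [r r01 <-]; have : (pr @^-1` U) (sg r) by case: (QUr r r01).
    by rewrite eV; case: (i); rewrite // setUC.
  - by exists 1 => //; exact: I01.2.
  - by rewrite sg1; case: Pq.
have V0 : V i (sg 0) by apply: sub; exists 0 => //; exact: I01.1.
have : (Q `&` frameU R) (pr (sg 0)).
  by split; [case: (QUr 0 I01.1) | rewrite pr_spin_frame//; exact: frameU_frU].
rewrite -eQ => -[y [Vy Wy] yE].
rewrite -sg0 -(_ : y = sg 0); first exact: interior_subset.
by apply: inj => //; rewrite inE.
Unshelve. all: by end_near.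
Qed.
End SpinFrameMap.

(** * Quaternions and rotations *)

Section Quaternions.
Context {R : realType}.
Implicit Types (p q : 'rV[R]_4) (M N : 'M[R]_3).

(** The rotation v |-> q v q^-1 of imaginary quaternions, for q of norm 1. *)
Definition rot q : 'M[R]_3 :=
  let a := q 0 0 in let b := q 0 1 in let c := q 0 2 in let d := q 0 3 in
  mat3
    (row3 (a ^+ 2 + b ^+ 2 - c ^+ 2 - d ^+ 2) (2 * (b * c - a * d)) (2 * (b * d + a * c)))
    (row3 (2 * (b * c + a * d)) (a ^+ 2 - b ^+ 2 + c ^+ 2 - d ^+ 2) (2 * (c * d - a * b)))
    (row3 (2 * (b * d - a * c)) (2 * (c * d + a * b)) (a ^+ 2 - b ^+ 2 - c ^+ 2 + d ^+ 2)).

Definition qmul p q : 'rV[R]_4 := row4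
  (p 0 0 * q 0 0 - p 0 1 * q 0 1 - p 0 2 * q 0 2 - p 0 3 * q 0 3)
  (p 0 0 * q 0 1 + p 0 1 * q 0 0 + p 0 2 * q 0 3 - p 0 3 * q 0 2)
  (p 0 0 * q 0 2 - p 0 1 * q 0 3 + p 0 2 * q 0 0 + p 0 3 * q 0 1)
  (p 0 0 * q 0 3 + p 0 1 * q 0 2 - p 0 2 * q 0 1 + p 0 3 * q 0 0).

Definition qdot p q : R := p 0 0 * q 0 0 + p 0 1 * q 0 1 + p 0 2 * q 0 2 + p 0 3 * q 0 3.

Lemma matrix3P M N : (forall j, M 0 j = N 0 j) -> (forall j, M 1 j = N 1 j) ->
  (forall j, M 2 j = N 2 j) -> M = N.
Proof. by move=> e0 e1 e2; apply/matrixP; apply: I3P. Qed.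

Lemma mulmx3 M N i j : (M *m N) i j = M i 0 * N 0 j + M i 1 * N 1 j + M i 2 * N 2 j.
Proof. by rewrite mxE sum3. Qed.

Lemma mat3_entry (u v w : 'rV[R]_3) j :
  (mat3 u v w 0 j = u 0 j) * (mat3 u v w 1 j = v 0 j) * (mat3 u v w 2 j = w 0 j).
Proof. by rewrite !mxE. Qed.
Lemma row3_entry (a b c : R) : (row3 a b c 0 0 = a) * (row3 a b c 0 1 = b) * (row3 a b c 0 2 = c).
Proof. by rewrite !mxE. Qed.
Lemma row4_entry (a b c d : R) : (row4 a b c d 0 0 = a) * (row4 a b c d 0 1 = b) *
  (row4 a b c d 0 2 = c) * (row4 a b c d 0 3 = d).
Proof. by rewrite !mxE. Qed.

Lemma rot_qmul p q : rot (qmul p q) = rot p *m rot q.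
Proof.
rewrite /rot /qmul !row4_entry.
move: (p 0 0) (p 0 1) (p 0 2) (p 0 3) (q 0 0) (q 0 1) (q 0 2) (q 0 3) => a b c d a' b' c' d'.
by apply: matrix3P; apply: I3P; rewrite mulmx3 !mat3_entry !row3_entry; ring.
Qed.

Lemma qdot_qmul p q : qdot (qmul p q) (qmul p q) = qdot p p * qdot q q.
Proof. by rewrite /qdot /qmul !row4_entry; ring. Qed.

Lemma mxtrace3 M : \tr M = M 0 0 + M 1 1 + M 2 2.
Proof. by rewrite /mxtrace sum3. Qed.

(** Unit quaternions with the same rotation have the inner product 1 or -1. *)
Lemma trace_rot p q : \tr (rot p *m (rot q)^T) = 4 * qdot p q ^+ 2 - qdot p p * qdot q q.
Proof.
rewrite mxtrace3 !mulmx3 /qdot /rot ![_^T _ _]mxE !mat3_entry !row3_entry.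
by move: (p 0 0) (p 0 1) (p 0 2) (p 0 3) (q 0 0) (q 0 1) (q 0 2) (q 0 3) => a b c d a' b' c' d'; ring.
Qed.

Definition SO3 M : Prop := M *m M^T = 1%:M /\ 0 < \det M.

Lemma SO3_det M : SO3 M -> \det M = 1.
Proof.
move=> [orth d]; have : \det M * \det M = 1 by rewrite -{2}det_tr -det_mulmx orth det1.
by nra.
Qed.

Lemma SO3_tr M : SO3 M -> M^T *m M = 1%:M.
Proof. by case=> orth _; exact: mulmx1C. Qed.

Lemma SO3_adj M : SO3 M -> \adj M = M^T.
Proof.
move=> sM; have d := SO3_det sM.
by rewrite -[LHS]mulmx1 -sM.1 mulmxA mul_adj_mx d mul1mx.
Qed.

Lemma SO3_mul M N : SO3 M -> SO3 N -> SO3 (M *m N^T).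
Proof.
move=> sM sN; split; last by rewrite det_mulmx det_tr !SO3_det// mulr1.
by rewrite trmx_mul trmxK mulmxA -[_ *m _ *m N]mulmxA SO3_tr// mulmx1 sM.1.
Qed.

(** The quaternion with positive real part over a rotation of angle less than
    pi, that is, with 1 + tr M > 0.  The square root is the one of the formula
    4 Re(q)^2 = 1 + tr M. *)
Definition sqrt_rot M : 'rV[R]_4 := (2 * Num.sqrt (1 + \tr M))^-1 *:
  row4 (1 + \tr M) (M 2 1 - M 1 2) (M 0 2 - M 2 0) (M 1 0 - M 0 1).

Lemma adj3 M : \adj M = mat3
  (row3 (M 1 1 * M 2 2 - M 1 2 * M 2 1) (M 0 2 * M 2 1 - M 0 1 * M 2 2) (M 0 1 * M 1 2 - M 0 2 * M 1 1))
  (row3 (M 1 2 * M 2 0 - M 1 0 * M 2 2) (M 0 0 * M 2 2 - M 0 2 * M 2 0) (M 0 2 * M 1 0 - M 0 0 * M 1 2))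
  (row3 (M 1 0 * M 2 1 - M 1 1 * M 2 0) (M 0 1 * M 2 0 - M 0 0 * M 2 1) (M 0 0 * M 1 1 - M 0 1 * M 1 0)).
Proof.
pose f (i j : nat) : R := M (inord i) (inord j).
have fE i j : M i j = f i j by rewrite /f !inord_val.
apply: matrix3P; apply: I3P; rewrite !mat3_entry !row3_entry mxE /cofactor;
rewrite !(expand_det_row _ (0 : 'I_2)) !big_ord_recl !big_ord0 /cofactor !det_mx11 !mxE /=;
by rewrite !fE /= /bump /=; ring.
Qed.

(** The identities for the entries are linear combinations of the relations
    expressing that M and its transpose are inverse and that the adjugate of M
    is its transpose. *)
Lemma rot_sqrt M : SO3 M -> 0 < 1 + \tr M ->
  rot (sqrt_rot M) = M /\ qdot (sqrt_rot M) (sqrt_rot M) = 1.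
Proof.
move=> sM t0; have adj := SO3_adj sM; rewrite adj3 in adj.
have E i j : (M *m M^T) i j = (i == j)%:R by rewrite sM.1 mxE.
have E' i j : (M^T *m M) i j = (i == j)%:R by rewrite SO3_tr// mxE.
have A i j := congr1 (fun N : 'M[R]_3 => N i j) adj.
have e00 := E 0 0; have e01 := E 0 1; have e02 := E 0 2; have e11 := E 1 1; have e12 := E 1 2; have e22 := E 2 2.
have f00 := E' 0 0; have f01 := E' 0 1; have f02 := E' 0 2; have f11 := E' 1 1; have f12 := E' 1 2; have f22 := E' 2 2.
have a00 := A 0 0; have a01 := A 0 1; have a02 := A 0 2.
have a10 := A 1 0; have a11 := A 1 1; have a12 := A 1 2.
have a20 := A 2 0; have a21 := A 2 1; have a22 := A 2 2.
move: e00 e01 e02 e11 e12 e22 f00 f01 f02 f11 f12 f22 a00 a01 a02 a10 a11 a12 a20 a21 a22.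
rewrite !mulmx3 ![_^T _ _]mxE !mat3_entry !row3_entry /= {E E' A adj}.
move: t0; rewrite /rot /qdot /sqrt_rot row4Z !row4_entry mxtrace3 => t0.
set t := 1 + _ in t0 *; have s2 : Num.sqrt t ^+ 2 = t by rewrite sqr_sqrtr// ltW.
have s0 : Num.sqrt t != 0 by rewrite sqrtr_eq0 -ltNge.
have k (p u v : R) : 4 * t * v = u -> p = u / (4 * Num.sqrt t ^+ 2) -> p = v.
  by move=> <- ->; rewrite s2; field; rewrite gt_eqF.
have k1 (p u : R) : u = 4 * t -> p = u / (4 * Num.sqrt t ^+ 2) -> p = 1.
  by move=> -> ->; rewrite s2; field; rewrite gt_eqF.
move=> e00 e01 e02 e11 e12 e22 f00 f01 f02 f11 f12 f22 a00 a01 a02 a10 a11 a12 a20 a21 a22.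
split; last first.
  apply: (k1 _ (t ^+ 2 + (M 2 1 - M 1 2) ^+ 2 + (M 0 2 - M 2 0) ^+ 2 + (M 1 0 - M 0 1) ^+ 2)).
    by rewrite /t; clear -a00 a11 a22 f00 f11 f22; lra.
  by field; exact: s0.
apply: matrix3P; apply: I3P; rewrite !mat3_entry !row3_entry.
- by apply: (k _ (t ^+ 2 + (M 2 1 - M 1 2) ^+ 2 - (M 0 2 - M 2 0) ^+ 2 - (M 1 0 - M 0 1) ^+ 2)); [rewrite /t; clear -e00 a00 a11 a22 f00 f11 f22; lra | field; exact: s0].
- by apply: (k _ (2 * ((M 2 1 - M 1 2) * (M 0 2 - M 2 0) - t * (M 1 0 - M 0 1)))); [rewrite /t; clear -e01 f01 a01 a10; lra | field; exact: s0].
- by apply: (k _ (2 * ((M 2 1 - M 1 2) * (M 1 0 - M 0 1) + t * (M 0 2 - M 2 0)))); [rewrite /t; clear -e02 f02 a02 a20; lra | field; exact: s0].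
- by apply: (k _ (2 * ((M 2 1 - M 1 2) * (M 0 2 - M 2 0) + t * (M 1 0 - M 0 1)))); [rewrite /t; clear -e01 f01 a01 a10; lra | field; exact: s0].
- by apply: (k _ (t ^+ 2 - (M 2 1 - M 1 2) ^+ 2 + (M 0 2 - M 2 0) ^+ 2 - (M 1 0 - M 0 1) ^+ 2)); [rewrite /t; clear -e11 a00 a11 a22 f00 f11 f22; lra | field; exact: s0].
- by apply: (k _ (2 * ((M 0 2 - M 2 0) * (M 1 0 - M 0 1) - t * (M 2 1 - M 1 2)))); [rewrite /t; clear -e12 f12 a12 a21; lra | field; exact: s0].
- by apply: (k _ (2 * ((M 2 1 - M 1 2) * (M 1 0 - M 0 1) - t * (M 0 2 - M 2 0)))); [rewrite /t; clear -e02 f02 a02 a20; lra | field; exact: s0].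
- by apply: (k _ (2 * ((M 0 2 - M 2 0) * (M 1 0 - M 0 1) + t * (M 2 1 - M 1 2)))); [rewrite /t; clear -e12 f12 a12 a21; lra | field; exact: s0].
- by apply: (k _ (t ^+ 2 - (M 2 1 - M 1 2) ^+ 2 - (M 0 2 - M 2 0) ^+ 2 + (M 1 0 - M 0 1) ^+ 2)); [rewrite /t; clear -e00 e11 e22 a00 a11 a22 f22; lra | field; exact: s0].
Qed.

End Quaternions.

(** * A full turn is not contractible in SO(3) *)

Section RotationLoop.
Context {R : realType}.
Implicit Types (p q : 'rV[R]_4) (M N : 'M[R]_3).

Section MatrixContinuity.
Context {T : topologicalType}.

Lemma cont_entry m n (F : T -> 'M[R]_(m.+1, n.+1)) x i j : cont_at F x -> cont_at (fun t => F t i j) x.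
Proof.
move=> cF; apply: (@cont_comp _ _ _ F (fun M : 'M[R]_(m.+1, n.+1) => M i j)) => //.
exact: coord_continuous.
Qed.

Arguments cont_entry {m n F x} i j _.

Lemma cont_row4 (f g h l : T -> R) x : cont_at f x -> cont_at g x -> cont_at h x ->
  cont_at l x -> cont_at (fun t => row4 (f t) (g t) (h t) (l t)) x.
Proof.
move=> cf cg ch cl; apply: cont_mx => i j; rewrite ord1.
move: j; case=> -[|[|[|[|//]]]] hj.
- by apply: cont_eq cf => t; rewrite mxE.
- by apply: cont_eq cg => t; rewrite mxE.
- by apply: cont_eq ch => t; rewrite mxE.
- by apply: cont_eq cl => t; rewrite mxE.
Qed.

Lemma cont_mulmx_tr (F G : T -> 'M[R]_3) x : cont_at F x -> cont_at G x ->
  cont_at (fun t => F t *m (G t)^T) x.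
Proof.
move=> cF cG; apply: cont_mx => i j.
have f k := cont_entry i k cF; have g k := cont_entry j k cG.
have [[f0 f1] f2] := (f 0, f 1, f 2); have [[g0 g1] g2] := (g 0, g 1, g 2).
apply: (cont_eq (f := fun t => F t i 0 * G t j 0 + F t i 1 * G t j 1 + F t i 2 * G t j 2)).
  by move=> t; rewrite mulmx3 ![(G t)^T _ _]mxE.
by cont.
Qed.

Lemma cont_trace (F : T -> 'M[R]_3) x : cont_at F x -> cont_at (fun t => \tr (F t)) x.
Proof.
move=> cF; have [[f0 f1] f2] := (cont_entry 0 0 cF, cont_entry 1 1 cF, cont_entry 2 2 cF).
apply: (cont_eq (f := fun t => F t 0 0 + F t 1 1 + F t 2 2)); last by cont.
by move=> t; rewrite mxtrace3.
Qed.

Lemma cont_sqrt_rot (F : T -> 'M[R]_3) x : cont_at F x -> 0 < 1 + \tr (F x) ->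
  cont_at (fun t => sqrt_rot (F t)) x.
Proof.
move=> cF t0; have ct := cont_trace cF.
have ct1 : cont_at (fun t => 1 + \tr (F t)) x by cont.
have cs : cont_at (fun t => Num.sqrt (1 + \tr (F t))) x.
  by apply: (@cont_comp _ _ _ _ Num.sqrt _ ct1); exact: sqrt_continuous.
have ci : cont_at (fun t => (2 * Num.sqrt (1 + \tr (F t)))^-1) x.
  apply: (contV (f := fun t => 2 * Num.sqrt (1 + \tr (F t)))); last by cont.
  by rewrite mulf_neq0 ?pnatr_eq0// sqrtr_eq0 -ltNge.
have e i j := cont_entry i j cF.
have [[[e01 e02] e10] [[e12 e20] e21]] := ((e 0 1, e 0 2, e 1 0), (e 1 2, e 2 0, e 2 1)).
by apply: cont_scale_mx => //; apply: cont_row4; cont.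
Qed.

Lemma cont_qmul (F G : T -> 'rV[R]_4) x : cont_at F x -> cont_at G x ->
  cont_at (fun t => qmul (F t) (G t)) x.
Proof.
move=> cF cG; have f k := cont_entry 0 k cF; have g k := cont_entry 0 k cG.
have [[f0 f1] [f2 f3]] := ((f 0, f 1), (f 2, f 3)).
have [[g0 g1] [g2 g3]] := ((g 0, g 1), (g 2, g 3)).
by apply: cont_row4; cont.
Qed.

Lemma cont_qdot (F G : T -> 'rV[R]_4) x : cont_at F x -> cont_at G x ->
  cont_at (fun t => qdot (F t) (G t)) x.
Proof.
move=> cF cG; have f k := cont_entry 0 k cF; have g k := cont_entry 0 k cG.
have [[f0 f1] [f2 f3]] := ((f 0, f 1), (f 2, f 3)).
have [[g0 g1] [g2 g3]] := ((g 0, g 1), (g 2, g 3)).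
by rewrite /qdot; cont.
Qed.
End MatrixContinuity.

(** Rotations that are close to each other differ by an angle less than pi. *)
Lemma trace_near M : SO3 M -> exists2 N : set 'M[R]_3, nbhs M N &
  forall B C, N B -> N C -> 0 < 1 + \tr (C *m B^T).
Proof.
move=> sM; pose x0 : 'M[R]_3 * 'M[R]_3 := (M, M).
have c1 : cont_at fst x0 by exact: cvg_fst.
have c2 : cont_at snd x0 by exact: cvg_snd.
have c : cont_at (fun x : 'M[R]_3 * 'M[R]_3 => 1 + \tr (x.2 *m x.1^T)) x0.
  have ct := cont_trace (cont_mulmx_tr c2 c1).
  by cont.
have : \forall x \near x0, 0 < 1 + \tr (x.2 *m x.1^T).
  apply: (cvgr_gt _ c); rewrite /x0 /= sM.1 mxtrace1.
  by rewrite ltr_wpDr.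
case=> -[N1 N2] [/= n1 n2] sub; exists (N1 `&` N2); first exact: filterI.
by move=> B C [B1 _] [_ C2]; exact: (sub (B, C)).
Qed.

Definition square : set (R * R) := `[0, 1]%classic `*` `[0, 1]%classic.

Section Lift.
Variable E : R * R -> 'M[R]_3.
Hypothesis cE : {within square, continuous E}.
Hypothesis sE : forall x, square x -> SO3 (E x).

(** Compactness of the square makes [trace_near] uniform. *)
Lemma uniform_steps : exists n : nat, forall x y, square x -> square y ->
  `|x.1 - y.1| <= n.+1%:R^-1 -> `|x.2 - y.2| <= n.+1%:R^-1 ->
  0 < 1 + \tr (E y *m (E x)^T).
Proof.
have K : compact square by apply: compact_setX; exact: segment_compact.
pose P (n : nat) x := square x -> forall y, square y ->
  `|x.1 - y.1| <= n.+1%:R^-1 -> `|x.2 - y.2| <= n.+1%:R^-1 -> 0 < 1 + \tr (E y *m (E x)^T).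
have [|n _ Pn] := (compact_near_coveringP square).1 K nat \oo P _.
  move=> x0 Kx0.
  have [N nN NE] := trace_near (sE Kx0).
  have /subspace_continuousP/(_ _ Kx0 _ nN) := cE; rewrite /= => /nbhs_ballP[e /= e0 be].
  have e2 : 0 < e / 2 by rewrite divr_gt0.
  near=> x n => Kx y Ky xy1 xy2.
  have ne : n.+1%:R^-1 < e / 2 by near: n; exact: (near_infty_natSinv_lt (PosNum e2)).
  have bx : ball x0 (e / 2) x by near: x; exact: nbhsx_ballx.
  apply: NE; apply: be => //.
    by apply: le_ball bx; rewrite ler_pdivrMr// ler_pMr// ler1n.
  rewrite (splitr e); apply: (ball_triangle bx).
  by split; rewrite /ball /=; [apply: le_lt_trans xy1 ne | apply: le_lt_trans xy2 ne].
by exists n => x y Kx; apply: Pn => //=.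
Unshelve. all: by end_near.
Qed.

Definition subdiv (n j : nat) (x : R * R) : R * R :=
  (j%:R / n.+1%:R * x.1, j%:R / n.+1%:R * x.2).

Lemma subdiv_square n j x : (j <= n.+1)%N -> square x -> square (subdiv n j x).
Proof.
move=> jn [/= x1 x2]; split; rewrite /= in_itv /=; [move: x1|move: x2]; rewrite /= in_itv /= => /andP[a b].
  by rewrite mulr_ge0 ?divr_ge0//= mulr_ile1 ?divr_ge0// ler_pdivrMr// mul1r ler_nat.
by rewrite mulr_ge0 ?divr_ge0//= mulr_ile1 ?divr_ge0// ler_pdivrMr// mul1r ler_nat.
Qed.

Lemma subdivS n j x : square x -> `|(subdiv n j x).1 - (subdiv n j.+1 x).1| <= n.+1%:R^-1 /\
  `|(subdiv n j x).2 - (subdiv n j.+1 x).2| <= n.+1%:R^-1.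
Proof.
have h (r : R) : `[0, 1]%classic r -> `|j%:R / n.+1%:R * r - j.+1%:R / n.+1%:R * r| <= n.+1%:R^-1.
  rewrite /= in_itv /= => /andP[r0 r1].
  rewrite -mulrBl -mulrBl -natr1 opprD addNKr mulN1r mulNr normrN ger0_norm ?mulr_ge0 ?invr_ge0//.
  by rewrite ler_piMr ?invr_ge0.
by move=> [x1 x2]; split; apply: h.
Qed.

(** A lift of E to unit quaternions, at the j-th of n + 1 equal steps on the
    segment from the corner (0, 0) to x.  It is the product of the quaternions
    [sqrt_rot] of the successive increments, which are small rotations, so it
    is continuous in x. *)
Fixpoint lift_rot (n j : nat) (x : R * R) : 'rV[R]_4 :=
  if j is j'.+1 then
    qmul (sqrt_rot (E (subdiv n j x) *m (E (subdiv n j' x))^T)) (lift_rot n j' x)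
  else row4 1 0 0 0.

Lemma rot1 : rot (row4 1 0 0 0 : 'rV[R]_4) = 1%:M.
Proof.
rewrite /rot !row4_entry.
by apply: matrix3P; apply: I3P; rewrite !mat3_entry !row3_entry mxE /=; ring.
Qed.

Section Steps.
Variable n : nat.
Hypothesis step : forall x y, square x -> square y ->
  `|x.1 - y.1| <= n.+1%:R^-1 -> `|x.2 - y.2| <= n.+1%:R^-1 -> 0 < 1 + \tr (E y *m (E x)^T).

Lemma lift_rotP j x : (j <= n.+1)%N -> square x ->
  rot (lift_rot n j x) = E (subdiv n j x) *m (E (0, 0))^T /\
  qdot (lift_rot n j x) (lift_rot n j x) = 1.
Proof.
move=> jn Kx; have s0 : subdiv n 0 x = (0, 0) by rewrite /subdiv !mul0r.
elim: j jn => [_|j ih jn] /=.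
  have K0 : square (0, 0) by rewrite -s0; exact: subdiv_square.
  by rewrite rot1 s0 (sE K0).1 /qdot !row4_entry; split => //; ring.
have [ih1 ih2] := ih (ltnW jn).
have K1 := subdiv_square (ltnW jn) Kx; have K2 := subdiv_square jn Kx.
have [d1 d2] := subdivS n j Kx.
have [r1 r2] := rot_sqrt (SO3_mul (sE K2) (sE K1)) (step K1 K2 d1 d2).
rewrite rot_qmul qdot_qmul r1 r2 ih1 ih2 mulr1; split => //.
by rewrite mulmxA -[_ *m _ *m E (subdiv n j x)]mulmxA SO3_tr ?mulmx1//; exact: sE.
Qed.

Lemma cont_lift_rot j (c : R -> R * R) u : (j <= n.+1)%N -> cont_at c u ->
  (forall t, square (c t)) -> cont_at (fun t => lift_rot n j (c t)) u.
Proof.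
move=> jn cc Kc; elim: j jn => [_|j ih jn] /=; first exact: cst_continuous.
have cs i : (i <= n.+1)%N -> cont_at (fun t => E (subdiv n i (c t))) u.
  move=> ile; apply: (cont_within (f := fun t => subdiv n i (c t)) cE).
    have c1 : cont_at (fun t => (c t).1) u by apply: (@cont_comp _ _ _ c fst _ cc); exact: cvg_fst.
    have c2 : cont_at (fun t => (c t).2) u by apply: (@cont_comp _ _ _ c snd _ cc); exact: cvg_snd.
    by apply: cont_pair; rewrite /subdiv; cont.
  by move=> t; exact: subdiv_square.
apply: cont_qmul; last exact: ih (ltnW jn).
have K1 := subdiv_square (ltnW jn) (Kc u); have K2 := subdiv_square jn (Kc u).
have [d1 d2] := subdivS n j (Kc u).
by apply: cont_sqrt_rot; [exact: cont_mulmx_tr (cs _ jn) (cs _ (ltnW jn)) | exact: step].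
Qed.

(** Two lifts of the same rotation differ by a sign, which is constant along a
    path by continuity. *)
Lemma lift_rot_sign (c : R -> R * R) (r : R -> 'rV[R]_4) : continuous c ->
  (forall t, square (c t)) -> continuous r ->
  (forall t, rot (r t) = E (c t) *m (E (0, 0))^T) -> (forall t, qdot (r t) (r t) = 1) ->
  qdot (lift_rot n n.+1 (c 0)) (r 0) = qdot (lift_rot n n.+1 (c 1)) (r 1) /\
  qdot (lift_rot n n.+1 (c 0)) (r 0) ^+ 2 = 1.
Proof.
move=> cc Kc cr rE r1; pose f t := qdot (lift_rot n n.+1 (c t)) (r t).
have sub x : subdiv n n.+1 x = x by rewrite /subdiv divff ?pnatr_eq0// !mul1r; case: x.
have f2 t : f t ^+ 2 = 1.
  have [e1 e2] := lift_rotP (leqnn n.+1) (Kc t).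
  have := trace_rot (lift_rot n n.+1 (c t)) (r t).
  rewrite e1 e2 r1 rE sub.
  have K0 : square (0, 0) by rewrite /square; split; rewrite /= in_itv /= lexx ler01.
  by rewrite (SO3_mul (sE (Kc t)) (sE K0)).1 mxtrace1 mulr1 -/(f t); lra.
have cf : continuous f.
  move=> u; have cl : cont_at (fun t => lift_rot n n.+1 (c t)) u.
    exact: cont_lift_rot (leqnn _) (cc u) Kc.
  exact: (cont_qdot cl (cr u)).
split; last exact: f2.
apply/eqP; apply/negPn/negP => ne.
have h t : f t = 1 \/ f t = -1.
  by have /eqP := f2 t; rewrite sqrf_eq1 => /orP[] /eqP; [left | right].
have [||z _ fz] := @IVT R f 0 1 0 ler01.
- exact: continuous_subspaceT.
- move: ne; rewrite -/(f 0) -/(f 1); case: (h 0) (h 1) => -> [->|->]; rewrite ?eqxx//= => _.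
    by rewrite ge_min le_max ler01 lerN10 orbT.
  by rewrite ge_min le_max ler01 lerN10 orbT.
- by have := f2 z; rewrite fz expr0n /= => /eqP; rewrite eq_sym oner_eq0.
Qed.
End Steps.
End Lift.

(** The lift of E to quaternions is constant along three sides of the square, on
    which E is constant.  Along the fourth, where E makes a full turn, it
    follows cos (pi t) - i sin (pi t) up to sign, and therefore changes sign
    between the two ends. *)
Lemma rotation_loop_not_contractible (E : R * R -> 'M[R]_3) :
  {within square, continuous E} -> (forall x, square x -> SO3 (E x)) ->
  (forall t, `[0, 1]%classic t ->
     E (t, 0) = rot (row4 (cos (pi * t)) (- sin (pi * t)) 0 0) *m E (0, 0)) ->
  (forall t, `[0, 1]%classic t -> E (t, 1) = E (0, 0)) ->
  (forall s, `[0, 1]%classic s -> E (0, s) = E (0, 0) /\ E (1, s) = E (0, 0)) -> False.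
Proof.
move=> cE sE bot top side.
have [n step] := uniform_steps cE sE.
have I0 : `[0, 1]%classic (0 : R) by rewrite /= in_itv /= lexx ler01.
have I1 : `[0, 1]%classic (1 : R) by rewrite /= in_itv /= lexx ler01.
(* A path of [0, 1] from 0 to 1 that is defined for all real t. *)
pose phi (t : R) := (1 - cos (pi * t)) / 2.
have phi0 : phi 0 = 0 by rewrite /phi mulr0 cos0 subrr mul0r.
have phi1 : phi 1 = 1 by rewrite /phi mulr1 cospi opprK -mulr2n divff// pnatr_eq0.
have Iphi t : `[0, 1]%classic (phi t).
  rewrite /= in_itv /= /phi; have := cos_geN1 (pi * t); have := cos_le1 (pi * t).
  by move=> h1 h2; apply/andP; split; lra.
have cid (t : R) : cont_at (fun r : R => r) t by exact: cvg_id.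
have ccos (f : R -> R) t : cont_at f t -> cont_at (fun r => cos (f r)) t.
  by move=> cf; apply: (@cont_comp _ _ _ f cos) => //; exact: continuous_cos.
have csin (f : R -> R) t : cont_at f t -> cont_at (fun r => sin (f r)) t.
  by move=> cf; apply: (@cont_comp _ _ _ f sin) => //; exact: continuous_sin.
have cphi (t : R) : cont_at phi t.
  have ct := cid t; have cp : cont_at (fun t : R => pi * t) t by cont.
  have cc := ccos _ _ cp; by rewrite /phi; cont.
pose Q x := lift_rot E n n.+1 x.
have Ksq a b : `[0, 1]%classic a -> `[0, 1]%classic b -> square (a, b) by split.
have K0 := Ksq _ _ I0 I0.
have one : qdot (row4 1 0 0 0) (row4 1 0 0 0) = 1 :> R by rewrite /qdot !row4_entry; ring.
have qdot1 q : qdot q (row4 1 0 0 0) = q 0 0.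
  by rewrite /qdot !row4_entry !mulr0 mulr1 !addr0.
(* Along a side where E is constant, the real part of the lift is constant. *)
have const (c : R -> R * R) : continuous c -> (forall t, square (c t)) ->
    (forall t, E (c t) = E (0, 0)) -> Q (c 0) 0 0 = Q (c 1) 0 0 /\ Q (c 0) 0 0 ^+ 2 = 1.
  move=> cc Kc Ec.
  have := lift_rot_sign cE sE step cc Kc (r := fun _ => row4 1 0 0 0).
  rewrite !qdot1; apply.
  - by move=> t; exact: cst_continuous.
  - by move=> t; rewrite rot1 Ec (sE _ K0).1.
  - by rewrite row4_entry.
have ccst (a t : R) : cont_at (fun _ : R => a) t by exact: contC.
have cpair (f g : R -> R) : (forall t : R, cont_at f t) -> (forall t : R, cont_at g t) ->
    continuous (fun t : R => (f t, g t)).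
  by move=> cf cg t; exact: (cont_pair (cf t) (cg t)).
have cL : continuous (fun t : R => (0 : R, phi t)).
  by apply: (cpair (fun=> 0) phi).
have cT : continuous (fun t : R => (phi t, 1 : R)).
  by apply: (cpair phi (fun=> 1)).
have cR : continuous (fun t : R => (1 : R, phi t)).
  by apply: (cpair (fun=> 1) phi).
have cB : continuous (fun t : R => (phi t, 0 : R)).
  by apply: (cpair phi (fun=> 0)).
have [|t|l1 l2] := const _ cL; [by move=> t; exact: Ksq | by case: (side _ (Iphi t))|].
have [|t|t1 _] := const _ cT; [by move=> t; exact: Ksq | exact: top (Iphi t)|].
have [|t|r1 _] := const _ cR; [by move=> t; exact: Ksq | by case: (side _ (Iphi t))|].
pose r (t : R) := row4 (cos (pi * phi t)) (- sin (pi * phi t)) 0 0.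
have cr : continuous r.
  move=> t; have cf := cphi t.
  have cp : cont_at (fun t : R => pi * phi t) t by cont.
  have c1 := ccos _ _ cp; have c2 := csin _ _ cp.
  apply: (@cont_row4 R (fun u => cos (pi * phi u)) (fun u => - sin (pi * phi u)) (fun=> 0) (fun=> 0)); by cont.
have [t|t|t|b1 _] := lift_rot_sign cE sE step cB _ cr.
- exact: Ksq.
- by rewrite bot// -mulmxA (sE _ K0).1 mulmx1.
- by rewrite /qdot !row4_entry mulr0 !addr0 mulrNN -!expr2 cos2Dsin2.
have r0 : r 0 = row4 1 0 0 0 by rewrite /r phi0 mulr0 cos0 sin0 oppr0.
have r1' : r 1 = - row4 1 0 0 0 by rewrite /r phi1 mulr1 cospi sinpi row4_lin !oppr0.
have qdotN q : qdot q (- row4 1 0 0 0) = - q 0 0.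
  by rewrite row4_lin /qdot !row4_entry !oppr0 !mulr0 mulrN1 !addr0.
move: l1 l2 t1 r1 b1; rewrite r0 r1' qdot1 qdotN phi0 phi1 /Q.
by move=> -> l2 t1 r1 b1; nra.
Qed.
End RotationLoop.

(** * Spin frames are not invariant under a full turn *)

Section NormalisedFrames.
Context {R : realType}.

(** A frame at height z, made orthonormal for the Euclidean metric. *)
Definition conformal_frame (f : frame R) : 'M[R]_3 := (f.1 0 2)^-1 *: f.2.

Lemma SO3_conformal_frame f : frameU R f -> SO3 (conformal_frame f).
Proof.
case: f => q M [/= z0 [oM dM]]; split; rewrite /conformal_frame /=.
  apply/matrixP => a b; rewrite mulmx3 ![_^T _ _]mxE !mxE -oM /metricU !mxE /=.
  by field; rewrite gt_eqF.
by rewrite detZ mulr_gt0 ?exprn_gt0 ?invr_gt0.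
Qed.

Lemma cont_conformal_frame f : frameU R f -> cont_at conformal_frame f.
Proof.
move=> [z0 _]; have c1 : cont_at (fun g : frame R => g.1) f by exact: cvg_fst.
have c2 : cont_at (fun g : frame R => g.2) f by exact: cvg_snd.
apply: (cont_scale_mx (f := fun g : frame R => (g.1 0 2)^-1)) => //.
apply: (contV (f := fun g : frame R => g.1 0 2)); first by rewrite gt_eqF.
by apply: (@cont_comp _ _ _ fst (fun M : 'rV[R]_3 => M 0 2)) => //; exact: coord_continuous.
Qed.

Lemma conformal_frame_rotate (t : R) f : conformal_frame (rotate_frame 0 (2 * t) f) =
  rot (row4 (cos t) (- sin t) 0 0) *m conformal_frame f.
Proof.
have o2 : 0 + 1 = 1 :> 'I_3 by apply/val_inj.
have o3 : 0 + 2 = 2 :> 'I_3 by apply/val_inj.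
have tt : 2 * t = t + t by ring.
have cs := cos2Dsin2 t.
rewrite /conformal_frame /rotate_frame /= tt cosD sinD o2 o3.
move: (cos t) (sin t) cs => c s cs.
have e0 : c ^+ 2 + (- s) ^+ 2 - 0 ^+ 2 - 0 ^+ 2 = 1 by rewrite -cs; ring.
by apply: matrix3P => j; rewrite mulmx3 /rot !row4_entry !mat3_entry !row3_entry ?e0 !mxE /= ?mxE; ring.
Qed.
End NormalisedFrames.

Section NoLoop.
Context {R : realType} {Spin : topologicalType} {pr : Spin -> frame R}.
Hypothesis Hspin : is_spin_bundle pr.

Lemma frameU_pr s : frameU R (pr s).
Proof. by case: Hspin => -[_ [<- _]] _; exists s. Qed.

(** Otherwise the lift of the full turn is a loop of the simply connected space
    of spin frames; it is contractible there, and so is its image in SO(3). *)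
Lemma full_turn_changes_sheet (f : frame R) (sigma : R -> Spin) : continuous sigma ->
  (forall u, pr (sigma u) = rotate_frame 0 u f) -> frameU R f -> sigma 0 <> sigma (2 * pi).
Proof.
move=> cs prs fU s02; have [[cpr _] [_ [_ sc]]] := Hspin.
pose c (t : R) := sigma (2 * pi * t).
have cc : continuous c.
  move=> t; have cid : cont_at (fun r : R => r) t by exact: cvg_id.
  have cm : cont_at (fun r : R => 2 * pi * r) t by cont.
  exact: (cont_comp cm (cs _)).
have [||H [cH [Hb Hs]]] := sc c.
- exact: continuous_subspaceT.
- by rewrite /c mulr0 mulr1.
pose E x := conformal_frame (pr (H x)).
have I0 : `[0, 1]%classic (0 : R) by rewrite /= in_itv /= lexx ler01.
have Ec t : conformal_frame (pr (c t)) = rot (row4 (cos (pi * t)) (- sin (pi * t)) 0 0) *m conformal_frame f.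
  by rewrite prs -conformal_frame_rotate mulrA.
have E0 : E (0, 0) = conformal_frame (pr (c 0)) by rewrite /E (Hb _ I0).1.
have E0f : E (0, 0) = conformal_frame f by rewrite E0 Ec mulr0 cos0 sin0 oppr0 rot1 mul1mx.
apply: (@rotation_loop_not_contractible R E).
- apply/subspace_continuousP => x Kx.
  move/subspace_continuousP: cH => /(_ x Kx) cH.
  have c1 := cvg_comp _ _ cH (cpr (H x)).
  exact: (cvg_comp _ _ c1 (cont_conformal_frame (frameU_pr (H x)))).
- by move=> x _; exact: SO3_conformal_frame (frameU_pr (H x)).
- by move=> t It; rewrite E0f /E (Hb _ It).1 Ec.
- by move=> t It; rewrite E0 /E (Hb _ It).2.
- by move=> t It; rewrite E0 /E (Hs _ It).1 (Hs _ It).2.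
Qed.
End NoLoop.

(** * Paths of spinors and the complex exponential *)

Section SpinPaths.
Context {R : realType}.
Implicit Types (k b : spinor R).

Lemma cont_spinorZ (f g : R -> R) k u : cont_at f u -> cont_at g u ->
  cont_spinor u (fun t : R => (f t +i* g t) *: k).
Proof.
move=> cf cg j; split.
  apply: (cont_eq (f := fun t : R => f t * Re (k j 0) + - (g t * Im (k j 0)))); last by cont.
  by move=> t; rewrite !linE ReM.
apply: (cont_eq (f := fun t : R => f t * Im (k j 0) + g t * Re (k j 0))); last by cont.
by move=> t; rewrite !linE ImM.
Qed.

Lemma cont_spinorRZ (f : R -> R) k u : cont_at f u -> cont_spinor u (fun t : R => (f t)%:C *: k).
Proof. by move=> cf; apply: (cont_spinorZ k cf); exact: contC. Qed.

Lemma cont_spinorD (k b : R -> spinor R) (u : R) : cont_spinor u k -> cont_spinor u b ->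
  cont_spinor u (fun t => k t + b t).
Proof.
move=> ck cb j; have [c1 c2] := ck j; have [c3 c4] := cb j; split.
  by apply: (cont_eq (f := fun t => Re (k t j 0) + Re (b t j 0))) (contD c1 c3) => t; rewrite !linE ReD.
by apply: (cont_eq (f := fun t => Im (k t j 0) + Im (b t j 0))) (contD c2 c4) => t; rewrite !linE ImD.
Qed.

Lemma cont_half (f : R -> R) (u : R) : continuous f -> cont_at (fun t : R => f (t / 2)) u.
Proof.
move=> cf; have cid : cont_at (fun r : R => r) u by exact: cvg_id.
have ch : cont_at (fun r : R => r / 2) u by cont.
exact: (cont_comp ch (cf _)).
Qed.

Lemma cexpD (z w : R[i]) : cexp (z + w) = cexp z * cexp w.
Proof.
rewrite /cexp ReD ImD expRD cosD sinD; apply: complexP; rewrite !(ReM, ImM) /=; ring.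
Qed.

Lemma cexp0 : cexp (0 : R[i]) = 1.
Proof. by rewrite /cexp /= expR0 cos0 sin0 mul1r. Qed.

Lemma cexpVN (z : R[i]) : cexp z * cexp (- z) = 1.
Proof. by rewrite -cexpD subrr cexp0. Qed.

Lemma cexp_surjective (w : R[i]) : w != 0 -> exists z, cexp z = w.
Proof.
rewrite -nsq_eq0 => w0; pose r := Num.sqrt (nsq w).
have r0 : 0 < r by rewrite sqrtr_gt0 lt_def w0 nsq_ge0.
have rr : r ^+ 2 = Re w ^+ 2 + Im w ^+ 2 by rewrite sqr_sqrtr// nsq_ge0.
have c1 : -1 <= Re w / r <= 1.
  by rewrite ler_pdivlMr// ler_pdivrMr// mulN1r mul1r -ler_norml -(ler_pXn2r (n := 2)) ?nnegrE ?(ltW r0)// real_normK ?num_real// rr lerDl sqr_ge0.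
have cs : (Re w / r) ^+ 2 + (Im w / r) ^+ 2 = 1.
  by rewrite !expr_div_n -mulrDl -rr divff// expf_neq0// gt_eqF.
pose a := if 0 <= Im w then acos (Re w / r) else - acos (Re w / r).
have ca : cos a = Re w / r by rewrite /a; case: ifP; rewrite ?cosN acosK.
have sa : sin a = Im w / r.
  have s2 : Num.sqrt (1 - (Re w / r) ^+ 2) = `|Im w / r|.
    by rewrite -cs addrC addKr sqrtr_sqr.
  rewrite /a; case: ifP => h; rewrite ?sinN sin_acos// s2 normrM (ger0_norm (x := r^-1)) ?invr_ge0 ?(ltW r0)//.
    by rewrite ger0_norm.
  by rewrite ltr0_norm ?mulNr ?opprK// ltNge h.
exists (ln r +i* a); rewrite /cexp /= lnK ?posrE// ca sa.
by apply: complexP; rewrite ?(ReM, ImM) /=; field; rewrite gt_eqF.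
Qed.
End SpinPaths.

(** * Motions of spin frames *)

Arguments cont_half {R} f u _.

Section SpinFrameTransport.
Context {R : realType} {Spin : topologicalType} {pr : Spin -> frame R}.
Hypothesis Hspin : is_spin_bundle pr.
Variable Kt : spinor R -> spin_dec_horosphere pr.
Hypothesis HKt : is_spin_lift Kt.
Implicit Types (k b : spinor R) (s : Spin) (d z : R[i]).
Local Notation S := (spin_frame Kt).
Let cov : double_covering (frameU R) pr := Hspin.1.

(** The spin frames of a path of pairs are the lift of the path of their
    frames. *)
Lemma lifts_to_spin_frame (c : R -> frame R) (k b : R -> spinor R) t s :
  (forall u, cont_spinor u k) -> (forall u, cont_spinor u b) ->
  (forall u, spinor_ip (k u) (b u) = 1) -> (forall u, c u = frU (k u) (b u)) ->
  lifts_to pr c t (S (k 0) (b 0)) s <-> s = S (k t) (b t).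
Proof.
move=> ck cb kb cE.
have cS : continuous (fun u => S (k u) (b u)).
  by move=> u; exact: (spin_frame_continuous cov HKt (ck u) (cb u) kb).
have prS u : pr (S (k u) (b u)) = c u by rewrite (pr_spin_frame HKt)// cE.
split=> [[sg [csg [prsg [sg0 <-]]]]|->]; last by exists (fun u => S (k u) (b u)).
by apply: (lift_unique cov csg cS) sg0 t => u; rewrite prsg prS.
Qed.

Lemma spin_rotate1 k b t s : spinor_ip k b = 1 ->
  spin_rotate pr 1 t (S k b) s <->
  s = S ((cos (t / 2))%:C *: k + (sin (t / 2))%:C *: b)
        ((- sin (t / 2))%:C *: k + (cos (t / 2))%:C *: b).
Proof.
move=> kb; rewrite /spin_rotate (pr_spin_frame HKt)//.
pose kt (u : R) := (cos (u / 2))%:C *: k + (sin (u / 2))%:C *: b.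
pose bt (u : R) := (- sin (u / 2))%:C *: k + (cos (u / 2))%:C *: b.
have cc u := cont_half cos u (@continuous_cos R); have cs u := cont_half sin u (@continuous_sin R).
rewrite -(_ : S (kt 0) (bt 0) = S k b); last first.
  by rewrite /kt /bt mul0r cos0 sin0 oppr0 !scale1r !scale0r addr0 add0r.
apply: lifts_to_spin_frame.
- by move=> u; apply: cont_spinorD; exact: cont_spinorRZ.
- move=> u; apply: cont_spinorD; apply: cont_spinorRZ => //.
  exact: contN (cs u).
- move=> u; rewrite !(ipDl, ipDr, ipZl, ipZr) !ipkk (ipC b k) kb.
  apply: complexP; rewrite !cE /=; [have := cos2Dsin2 (u / 2); lra | ring].
- by move=> u; rewrite /frU rotate_push rotate1_frH.
Qed.

Lemma spin_rotate0 k b t s : spinor_ip k b = 1 ->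
  spin_rotate pr 0 t (S k b) s <->
  s = S ((cos (t / 2) +i* sin (t / 2)) *: k) ((cos (t / 2) -i* sin (t / 2)) *: b).
Proof.
move=> kb; rewrite /spin_rotate (pr_spin_frame HKt)//.
pose kt (u : R) := (cos (u / 2) +i* sin (u / 2)) *: k.
pose bt (u : R) := (cos (u / 2) -i* sin (u / 2)) *: b.
have cc u := cont_half cos u (@continuous_cos R); have cs u := cont_half sin u (@continuous_sin R).
rewrite -(_ : S (kt 0) (bt 0) = S k b); last first.
  by rewrite /kt /bt mul0r cos0 sin0 oppr0 !scale1r.
apply: lifts_to_spin_frame.
- by move=> u; exact: cont_spinorZ.
- move=> u; apply: cont_spinorZ => //.
  exact: contN (cs u).
- move=> u; rewrite ipZl ipZr kb.
  by apply: complexP; rewrite !cE /=; [have := cos2Dsin2 (u / 2); lra | ring].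
- by move=> u; rewrite /frU rotate_push rotate0_frH.
Qed.

Lemma ip_boost k b (t : R) : spinor_ip k b = 1 ->
  spinor_ip ((expR t)%:C *: k) ((expR (- t))%:C *: b) = 1.
Proof. by move=> kb; rewrite ipZl ipZr kb mulr1 -rmorphM -expRD subrr expR0. Qed.

Lemma spin_translateE k b t s : spinor_ip k b = 1 ->
  spin_translate pr t (S k b) s <->
  s = S ((expR (t / 2))%:C *: k) ((expR (- (t / 2)))%:C *: b).
Proof.
move=> kb; pose kt (u : R) := (expR (u / 2))%:C *: k.
pose bt (u : R) := (expR (- (u / 2)))%:C *: b.
have ce u := cont_half expR u (@continuous_expR R).
have H : lifts_to pr (fun u => push_frame (translateH u (frH k b))) t (S k b) s <-> s = S (kt t) (bt t).
  rewrite -(_ : S (kt 0) (bt 0) = S k b); last by rewrite /kt /bt mul0r oppr0 expR0 !scale1r.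
  apply: lifts_to_spin_frame.
  - by move=> u; exact: cont_spinorRZ.
  - move=> u; apply: cont_spinorRZ.
    apply: (cont_half (fun r : R => expR (- r)) u) => r.
    have cid : cont_at (fun r : R => r) r by exact: cvg_id.
    exact: (cont_comp (contN cid) (@continuous_expR R _)).
  - by move=> u; exact: ip_boost.
  - by move=> u; rewrite /frU translate_frH.
split=> [[xF [hx [ex l]]]|e].
  have exF : xF = frH k b.
    by apply: push_frame_inj => //; [exact: frameH_frH | rewrite ex (pr_spin_frame HKt)].
  by apply/H; rewrite -exF.
exists (frH k b); split; first exact: frameH_frH.
by split; [rewrite (pr_spin_frame HKt) | apply/H].
Qed.

Lemma cexp_polar z : cexp z = (cos (Im z) +i* sin (Im z)) * (expR (Re z))%:C.
Proof. by rewrite /cexp mulrC. Qed.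

(** Translation and rotation combine to right multiplication by
    diag(e^{d/2}, e^{-d/2}).  This is where exp (d / 2) comes from. *)
Lemma spin_screwE k b d s : spinor_ip k b = 1 ->
  (exists s', spin_translate pr (Re d) (S k b) s' /\ spin_rotate pr 0 (Im d) s' s) <->
  s = S (cexp (d / 2) *: k) (cexp (- (d / 2)) *: b).
Proof.
move=> kb; have [dR dI] : Re d / 2 = Re (d / 2) /\ Im d / 2 = Im (d / 2).
  have {1 3}-> : d = d / 2 + d / 2 by field.
  by rewrite ReD ImD; split; field.
move: (d / 2) dR dI => z dR dI; pose k' := (expR (Re d / 2))%:C *: k; pose b' := (expR (- (Re d / 2)))%:C *: b.
have kb' : spinor_ip k' b' = 1 by exact: ip_boost.
have E : S ((cos (Im d / 2) +i* sin (Im d / 2)) *: k') ((cos (Im d / 2) -i* sin (Im d / 2)) *: b') =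
    S (cexp z *: k) (cexp (- z) *: b).
  by rewrite !cexp_polar -!scalerA ReN ImN cosN sinN -dR -dI.
rewrite -E; split=> [[s' [/(spin_translateE _ _ kb) ->]]|->]; first by move/(spin_rotate0 _ _ kb').
have T : spin_translate pr (Re d) (S k b) (S k' b') := (spin_translateE (Re d) _ kb).2 erefl.
have Q := (spin_rotate0 (Im d) _ kb').2 erefl.
exact: (ex_intro _ (S k' b') (conj T Q)).
Qed.

(** The path of pairs diag(e^{iu/2}, e^{-iu/2}), u in [0, 2 pi], lifts a full
    turn about the first vector. *)
Lemma spin_frame_sign k b : spinor_ip k b = 1 -> S k b <> S (- k) (- b).
Proof.
move=> kb; have [_ ] := spin_rotate0 (2 * pi) (S (- k) (- b)) kb.
have -> : 2 * pi / 2 = pi :> R by field.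
rewrite cospi sinpi oppr0 (_ : (-1 +i* 0) = -1 :> R[i]); last by apply: complexP => /=; rewrite ?oppr0.
rewrite !scaleN1r => /(_ erefl)[sg [csg [prsg [sg0 sg1]]]].
rewrite -sg0 -sg1; apply: (full_turn_changes_sheet Hspin csg prsg).
exact: frameU_pr Hspin _.
Qed.

Lemma spin_frame_inj k b k' b' : spinor_ip k b = 1 -> spinor_ip k' b' = 1 ->
  S k b = S k' b' -> k' = k /\ b' = b.
Proof.
move=> kb kb' e; have := congr1 pr e; rewrite !(pr_spin_frame HKt)// => f.
have [//|[ek eb]] := frU_inj kb kb' f.
by move: e; rewrite ek eb => /(spin_frame_sign kb).
Qed.

(** Rotation by pi about the second vector takes (k, b) to (b, - k). *)
Lemma sd_in_spin_frame k b : spinor_ip k b = 1 ->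
  sd_in (Kt k) (frU k b).1 = S b (- k).
Proof.
move=> kb; have := sd_in_of_out (dh_set_frU HKt kb).
move=> /(spin_rotate1 _ _ kb) ->.
rewrite cos_pihalf sin_pihalf !scale0r scale1r add0r addr0 (_ : (-1)%:C = -1 :> R[i]).
  by rewrite scaleN1r.
by apply: complexP => /=; rewrite ?oppr0.
Qed.

End SpinFrameTransport.

(** * Geodesics between horospheres *)

Section GeodesicVelocity.
Context {R : realType}.
Implicit Types (k b : spinor R) (x v : 'rV[R]_4).

Lemma is_diff_expR (t : R) : is_diff t (expR : R -> R) (fun h => h * expR t).
Proof.
have d : differentiable (expR : R -> R) t by apply/derivable1_diffP; exact: derivable_expR.
by apply: DiffDef => //; rewrite diff1E// derive1E derive_val.
Qed.

Lemma is_diff_geodesicH x v (t : R) :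
  is_diff t (geodesicH x v) (fun h => h *: (sh t *: x + ch t *: v)).
Proof.
have eN : is_diff t (fun s : R => expR (- s)) (fun h => - (h * expR (- t))).
  apply: (is_diff_ext (is_diff_comp (is_diffN (is_diff_id t)) (is_diff_expR (- t)))) => // h.
  by rewrite /= mulNr.
have e := is_diff_expR t.
have sc (w : 'rV[R]_4) (a : R) : is_diff a (fun l : R => l *: w) (fun l : R => l *: w).
  exact: is_diff_scalel.
have := is_diffD (is_diff_comp e (sc (2^-1 *: (x + v)) _)) (is_diff_comp eN (sc (2^-1 *: (x - v)) _)).
move=> H; apply: (is_diff_ext H) => s; apply/rowP => j; rewrite /geodesicH /sh /ch /= !mxE /=; first by field.
by field.
Qed.

Lemma derive1_geodesic x v (t : R) : hyperboloid (geodesicH x v t) ->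
  derive1 (map_ji \o geodesicH x v) t = dmap_ji (geodesicH x v t) (sh t *: x + ch t *: v).
Proof.
move=> hx; have [x1 e1 _] := ball_coordinates hx.
have h0 := hyp_ht hx.
have [di _] := is_diff_map_i x1.
have [|dj _] := @is_diff_map_j R (map_i (geodesicH x v t)).
  by rewrite e1 mulf_neq0 ?invr_eq0// mulf_neq0 ?gt_eqF.
have [dg eg] := is_diff_geodesicH x v t.
have dig : differentiable (map_i \o geodesicH x v) t by exact: differentiable_comp.
have -> : map_ji \o geodesicH x v = map_j \o (map_i \o geodesicH x v) by [].
rewrite derive1E'; last exact: differentiable_comp.
by rewrite diff_comp// diff_comp//= eg /= scale1r.
Qed.
End GeodesicVelocity.

Section Geodesics.
Context {R : realType}.
Implicit Types (k b : spinor R) (z d : R[i]).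

Definition spinor_geodesic k b : R -> 'rV[R]_3 :=
  map_ji \o geodesicH (frH k b).1 (row 0 (frH k b).2).

Lemma oriented_spinor_geodesic k b : spinor_ip k b = 1 ->
  oriented_geodesic (spinor_geodesic k b) (ray (nullv b)) (ray (nullv k)).
Proof.
move=> kb; exists (frH k b).1, (row 0 (frH k b).2).
split; first exact: hyperboloid_frH.
split; first exact: frH_tangent.
split; first by rewrite (frH_orthonormal kb 0 0).
split=> //; rewrite /frH !row_mat3; split; exists 1; rewrite ?ltr01// scale1r.
  by apply/rowP => j; rewrite !mxE; field.
by apply/rowP => j; rewrite !mxE; field.
Qed.

Lemma adapted_spinor_geodesic k b z : spinor_ip k b = 1 ->
  (frU (cexp z *: k) (cexp (- z) *: b)).1 = spinor_geodesic k b (2 * Re z) /\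
  adapted (spinor_geodesic k b) (frU (cexp z *: k) (cexp (- z) *: b)).
Proof.
move=> kb; set t := 2 * Re z.
have tz : t / 2 = Re z by rewrite /t; field.
pose k' := (expR (t / 2))%:C *: k; pose b' := (expR (- (t / 2)))%:C *: b.
have kb' : spinor_ip k' b' = 1 by exact: ip_boost.
have T := translate_frH t k b.
have e1 : (frH k' b').1 = geodesicH (frH k b).1 (row 0 (frH k b).2) t by rewrite -T.
have e2 : row 0 (frH k' b').2 = sh t *: (frH k b).1 + ch t *: row 0 (frH k b).2.
  by rewrite -T rowK.
have E : frU (cexp z *: k) (cexp (- z) *: b) = rotate_frame 0 (2 * Im z) (frU k' b').
  have iz : 2 * Im z / 2 = Im z by field.
  by rewrite rotate_push rotate0_frH iz !cexp_polar -!scalerA ReN ImN cosN sinN -tz.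
have p1 : (frU (cexp z *: k) (cexp (- z) *: b)).1 = spinor_geodesic k b t.
  by rewrite E -[LHS]/(map_ji (frH k' b').1) e1.
split; first exact: p1.
exists t, 1; split; first exact: ltr01.
split; first exact: p1.
have -> : row 0 (frU (cexp z *: k) (cexp (- z) *: b)).2 = row 0 (frU k' b').2.
  by rewrite E rowK.
rewrite scale1r rowK e2 e1 derive1_geodesic; first by [].
by rewrite -e1; exact: hyperboloid_frH.
Qed.
End Geodesics.

(** * Complex lambda lengths *)

Section LambdaLength.
Context {R : realType} {Spin : topologicalType} {pr : Spin -> frame R}.
Hypothesis Hspin : is_spin_bundle pr.
Variable Kt : spinor R -> spin_dec_horosphere pr.
Hypothesis HKt : is_spin_lift Kt.
Implicit Types (k b : spinor R) (d z : R[i]).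

Lemma ip_inward k b : spinor_ip k b = 1 -> spinor_ip b (- k) = 1.
Proof. by move=> kb; rewrite ipNr ipC kb opprK. Qed.

Lemma ip_screw k b z : spinor_ip k b = 1 -> spinor_ip (cexp z *: k) (cexp (- z) *: b) = 1.
Proof. by move=> kb; rewrite ipZl ipZr kb mulr1 cexpVN. Qed.

(** Going from (b1, - k1) by d leads to a pair with first spinor
    e^{d/2} b1.  It gives the same spin frame as (k2, b2), hence
    k2 = e^{d/2} b1. *)
Lemma complex_distance_ip k1 k2 d : k1 != 0 -> k2 != 0 ->
  complex_distance (Kt k1) (Kt k2) d -> spinor_ip k1 k2 = cexp (d / 2).
Proof.
move=> k10 k20 [g [q1 [q2 [_ [[_ h1] [[_ h2] [_ [_ H]]]]]]]].
have [b1 kb1 [e1 _]] := sd_out_spin_frame HKt k10 h1.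
have [b2 kb2 [e2 _]] := sd_out_spin_frame HKt k20 h2.
have kb1' := ip_inward kb1.
move: H; rewrite e1 e2 (sd_in_spin_frame Hspin HKt kb1).
move/(spin_screwE Hspin HKt d _ kb1') => e.
have [-> _] := spin_frame_inj Hspin HKt (ip_screw (d / 2) kb1') kb2 (esym e).
by rewrite ipZr kb1 mulr1.
Qed.

Lemma ray_scale (p : 'rV[R]_4) (a : R) : 0 < a -> ray (a *: p) = ray p.
Proof.
move=> a0; apply/seteqP; split=> x [c c0 ->].
  by exists (c * a); rewrite ?mulr_gt0// scalerA.
by exists (c / a); rewrite ?divr_gt0// scalerA divfK// gt_eqF.
Qed.

Lemma centre_spin_horosphere k : k != 0 -> centre (dh_set (sd_dec (Kt k))) = ray (nullv k).
Proof. by move=> k0; rewrite (HKt.2 _ k0) (centre_map_K k0). Qed.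

(** The ray of [nullv k] is the centre of the horosphere of k, and multiplying
    k by c multiplies [nullv k] by |c|^2. *)
Lemma ray_nullv_eq k1 k2 : k1 != 0 -> k2 != 0 ->
  (ray (nullv k1) = ray (nullv k2)) <-> spinor_ip k1 k2 = 0.
Proof.
move=> k10 k20; split=> [e|].
  have [a a0 ea] : ray (nullv k2) (nullv k1) by rewrite -e; exists 1; rewrite ?scale1r.
  have : mink (nullv k1) (nullv k2) = 0.
    by rewrite ea minkZl mink_nullv ipkk /nsq /= expr0n /= addr0 !mulr0.
  by rewrite mink_nullv => /eqP; rewrite mulf_eq0 pnatr_eq0 /= nsq_eq0 => /eqP.
move=> /(ip_eq0 k10)[c ck]; rewrite ck nullvZ ray_scale// lt_def nsq_ge0 nsq_eq0 andbT.
by apply: contra_neq k20 => c0; rewrite ck c0 scale0r.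
Qed.

(** Writing {k1, k2} = e^z, the computation for a given distance is run
    backwards: b1 = e^{-z} k2 completes k1, b2 = - e^{-z} k1 completes k2, and
    2 z is the distance along the geodesic of the pair (b1, - k1). *)
Lemma complex_distance_exists k1 k2 : k1 != 0 -> k2 != 0 -> spinor_ip k1 k2 != 0 ->
  exists d, complex_distance (Kt k1) (Kt k2) d.
Proof.
move=> k10 k20 /[dup] w0 /cexp_surjective[z wz].
pose b1 := cexp (- z) *: k2.
have kb1 : spinor_ip k1 b1 = 1 by rewrite ipZr -wz mulrC cexpVN.
have kb1' := ip_inward kb1.
pose b2 := cexp (- z) *: - k1.
have ek2 : k2 = cexp z *: b1 by rewrite scalerA cexpVN scale1r.
have kb2 : spinor_ip k2 b2 = 1 by rewrite ek2; exact: ip_screw.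
have zE : 2 * z / 2 = z by field.
exists (2 * z), (spinor_geodesic b1 (- k1)), (frU k1 b1).1, (frU k2 b2).1.
have g0 := adapted_spinor_geodesic 0 kb1'.
have g1 := adapted_spinor_geodesic z kb1'.
rewrite oppr0 cexp0 !scale1r in g0; rewrite -ek2 -/b2 in g1.
have p1 : (frU k1 b1).1 = (frU b1 (- k1)).1.
  by rewrite /= nullvN addrC.
split; last split; last split.
- have := oriented_spinor_geodesic kb1'; rewrite nullvN.
  rewrite (centre_spin_horosphere k10) (centre_spin_horosphere k20) nullvZ ray_scale//.
  rewrite lt_def nsq_ge0 nsq_eq0 andbT; apply/eqP => c0.
  by move: (cexpVN z); rewrite c0 mulr0 => /eqP; rewrite eq_sym oner_eq0.
- by split; [exists (2 * Re 0) => //; rewrite p1 g0.1 | exact: dh_set_frU].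
- by split; [exists (2 * Re z) => //; rewrite g1.1 | exact: dh_set_frU].
rewrite (sd_in_spin_frame Hspin HKt kb1).
have -> : sd_out (Kt k2) (frU k2 b2).1 = spin_frame Kt k2 b2 by [].
split; first by rewrite (pr_spin_frame HKt)//; exact: g0.2.
split; first by rewrite (pr_spin_frame HKt)//; exact: g1.2.
apply/(spin_screwE Hspin HKt _ _ kb1').
by rewrite zE -ek2.
Qed.
End LambdaLength.

Theorem theorem3 (R : realType) (Spin : topologicalType) (pr : Spin -> frame R)
    (Hspin : is_spin_bundle pr)
    (Kt : spinor R -> spin_dec_horosphere pr) (HKt : is_spin_lift Kt)
    (k1 k2 : spinor R) (hk1 : k1 != 0) (hk2 : k2 != 0) :
  let c1 := centre (dh_set (sd_dec (Kt k1))) in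
  let c2 := centre (dh_set (sd_dec (Kt k2))) in
  (c1 <> c2 ->
     (exists d : R[i], complex_distance (Kt k1) (Kt k2) d) /\
     (forall d : R[i], complex_distance (Kt k1) (Kt k2) d ->
        spinor_ip k1 k2 = cexp (d / 2))) /\
  (c1 = c2 -> spinor_ip k1 k2 = 0).
Proof.
move=> c1 c2.
have e1 : c1 = ray (nullv k1) := centre_spin_horosphere HKt hk1.
have e2 : c2 = ray (nullv k2) := centre_spin_horosphere HKt hk2.
move: c1 c2 e1 e2 => _ _ -> ->.
split=> [ne|]; last by move/(ray_nullv_eq hk1 hk2).
split=> [|d]; last exact: complex_distance_ip.
by apply: complex_distance_exists => //; apply/eqP => /(ray_nullv_eq hk1 hk2).
Qed.
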